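(* Let $\mathbb K\in\{\mathbb R,\mathbb C\}$. Suppose $\theta\subset\Delta=\{\alpha_1,\dots,\alpha_{d-1}\}$ is symmetric, $\Omega\subset\mathbb P(\mathbb R^{d_0})$ is a properly convex domain, $\Gamma_0\subset\mathrm{Aut}(\Omega)$ is a non-elementary projectively visible subgroup, $\rho:\Gamma_0\to\mathsf{PSL}(d,\mathbb K)$ is a $\mathsf P_\theta$-transverse representation with limit map $\xi:\Lambda_\Omega(\Gamma_0)\to\mathcal F_\theta$, $\Gamma:=\rho(\Gamma_0)$, $\phi\in\mathfrak a_\theta^*$ and $\mu$ is a $\phi$-Patterson-Sullivan measure for $\Gamma$ of dimension $\beta$. For any $b_0\in\Omega$, there exists $R_0$ such that: if $r>R_0$, then there exists $C=C(b_0,r)>1$ so that $$C^{-1}e^{-\beta\phi(\kappa_\theta(\rho(\gamma)))}\le\mu\Big(\xi\big(\mathcal O_r(b_0,\gamma(b_0))\cap\Lambda_\Omega(\Gamma_0)\big)\Big)\le C e^{-\beta\phi(\kappa_\theta(\rho(\gamma)))}$$ for all $\gamma\in\Gamma_0$.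
   Context: Linear notation. $\mathfrak a=\{\mathrm{diag}(a_1,\dots,a_d): a_i\in\mathbb R,\ \sum a_i=0\}$. The Cartan projection of $g\in\mathsf{PSL}(d,\mathbb K)$ is $\kappa(g)=\mathrm{diag}(\log\sigma_1(g),\dots,\log\sigma_d(g))$, where $\sigma_1(g)\ge\dots\ge\sigma_d(g)$ are the singular values of a lift to $\mathsf{SL}(d,\mathbb K)$. Simple roots: $\alpha_j(\mathrm{diag}(a_1,\dots,a_d))=a_j-a_{j+1}$; fundamental weights: $\omega_{\alpha_j}(\mathrm{diag}(a_1,\dots,a_d))=a_1+\dots+a_j$. $\theta$ is symmetric if $\alpha_k\in\theta\iff\alpha_{d-k}\in\theta$. $\mathfrak a_\theta=\{\mathrm{diag}(a_1,\dots,a_d)\in\mathfrak a:a_j=a_{j+1}\text{ for all }\alpha_j\notin\theta\}$; the $\omega_\alpha|_{\mathfrak a_\theta}$, $\alpha\in\theta$, form a basis of $\mathfrak a_\theta^*$. $\kappa_\theta(g)\in\mathfrak a_\theta$ is defined by $\omega_\alpha(\kappa_\theta(g))=\omega_\alpha(\kappa(g))$ for all $\alpha\in\theta$. $\mathcal F_\theta$ is the manifold of partial flags $F=(F^j)_{\alpha_j\in\theta}$ in $\mathbb K^d$, $\dim F^j=j$; $F,G$ are transverse if $F^j\oplus G^{d-j}=\mathbb K^d$ for all $\alpha_j\in\theta$; $\mathcal Z_F$ is the set of flags not transverse to $F$. The partial Iwasawa cocycle $B_\theta:\mathsf{PSL}(d,\mathbb K)\times\mathcal F_\theta\to\mathfrak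 a_\theta$ is defined by $\omega_{\alpha_j}(B_\theta(g,F))=\log\frac{\|(\bigwedge^jg)v\|}{\|v\|}$ for $\alpha_j\in\theta$ and any nonzero $v\in\bigwedge^jF^j$ (standard norms). Convex domains. A properly convex domain $\Omega\subset\mathbb P(\mathbb R^{m})$ is an open set that is convex and bounded in some affine chart. For $x,y\in\overline\Omega$, $[x,y]_\Omega$ is the closed projective segment in $\overline\Omega$ joining them, and $(x,y)_\Omega$, $[x,y)_\Omega$ are obtained by removing both endpoints, resp. $y$. The Hilbert metric is $\mathrm d_\Omega(p,q)=\log\frac{|x-q||y-p|}{|x-p||y-q|}$ where $x,y\in\partial\Omega$ are such that $x,p,q,y$ lie in this order on a projective line. $\mathrm{Aut}(\Omega)\subset\mathsf{PGL}(m,\mathbb R)$ is the stabilizer of $\Omega$. A point $x\in\partial\Omega$ is $C^1$-smooth if there is a unique projective hyperplane through $x$ disjoint from $\Omega$. For an infinite discrete subgroup $\Gamma_0\subset\mathrm{Aut}(\Omega)$, $\Lambda_\Omega(\Gamma_0)$ is the set of $x\in\partial\Omega$ with $x=\lim\gamma_n(p)$ for some $p\in\Omega$, $\{\gamma_n\}\subset\Gamma_0$. A discrete $\Gamma_0\subset\mathrm{Aut}(\Omega)$ is projectively visible if $(x,y)_\Omega\subset\Omega$ for all distinct $x,y\in\Lambda_\Omega(\Gamma_0)$ and every point of $\Lambda_\Omega(\Gamma_0)$ is a $C^1$-smooth point of $\partial\Omega$; it is non-elementary if $\Lambda_\Omega(\Gamma_0)$ is infinite. For $b,p\in\Omega$,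 $r>0$, the shadow is $\mathcal O_r(b,p)=\{x\in\partial\Omega:\mathrm d_\Omega(p,[b,x)_\Omega)<r\}$. Transverse representations. $\rho:\Gamma_0\to\mathsf{PSL}(d,\mathbb K)$ is $\mathsf P_\theta$-transverse if there is a continuous $\rho$-equivariant embedding $\xi:\Lambda_\Omega(\Gamma_0)\to\mathcal F_\theta$ (the limit map) such that distinct flags in the image are transverse and, whenever $\{\gamma_n\}\subset\Gamma_0$ satisfies $\gamma_n(b_0)\to x\in\Lambda_\Omega(\Gamma_0)$ and $\gamma_n^{-1}(b_0)\to y\in\Lambda_\Omega(\Gamma_0)$ for some (any) $b_0\in\Omega$, one has $\rho(\gamma_n)(F)\to\xi(x)$ for all $F\in\mathcal F_\theta\setminus\mathcal Z_{\xi(y)}$. In this case the limit set $\Lambda_\theta(\Gamma)$ of $\Gamma=\rho(\Gamma_0)$ equals $\xi(\Lambda_\Omega(\Gamma_0))$. A $\phi$-Patterson-Sullivan measure for $\Gamma$ of dimension $\beta$ is a Borel probability measure $\mu$ on $\mathcal F_\theta$ supported on $\Lambda_\theta(\Gamma)$ such that for all $\gamma\in\Gamma$ the measures $\mu,\gamma_*\mu$ are mutually absolutely continuous with $\frac{d\gamma_*\mu}{d\mu}=e^{-\beta\phi(B_\theta(\gamma^{-1},\cdot))}$ almost everywhere. *)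

(* Defs.v *)
From HB Require Import structures.
From mathcomp Require Import all_boot all_order all_algebra.
From mathcomp Require Import complex.
From mathcomp Require Import all_classical all_reals all_analysis.

Set Implicit Arguments.
Unset Strict Implicit.
Unset Printing Implicit Defensive.

Import Order.TTheory GRing.Theory Num.Theory.
Import numFieldNormedType.Exports.

Local Open Scope classical_set_scope.
Local Open Scope ring_scope.
Local Open Scope quotient_scope.

Inductive scalar_kind := RealScalars | ComplexScalars.

Definition scalars (R : realType) (k : scalar_kind) : numFieldType :=
  match k with
  | RealScalars => R
  | ComplexScalars => R[i]
  end.

Definition scalar_of_real (R : realType) (k : scalar_kind) : R -> scalars R k :=
  match k return R -> scalars R k with
  | RealScalars => fun x => x
  | ComplexScalars => fun x => (x%:C)%C
  end.

Definition scalar_conj (R : realType) (k : scalar_kind) :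
    scalars R k -> scalars R k :=
  match k return scalars R k -> scalars R k with
  | RealScalars => fun x => x
  | ComplexScalars => fun z => (z^*)%C
  end.

(* The norm of [R[i]] takes its values in [R[i]]. *)
Definition scalar_abs (R : realType) (k : scalar_kind) : scalars R k -> R :=
  match k return scalars R k -> R with
  | RealScalars => fun x => `|x|
  | ComplexScalars => fun z => complex.Re `|z|
  end.

Definition final_topology {S T : Type} (f : S -> T) : Type := T.

Section FinalTopology.
Context {S : topologicalType} {T : choiceType} (f : S -> T).
Local Notation W := (final_topology f).

Definition final_open : set_system W := [set U | open (f @^-1` U)].

Lemma final_openT : final_open setT.
Proof. by rewrite /final_open /= preimage_setT; exact: openT. Qed.

Lemma final_openI : setI_closed final_open.
Proof. by move=> A B oA oB; exact: openI. Qed.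

Lemma final_open_bigU (I : Type) (g : I -> set W) :
  (forall i, final_open (g i)) -> final_open (\bigcup_i g i).
Proof.
move=> og; rewrite /final_open /= preimage_bigcup.
by apply: bigcup_open => i _; exact: og.
Qed.

HB.instance Definition _ := Choice.on W.
HB.instance Definition _ :=
  isOpenTopological.Build W final_openT final_openI final_open_bigU.
End FinalTopology.

(* [linear_group true n] is SL(n, K) and [linear_group false n] is GL(n, K);  *)
(* [projective_group special n] is its quotient by the scalar matrices that   *)
(* it contains, which are exactly its centre.                                 *)
Section ProjectiveGroups.
Context (K : numFieldType) (special : bool) (n : nat).

Definition in_linear_group (A : 'M[K]_n) : bool :=
  if special then \det A == 1 else A \in unitmx.

Lemma in_linear_group_unit (A : 'M[K]_n) : in_linear_group A -> A \in unitmx.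
Proof.
rewrite /in_linear_group; case: special => // /eqP dA.
by rewrite unitmxE dA unitr1.
Qed.

Record linear_group :=
  LinearGroup { matrix_of :> 'M[K]_n; _ : in_linear_group matrix_of }.

HB.instance Definition _ := [isSub for matrix_of].
HB.instance Definition _ := [Choice of linear_group by <:].
HB.instance Definition _ := Topological.copy linear_group
  (initial_topology matrix_of).

Lemma linear_group_unit (g : linear_group) : (g : 'M[K]_n) \in unitmx.
Proof. by case: g => A; exact: in_linear_group_unit. Qed.

Lemma linear_group1 : in_linear_group 1%:M.
Proof.
by rewrite /in_linear_group; case: special; rewrite ?det1 ?unitmx1.
Qed.

Lemma linear_groupM (g h : linear_group) : in_linear_group (g *m h).
Proof.
case: g h => [g +] [h] /=; rewrite /in_linear_group.
case: special => [/eqP gE /eqP hE|gu hu].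
  by rewrite det_mulmx gE hE mulr1.
by rewrite unitmx_mul gu.
Qed.

Lemma linear_groupV (g : linear_group) : in_linear_group (invmx g).
Proof.
case: g => g /=; rewrite /in_linear_group.
case: special => [/eqP gE|gu]; last by rewrite unitmx_inv.
by rewrite det_inv gE invr1.
Qed.

Definition lg_one := LinearGroup linear_group1.
Definition lg_mul g h := LinearGroup (linear_groupM g h).
Definition lg_inv g := LinearGroup (linear_groupV g).

Lemma lg_mulA : associative lg_mul.
Proof. by move=> a b c; apply: val_inj; rewrite /= mulmxA. Qed.
Lemma lg_mul1 : left_id lg_one lg_mul.
Proof. by move=> a; apply: val_inj; rewrite /= mul1mx. Qed.
Lemma lg_mulr1 : right_id lg_one lg_mul.
Proof. by move=> a; apply: val_inj; rewrite /= mulmx1. Qed.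
Lemma lg_mulV : left_inverse lg_one lg_inv lg_mul.
Proof.
by move=> a; apply: val_inj; rewrite /= mulVmx// linear_group_unit.
Qed.
Lemma lg_mulrV : right_inverse lg_one lg_inv lg_mul.
Proof.
by move=> a; apply: val_inj; rewrite /= mulmxV// linear_group_unit.
Qed.

HB.instance Definition _ := isGroup.Build linear_group
  lg_mulA lg_mul1 lg_mulr1 lg_mulV lg_mulrV.

Definition proportional (g h : linear_group) : bool :=
  `[< exists2 c : K, c != 0 & (g : 'M[K]_n) = c *: (h : 'M[K]_n) >].

Lemma proportional_refl : reflexive proportional.
Proof. by move=> g; apply/asboolP; exists 1; rewrite ?oner_neq0 ?scale1r. Qed.

Lemma proportional_sym : symmetric proportional.
Proof.
have H g h : proportional g h -> proportional h g.
  move=> /asboolP[c c0 gh]; apply/asboolP; exists c^-1.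
    by rewrite invr_eq0.
  by rewrite gh scalerA mulVf// scale1r.
by move=> g h; apply/idP/idP; exact: H.
Qed.

Lemma proportional_trans : transitive proportional.
Proof.
move=> h g l /asboolP[c c0 gh] /asboolP[e e0 hl]; apply/asboolP.
by exists (c * e); rewrite ?mulf_neq0// gh hl scalerA.
Qed.

Canonical proportional_equiv :=
  EquivRel proportional proportional_refl proportional_sym proportional_trans.

Definition projective_group :=
  quotient_topology {eq_quot proportional_equiv}.

HB.instance Definition _ := Topological.on projective_group.
HB.instance Definition _ := Quotient.on projective_group.

Lemma pi_projective_eq (g h : linear_group) :
  reflect (exists2 c : K, c != 0 & (g : 'M[K]_n) = c *: (h : 'M[K]_n))
          (\pi_projective_group g == \pi_projective_group h).
Proof.
apply: (iffP eqP) => [/eqmodP /asboolP //|gh].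
by apply/eqmodP/asboolP.
Qed.

Definition pg_one : projective_group := \pi_projective_group lg_one.
Definition pg_mul (x y : projective_group) : projective_group :=
  \pi_projective_group (lg_mul (repr x) (repr y)).
Definition pg_inv (x : projective_group) : projective_group :=
  \pi_projective_group (lg_inv (repr x)).

Lemma pi_pg_mul g h :
  \pi_projective_group (lg_mul g h) =
  pg_mul (\pi_projective_group g) (\pi_projective_group h).
Proof.
rewrite /pg_mul; apply/eqP/pi_projective_eq.
case: (piP projective_group g) => g' /eqP/pi_projective_eq[c c0 gE].
case: (piP projective_group h) => h' /eqP/pi_projective_eq[e e0 hE].
exists (c * e); first by rewrite mulf_neq0.
by rewrite /= gE hE -scalemxAl -scalemxAr scalerA.
Qed.

Lemma pg_mulA : associative pg_mul.
Proof.
move=> x y z; rewrite -[x]reprK -[y]reprK -[z]reprK.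
move: (repr x) (repr y) (repr z) => a b c.
rewrite -(pi_pg_mul b c) -(pi_pg_mul a b).
by rewrite -(pi_pg_mul a (lg_mul b c)) -(pi_pg_mul (lg_mul a b) c) lg_mulA.
Qed.

Lemma pg_mul1 : left_id pg_one pg_mul.
Proof.
by move=> x; rewrite -[x]reprK -(pi_pg_mul lg_one (repr x)) lg_mul1.
Qed.

Lemma pg_mulr1 : right_id pg_one pg_mul.
Proof.
by move=> x; rewrite -[x]reprK -(pi_pg_mul (repr x) lg_one) lg_mulr1.
Qed.

Lemma pg_mulV : left_inverse pg_one pg_inv pg_mul.
Proof.
move=> x; rewrite -[X in pg_mul _ X]reprK.
by rewrite -(pi_pg_mul (lg_inv (repr x)) (repr x)) lg_mulV.
Qed.

Lemma pg_mulrV : right_inverse pg_one pg_inv pg_mul.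
Proof.
move=> x; rewrite -[X in pg_mul X _]reprK.
by rewrite -(pi_pg_mul (repr x) (lg_inv (repr x))) lg_mulrV.
Qed.

HB.instance Definition _ := isGroup.Build projective_group
  pg_mulA pg_mul1 pg_mulr1 pg_mulV pg_mulrV.

Definition lift_mx (g : projective_group) : 'M[K]_n := repr g : linear_group.

Lemma lift_mx_unit g : lift_mx g \in unitmx.
Proof. exact: linear_group_unit. Qed.

End ProjectiveGroups.

Notation GL K n := (linear_group K false n).
Notation PGL K n := (projective_group K false n).
Notation PSL K n := (projective_group K true n).

Section LinearAction.
Context (K : numFieldType) (n : nat).

Definition lmul (A : 'M[K]_n) : 'End('cV[K]_n) :=
  linfun (mulmx A : 'cV[K]_n -> 'cV[K]_n).

Lemma dim_lmul (A : 'M[K]_n) (U : {vspace 'cV[K]_n}) :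
  A \in unitmx -> \dim (lmul A @: U) = \dim U.
Proof.
move=> Au; apply: limg_dim_eq.
suff -> : lker (lmul A) = 0%VS by rewrite capv0.
apply/eqP/lker0P => u v; rewrite !lfunE /= => /(congr1 (mulmx (invmx A))).
by rewrite !mulKmx.
Qed.

End LinearAction.

Section ProjectiveSpace.
Context (K : numFieldType) (n : nat).

Record nonzero_vector :=
  NonzeroVector { vector_of :> 'cV[K]_n; _ : vector_of != 0 }.

HB.instance Definition _ := [isSub for vector_of].
HB.instance Definition _ := [Choice of nonzero_vector by <:].
HB.instance Definition _ := Topological.copy nonzero_vector
  (initial_topology vector_of).

Record projective_space := ProjectivePoint
  { line_of :> {vspace 'cV[K]_n}; _ : \dim line_of == 1 }.

HB.instance Definition _ := [isSub for line_of].
HB.instance Definition _ := [Choice of projective_space by <:].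

Lemma dim_nonzero_line (v : nonzero_vector) : \dim <[v : 'cV[K]_n]> == 1.
Proof. by case: v => v v0 /=; rewrite dim_vline v0. Qed.

Definition proj_of (v : nonzero_vector) : projective_space :=
  ProjectivePoint (dim_nonzero_line v).

HB.instance Definition _ := Topological.copy projective_space
  (final_topology proj_of).

Lemma proj_act_subproof special (g : projective_group K special n)
    (x : projective_space) :
  \dim (lmul (lift_mx g) @: x) == 1.
Proof. by rewrite dim_lmul ?lift_mx_unit//; case: x. Qed.

Definition proj_act special (g : projective_group K special n)
    (x : projective_space) :
  projective_space := ProjectivePoint (proj_act_subproof g x).

End ProjectiveSpace.

Section Flags.
Context (K : numFieldType) (d : nat).

(* The simple root $\alpha_{j+1}$ is represented by [j : 'I_d.-1], so that   *)
(* [rev_ord j] represents $\alpha_{d-(j+1)}$.                                *)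
Definition symmetric_roots (theta : {set 'I_d.-1}) : Prop :=
  forall j, (rev_ord j \in theta) = (j \in theta).

Context (theta : {set 'I_d.-1}).

Definition root_in := {j : 'I_d.-1 | j \in theta}.

Definition is_flag (F : {ffun root_in -> {vspace 'cV[K]_d}}) : bool :=
  [forall j : root_in, \dim (F j) == (val j).+1] &&
  [forall i : root_in, forall j : root_in,
    (val i <= val j)%N ==> (F i <= F j)%VS].

Record flag := Flag
  { subspaces_of :> {ffun root_in -> {vspace 'cV[K]_d}};
    _ : is_flag subspaces_of }.

HB.instance Definition _ := [isSub for subspaces_of].
HB.instance Definition _ := [Choice of flag by <:].

Definition standard_basis : seq 'cV[K]_d := [seq delta_mx i 0 | i : 'I_d].

Lemma standard_basisP : basis_of fullv standard_basis.
Proof.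
rewrite basisEdim; apply/andP; split; last first.
  by rewrite size_map -cardE card_ord dimvf /dim /= muln1.
apply/subvP => v _; rewrite (matrix_sum_delta v); apply: memv_suml => i _.
apply: memv_suml => j _; apply: memvZ; apply: memv_span.
by rewrite ord1; apply/mapP; exists i; rewrite ?mem_enum.
Qed.

Lemma standard_flag_subproof :
  is_flag [ffun j : root_in => <<take (val j).+1 standard_basis>>%VS].
Proof.
have fr := basis_free standard_basisP.
have sz : size standard_basis = d by rewrite size_map -cardE card_ord.
apply/andP; split; apply/forallP => i; last first.
  apply/forallP => j; apply/implyP => ij; rewrite !ffunE.
  apply: sub_span => v; rewrite -(@take_takel _ (val i).+1 (val j).+1)//.
  exact: mem_take.
rewrite ffunE; apply/eqP.
have := fr; rewrite -{1}(cat_take_drop (val i).+1 standard_basis) => /catl_free.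
move=> /eqP ->; rewrite size_takel// sz.
by have := ltn_ord (val i); rewrite ltn_predRL => /ltnW.
Qed.

Definition standard_flag : flag := Flag standard_flag_subproof.

HB.instance Definition _ := isPointed.Build flag standard_flag.

Lemma linear_act_subproof (A : 'M[K]_d) (F : flag) : A \in unitmx ->
  is_flag [ffun j => (lmul A @: F j)%VS].
Proof.
move=> Au; case: F => F /= /andP[/forallP dF /forallP sF].
apply/andP; split; apply/forallP => i; first by rewrite ffunE dim_lmul.
apply/forallP => j; apply/implyP => ij; rewrite !ffunE; apply: limgS.
by have /forallP/(_ j)/implyP := sF i; exact.
Qed.

Definition linear_act (g : GL K d) (F : flag) : flag :=
  Flag (linear_act_subproof F (linear_group_unit g)).

(* The topology of $\mathcal F_\theta$ as a homogeneous space of GL(d, K).  *)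
HB.instance Definition _ := Topological.copy flag
  (final_topology (linear_act^~ standard_flag)).

Definition flag_act special (g : projective_group K special d) (F : flag) :
  flag := Flag (linear_act_subproof F (lift_mx_unit g)).

Definition borel_flag := g_sigma_algebraType (@open flag).

Definition transverse_flags (F G : flag) : Prop :=
  forall i j : root_in, ((val i).+1 + (val j).+1 = d)%N ->
    (F i + G j)%VS = fullv /\ (F i :&: G j)%VS = 0%VS.

End Flags.

Section CartanTheta.
Context (R : realType) (d : nat).

Lemma root_snd_subproof (j : 'I_d.-1) : (j.+1 < d)%N.
Proof. by rewrite -ltn_predRL. Qed.

Definition root_fst (j : 'I_d.-1) : 'I_d := widen_ord (leq_pred d) j.
Definition root_snd (j : 'I_d.-1) : 'I_d := Ordinal (root_snd_subproof j).

(* Diagonal matrices are represented by the row of their diagonal entries. *)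
Definition simple_root (j : 'I_d.-1) (a : 'rV[R]_d) : R :=
  a 0 (root_fst j) - a 0 (root_snd j).

Definition fundamental_weight (j : 'I_d.-1) (a : 'rV[R]_d) : R :=
  \sum_(i < d | (i <= j)%N) a 0 i.

Context (theta : {set 'I_d.-1}).

Definition in_a_theta : {pred 'rV[R]_d} := fun a =>
  (\sum_(i < d) a 0 i == 0) &&
  [forall j, (j \notin theta) ==> (simple_root j a == 0)].

Lemma in_a_theta_submod : submod_closed in_a_theta.
Proof.
split=> [|c a b /andP[/eqP a0 /forallP ar] /andP[/eqP b0 /forallP br]].
  apply/andP; split; first by rewrite big1// => i _; rewrite mxE.
  by apply/forallP => j; apply/implyP => _; rewrite /simple_root !mxE subrr.
apply/andP; split.
  rewrite (eq_bigr (fun i => c * a 0 i + b 0 i)).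
    by rewrite big_split /= -mulr_sumr a0 b0 mulr0 addr0.
  by move=> i _; rewrite !mxE.
apply/forallP => j; apply/implyP => jt.
have /implyP/(_ jt) := ar j; have /implyP/(_ jt) := br j.
rewrite /simple_root !mxE !subr_eq0 => /eqP -> /eqP ->; exact: eqxx.
Qed.

HB.instance Definition _ :=
  GRing.isSubmodClosed.Build R 'rV[R]_d in_a_theta in_a_theta_submod.

Record a_theta := ATheta { diag_of :> 'rV[R]_d; _ : diag_of \in in_a_theta }.

HB.instance Definition _ := [isSub for diag_of].
HB.instance Definition _ := [Choice of a_theta by <:].
HB.instance Definition _ := [SubChoice_isSubZmodule of a_theta by <:].
HB.instance Definition _ := [SubZmodule_isSubLmodule of a_theta by <:].

End CartanTheta.

Section ExteriorPower.
Context (R : realType) (k : scalar_kind) (d : nat).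
Local Notation K := (scalars R k).

(* [exterior j] is the j-th exterior power of K^d in the coordinates of the   *)
(* basis e_{f 0} /\ ... /\ e_{f (j-1)}, where f is strictly increasing; this  *)
(* basis is orthonormal for the standard norm.                                *)
Definition increasing_map (j : nat) :=
  {f : {ffun 'I_j -> 'I_d} |
    [forall a : 'I_j, forall b : 'I_j, (a < b)%N ==> (f a < f b)%N]}.

Definition exterior (j : nat) := {ffun increasing_map j -> K}.

Definition wedge_product (j : nat) (s : j.-tuple 'cV[K]_d) : exterior j :=
  [ffun f : increasing_map j =>
    \det (\matrix_(a < j, b < j) tnth s b (val f a) 0)].

(* The coordinates of the j-th exterior power of a linear map are the minors  *)
(* of its matrix.                                                             *)
Definition exterior_map (j : nat) (A : 'M[K]_d) (v : exterior j) : exterior j :=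
  [ffun f : increasing_map j =>
    \sum_(h : increasing_map j) \det (mxsub (val f) (val h) A) * v h].

Definition exterior_norm (j : nat) (v : exterior j) : R :=
  Num.sqrt (\sum_f scalar_abs (v f) ^+ 2).

End ExteriorPower.

Section Projections.
Context (R : realType) (k : scalar_kind) (d : nat) (theta : {set 'I_d.-1}).
Local Notation K := (scalars R k).

Definition conj_transpose (A : 'M[K]_d) : 'M[K]_d :=
  map_mx (@scalar_conj R k) A^T.

Definition is_singular_values (A : 'M[K]_d) (s : 'rV[R]_d) : Prop :=
  [/\ forall i, 0 <= s 0 i,
      forall i j : 'I_d, (i <= j)%N -> s 0 j <= s 0 i &
      char_poly (conj_transpose A *m A) =
        \prod_(i < d) ('X - (scalar_of_real k (s 0 i ^+ 2))%:P)].

Definition singular_values (A : 'M[K]_d) : 'rV[R]_d :=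
  xget 0 [set s | is_singular_values A s].

Definition kappa (g : PSL K d) : 'rV[R]_d :=
  map_mx (@ln R) (singular_values (lift_mx g)).

Definition kappa_theta (g : PSL K d) : a_theta R theta :=
  xget 0 [set a : a_theta R theta | forall j : 'I_d.-1, j \in theta ->
    fundamental_weight j a = fundamental_weight j (kappa g)].

(* As $\bigwedge^jF^j$ is a line, its nonzero elements are the nonzero        *)
(* $v_1\wedge\dots\wedge v_j$ with all $v_i\in F^j$.                          *)
Definition iwasawa_cocycle (g : PSL K d) (F : flag K theta) : a_theta R theta :=
  xget 0 [set b : a_theta R theta |
    forall (j : root_in theta) (s : (val j).+1.-tuple 'cV[K]_d),
      (forall i, tnth s i \in F j) -> wedge_product s != 0 ->
      fundamental_weight (val j) b =
        ln (exterior_norm (exterior_map (lift_mx g) (wedge_product s)) /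
            exterior_norm (wedge_product s))].

(* The integral formula says that $e^{-\beta\phi(B_\theta(g^{-1},\cdot))}$ is *)
(* a version of the Radon-Nikodym derivative of gmu with respect to mu.       *)
Definition patterson_sullivan (Gamma : set (PSL K d))
    (Lambda : set (flag K theta)) (phi : {scalar a_theta R theta}) (beta : R)
    (mu : probability (borel_flag K theta) R) : Prop :=
  mu.-negligible (~` Lambda) /\
  forall g, Gamma g ->
    let gmu := pushforward mu
      (flag_act g : borel_flag K theta -> borel_flag K theta) in
    [/\ gmu `<< mu, mu `<< gmu &
        forall A : set (borel_flag K theta), measurable A ->
          gmu A = (\int[mu]_(F in A)
            (expR (- beta * phi (iwasawa_cocycle g^-1%g F)))%:E)%E].

End Projections.

Section ConvexDomains.
Context (R : realType) (m : nat).
Local Notation P := (projective_space R m).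

(* A linear form f determines the affine chart {[v] | f v = 1}.               *)
Definition in_chart (f : 'rV[R]_m) (x : P) (v : 'cV[R]_m) : Prop :=
  v \in line_of x /\ (f *m v) 0 0 = 1.

Definition chart_image (f : 'rV[R]_m) (Omega : set P) : set 'cV[R]_m :=
  [set v | exists2 x, Omega x & in_chart f x v].

Definition convex_bounded_chart (Omega : set P) (f : 'rV[R]_m) : Prop :=
  [/\ f != 0,
      forall x, Omega x -> exists v, in_chart f x v,
      convex_set (chart_image f Omega) &
      bounded_set (chart_image f Omega)].

Definition properly_convex_domain (Omega : set P) : Prop :=
  open Omega /\ exists f, convex_bounded_chart Omega f.

Definition boundary (Omega : set P) : set P := closure Omega `\` interior Omega.

Definition segment_between (v w : 'cV[R]_m) : set P :=
  [set z | exists2 t : R, 0 <= t <= 1 &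
    line_of z = <[(1 - t) *: v + t *: w]>%VS].

Definition closed_segment (Omega : set P) (x y : P) : set P :=
  [set z | exists v w, [/\ line_of x = <[v]>%VS, line_of y = <[w]>%VS,
    segment_between v w `<=` closure Omega & segment_between v w z]].

Definition open_segment (Omega : set P) (x y : P) : set P :=
  closed_segment Omega x y `\` [set x; y].

Definition half_open_segment (Omega : set P) (x y : P) : set P :=
  closed_segment Omega x y `\ y.

(* The cross ratio is computed in an affine chart in which Omega is bounded;  *)
(* the case p = q gives the value 0.                                          *)
Definition hilbert_dist (Omega : set P) (p q : P) : R :=
  xget 0 [set r | exists f x y (vx vp vq vy : 'cV[R]_m) (s t : R),
    [/\ convex_bounded_chart Omega f,
        boundary Omega x /\ boundary Omega y,
        [/\ in_chart f x vx, in_chart f p vp, in_chart f q vq &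
            in_chart f y vy],
        [/\ vx != vy, 0 <= s <= t, t <= 1,
            vp = (1 - s) *: vx + s *: vy & vq = (1 - t) *: vx + t *: vy] &
        r = ln ((`|vx - vq| * `|vy - vp|) / (`|vx - vp| * `|vy - vq|))]].

Definition automorphisms (Omega : set P) : set (PGL R m) :=
  [set g | proj_act g @` Omega = Omega].

Definition C1_smooth (Omega : set P) (x : P) : Prop :=
  exists! H : {vspace 'cV[R]_m},
    [/\ (\dim H).+1 = m, (line_of x <= H)%VS &
        forall p, Omega p -> ~~ (line_of p <= H)%VS].

Definition discrete_subgroup (Gamma0 : set (PGL R m)) : Prop :=
  group_closed (mem Gamma0) /\ forall g, Gamma0 g -> isolated Gamma0 g.

Definition limit_set (Omega : set P) (Gamma0 : set (PGL R m)) : set P :=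
  [set x | boundary Omega x /\
    exists p (gamma : nat -> PGL R m), [/\ Omega p, forall n, Gamma0 (gamma n) &
      (fun n => proj_act (gamma n) p) @ \oo --> x]].

Definition projectively_visible (Omega : set P) (Gamma0 : set (PGL R m)) :
    Prop :=
  [/\ discrete_subgroup Gamma0, Gamma0 `<=` automorphisms Omega,
      forall x y, limit_set Omega Gamma0 x -> limit_set Omega Gamma0 y ->
        x != y -> open_segment Omega x y `<=` Omega &
      forall x, limit_set Omega Gamma0 x -> C1_smooth Omega x].

Definition non_elementary (Omega : set P) (Gamma0 : set (PGL R m)) : Prop :=
  infinite_set (limit_set Omega Gamma0).

Definition shadow (Omega : set P) (r : R) (b p : P) : set P :=
  [set x | boundary Omega x /\
    inf [set hilbert_dist Omega p q | q in half_open_segment Omega b x] < r].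

End ConvexDomains.

Section TransverseRepresentations.
Context (R : realType) (m : nat) (k : scalar_kind) (d : nat).
Context (theta : {set 'I_d.-1}).
Local Notation K := (scalars R k).

Definition representation (Gamma0 : set (PGL R m)) (rho : PGL R m -> PSL K d) :
    Prop :=
  {in Gamma0 &, {morph rho : g h / (g * h)%g}}.

Definition embedding_on (Lambda : set (projective_space R m))
    (xi : projective_space R m -> flag K theta) : Prop :=
  [/\ {within Lambda, continuous xi}, {in Lambda &, injective xi} &
      forall U, open U -> exists2 V, open V &
        xi @` (Lambda `&` U) = xi @` Lambda `&` V].

Definition transverse_with_limit_map (Omega : set (projective_space R m))
    (Gamma0 : set (PGL R m)) (rho : PGL R m -> PSL K d)
    (xi : projective_space R m -> flag K theta) : Prop :=
  let Lambda := limit_set Omega Gamma0 in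
  [/\ embedding_on Lambda xi,
      forall g x, Gamma0 g -> Lambda x ->
        xi (proj_act g x) = flag_act (rho g) (xi x),
      forall x y, Lambda x -> Lambda y -> xi x != xi y ->
        transverse_flags (xi x) (xi y) &
      forall (gamma : nat -> PGL R m) b0 x y,
        (forall n, Gamma0 (gamma n)) -> Omega b0 -> Lambda x -> Lambda y ->
        (fun n => proj_act (gamma n) b0) @ \oo --> x ->
        (fun n => proj_act (gamma n)^-1%g b0) @ \oo --> y ->
        forall F, transverse_flags F (xi y) ->
          (fun n => flag_act (rho (gamma n)) F) @ \oo --> xi x].

End TransverseRepresentations.

(* Main.v *)
From HB Require Import structures.
Require Import Defs.
From mathcomp Require Import all_boot all_order all_algebra all_fingroup.
From mathcomp Require Import ring lra zify.
From mathcomp Require Import complex.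
From mathcomp Require Import all_classical all_reals all_analysis.

(* Since [mu] is quasi-invariant, the mass of the image of the shadow
   O_r(b0, g b0) is the integral of exp(- beta phi (B(rho g, F))) over the image
   of the shadow O_r(g^-1 b0, b0).  Two facts then give the estimate.

   (a) On this image, B(rho g, F) stays at bounded distance from the Cartan
   projection of rho g.  Otherwise take a bad sequence with g_n b0 -> x and
   g_n^-1 b0 -> y.  The matrices of j-minors of rho g_n, divided by their norms,
   converge to some T along a subsequence.  Applying rho g_n^-1 to flags
   transverse to xi x forces T to be of rank one, T v = u (q v), where q are the
   Pluecker coordinates of the annihilator of xi y.  Points of the shadows cannot
   accumulate at y, and q does not vanish on flags transverse to xi y, so the
   expansion of rho g_n on these flags is comparable to the norm of the minors.

   (b) The mass of the image of O_r(g^-1 b0, b0) is bounded below for r large.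
   Otherwise, along a sequence g_n^-1 b0 -> y, these shadows exhaust the limit
   set minus y, and [mu] is a Dirac mass at xi y.  By quasi-invariance y is fixed
   by the whole group, which is impossible: a contracting element g has another
   fixed point b, some h moves b, and elements g^-i h g^n with i, n large would
   keep a triple (y, b, z) of points in a compact set of distinct triples
   without converging in the group. *)

Set Implicit Arguments.
Unset Strict Implicit.
Unset Printing Implicit Defensive.

Import Order.TTheory GRing.Theory Num.Theory.
Import numFieldNormedType.Exports.

Local Open Scope classical_set_scope.
Local Open Scope ring_scope.

(** * Minors and singular values *)

(** Transversality gives convergence of [rho (gamma n) F] for each fixed flag [F] only, while both
    facts need flags that move with [n]. This is what the limit of normalised minors is for: once it
    has rank one, convergence along moving flags follows by continuity of a bilinear expression,
    without any estimate of gaps between singular values. For this reason flags are handled through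
    invertible frames, where convergence is entrywise, and the Cartan projection through sums of
    absolute values of minors, which replace products of singular values up to bounded factors.

    On the convex side points become vectors of an open cone. There the Hilbert distance is an order
    relation, so a shadow is a pair of inequalities that pass to limits.

    In (b) the radii tend to infinity along the bad sequence, which is why one lower bound serves
    all [r] beyond [R0]. In its last step [i] is the first time at which [g^-i h g^n z] leaves a
    fixed ball around [y]: that point is then away from [y], and also from [b], since one step
    earlier it was still in the ball while [g] fixes [b]. *)

Section CauchyBinet.
Context (K : comNzRingType) (d j : nat).

Lemma increasing_mapP (f : increasing_map d j) (a b : 'I_j) :
  (a < b)%N -> (val f a < val f b)%N.
Proof. by case: f => f /= /forallP/(_ a)/forallP/(_ b)/implyP. Qed.

Lemma increasing_map_inj (f : increasing_map d j) : injective (val f).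
Proof.
move=> a b fab; apply/val_inj; case: (ltngtP a b) => // ab.
  by have := increasing_mapP f ab; rewrite fab ltnn.
by have := increasing_mapP f ab; rewrite fab ltnn.
Qed.

Let relabel (x : increasing_map d j * 'S_j) : {ffun 'I_j -> 'I_d} :=
  [ffun a => val x.1 (x.2 a)].

(** A strictly sorted list is determined by its set of elements, and relabelling by [p] or [q] does
    not change the set of values. *)
Lemma increasing_map_eq (f g : increasing_map d j) (p q : 'S_j) :
  (forall a, val f (p a) = val g (q a)) -> f = g.
Proof.
move=> fg.
have srt (h : increasing_map d j) :
    sorted (fun x y : 'I_d => (x < y)%N) [seq val h a | a <- enum 'I_j].
  rewrite sorted_map.
  have: sorted ltn [seq val a | a <- enum 'I_j] by rewrite val_enum_ord iota_ltn_sorted.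
  rewrite sorted_map; apply: sub_sorted => a b /=; exact: increasing_mapP.
have E : [seq val f a | a <- enum 'I_j] = [seq val g a | a <- enum 'I_j].
  apply: (@irr_sorted_eq _ (fun x y : 'I_d => (x < y)%N)) => //.
  - by move=> a b c; apply: ltn_trans.
  - by move=> a; rewrite /= ltnn.
  move=> x; apply/mapP/mapP => -[a _ ->].
    by exists (q ((p^-1)%g a)); rewrite ?mem_enum// -fg permKV.
  by exists (p ((q^-1)%g a)); rewrite ?mem_enum// fg permKV.
apply: val_inj; apply/ffunP => a.
by apply: (proj2 (eq_in_map _ _ _) E); rewrite mem_enum.
Qed.

Lemma sort_injection (f : {ffun 'I_j -> 'I_d}) : injective f ->
  exists (g : increasing_map d j) (p : 'S_j), f = [ffun a => val g (p a)].
Proof.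
move=> finj.
pose le (x y : 'I_d) := (x <= y)%N.
pose s := [tuple f a | a < j].
have le_tr : transitive le by move=> a b c; exact: leq_trans.
have le_tot : total le by move=> a b; exact: leq_total.
have sz : size (sort le s) == j by rewrite size_sort size_tuple.
pose t : j.-tuple 'I_d := Tuple sz.
have /tuple_permP[p sp] : perm_eq s t by rewrite /= perm_sym perm_sort.
have ut : uniq t.
  rewrite /= sort_uniq map_inj_uniq ?enum_uniq //; exact: finj.
pose g := [ffun a => tnth t a].
have gi : [forall a : 'I_j, forall b : 'I_j, (a < b)%N ==> (g a < g b)%N].
  apply/forallP => a; apply/forallP => b; apply/implyP => ab.
  rewrite !ffunE ltn_neqAle; apply/andP; split.
    apply/negP => /eqP/val_inj/eqP; rewrite !(tnth_nth (g a)) nth_uniq ?size_tuple//.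
    by move=> /eqP E; rewrite E ltnn in ab.
  have := sort_sorted le_tot s => /(sorted_ltn_nth le_tr) H.
  rewrite !(tnth_nth (g a)); apply: H => //; rewrite inE size_sort size_tuple//.
exists (exist _ g gi), p; apply/ffunP => a; rewrite !ffunE /=.
have /val_inj E : val s = [tuple tnth t (p i) | i < j] by exact: sp.
by have := congr1 (fun u => tnth u a) E; rewrite !tnth_mktuple.
Qed.

(** Sorting splits an injection uniquely into an increasing map after a permutation, so [relabel] is
    a bijection onto the injections. *)
Lemma big_injections (F : {ffun 'I_j -> 'I_d} -> K) :
  \sum_(f : {ffun 'I_j -> 'I_d} | injectiveb f) F f =
  \sum_(g : increasing_map d j) \sum_(p : 'S_j) F [ffun a => val g (p a)].
Proof.
rewrite pair_bigA /=.
have rinj : injective relabel.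
  move=> [f p] [g q] /ffunP E.
  have E1 a : val f (p a) = val g (q a) by have := E a; rewrite !ffunE.
  have fg := increasing_map_eq E1; subst g; congr (_, _).
  by apply/permP => a; apply: (@increasing_map_inj f).
rewrite -(big_imset (h := relabel) (A := predT)) /=; last by move=> ? ? _ _; exact: rinj.
apply: eq_bigl => f; apply/idP/imsetP => [/injectiveP/sort_injection[g [p ->]]|].
  by exists (g, p).
move=> [[g p] _ ->]; apply/injectiveP => a b; rewrite !ffunE /=.
by move=> /increasing_map_inj/perm_inj.
Qed.

(** Expanding each entry of the product turns the determinant into a sum over all index maps [f]. A
    map that is not injective repeats a row of [B] and contributes zero; the others are increasing
    maps after a permutation, and the signs reassemble the determinant of the columns of [A]. *)
Theorem cauchy_binet (A : 'M[K]_(j, d)) (B : 'M[K]_(d, j)) :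
  \det (A *m B) =
  \sum_(f : increasing_map d j) \det (colsub (val f) A) * \det (rowsub (val f) B).
Proof.
transitivity (\sum_(f : {ffun 'I_j -> 'I_d}) (\prod_a A a (f a)) * \det (rowsub f B)).
  rewrite {1}/determinant.
  transitivity (\sum_(s : 'S_j) \sum_(f : {ffun 'I_j -> 'I_d})
      (-1) ^+ s * \prod_a (A a (f a) * B (f a) (s a))).
    apply: eq_bigr => s _; rewrite -big_distrr /=; congr (_ * _).
    rewrite -(bigA_distr_bigA (fun a k => A a k * B k (s a))).
    by apply: eq_bigr => a _; rewrite mxE.
  rewrite exchange_big /=; apply: eq_bigr => f _.
  rewrite /determinant big_distrr /=; apply: eq_bigr => s _.
  rewrite big_split /= mulrCA; congr (_ * (_ * _)).
  by apply: eq_bigr => a _; rewrite !mxE.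
rewrite (bigID (fun f : {ffun _} => injectiveb f)) /= [X in _ + X]big1 ?addr0; last first.
  move=> f /injectivePn[a [b ab fab]].
  rewrite (@determinant_alternate _ _ _ a b) ?mulr0// => c.
  by rewrite !mxE fab.
rewrite big_injections; apply: eq_bigr => g _.
rewrite [X in X * _]/determinant big_distrl /=; apply: eq_bigr => p _.
have -> : rowsub [ffun a => val g (p a)] B = row_perm p (rowsub (val g) B).
  by apply/matrixP => a b; rewrite !mxE ffunE.
rewrite row_permE det_mulmx det_perm mulrCA mulrA; congr (_ * _ * _).
by apply: eq_bigr => a _; rewrite !mxE ffunE.
Qed.

Lemma minors_mulmx (m n : nat) (f : 'I_j -> 'I_m) (h : 'I_j -> 'I_n)
    (A : 'M[K]_(m, d)) (B : 'M[K]_(d, n)) :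
  \det (mxsub f h (A *m B)) =
  \sum_(g : increasing_map d j)
    \det (mxsub f (val g) A) * \det (mxsub (val g) h B).
Proof.
have -> : mxsub f h (A *m B) = rowsub f A *m colsub h B.
  apply/matrixP => a b; rewrite !mxE; apply: eq_bigr => c _; by rewrite !mxE.
rewrite cauchy_binet; apply: eq_bigr => g _; congr (_ * _); congr (\det _);
  by apply/matrixP => a b; rewrite !mxE.
Qed.

End CauchyBinet.

(** * Pluecker coordinates and exterior powers *)

Section Wedge.
Context (R : realType) (k : scalar_kind) (d j : nat).
Local Notation K := (scalars R k).

Definition plucker (V : 'M[K]_(d, j)) : exterior R k d j :=
  [ffun f : increasing_map d j => \det (rowsub (val f) V)].

Definition tuple_mx (s : j.-tuple 'cV[K]_d) : 'M[K]_(d, j) :=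
  \matrix_(a, b) tnth s b a 0.

Lemma wedge_productE (s : j.-tuple 'cV[K]_d) :
  wedge_product s = plucker (tuple_mx s).
Proof.
apply/ffunP => f; rewrite !ffunE; congr (\det _).
by apply/matrixP => a b; rewrite !mxE.
Qed.

Lemma exterior_map_plucker (A : 'M[K]_d) (V : 'M[K]_(d, j)) :
  exterior_map A (plucker V) = plucker (A *m V).
Proof.
apply/ffunP => f; rewrite !ffunE.
have -> : rowsub (val f) (A *m V) = mxsub (val f) id (A *m V) by [].
rewrite minors_mulmx; apply: eq_bigr => h _; by rewrite ffunE.
Qed.

Lemma plucker_mulmx (V : 'M[K]_(d, j)) (B : 'M[K]_j) :
  plucker (V *m B) = [ffun f => \det B * plucker V f].
Proof.
apply/ffunP => f; rewrite !ffunE mulrC -det_mulmx; congr (\det _).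
by apply/matrixP => a b; rewrite !mxE; apply: eq_bigr => c _; rewrite !mxE.
Qed.

End Wedge.

(** * Real and complex scalars treated together *)

Section Scalars.
Context (R : realType) (k : scalar_kind).
Local Notation K := (scalars R k).

(** Lets the real and complex cases share one proof: facts on absolute values and the spectral
    theorem are taken over [R[i]] and pulled back along this field morphism. *)
Definition to_complex : K -> R[i] :=
  match k return scalars R k -> R[i] with
  | RealScalars => fun x => (x%:C)%C
  | ComplexScalars => fun z => z
  end.

Lemma to_complex_is_zmod_morphism : zmod_morphism to_complex.
Proof. by rewrite /to_complex; case: k => x y //=; rewrite rmorphB. Qed.

Lemma to_complex_is_monoid_morphism : monoid_morphism to_complex.
Proof.
by rewrite /to_complex; case: k => //=; split=> [|x y];
  rewrite ?rmorph1 ?rmorphM.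
Qed.

HB.instance Definition _ := GRing.isZmodMorphism.Build K R[i] to_complex
  to_complex_is_zmod_morphism.
HB.instance Definition _ := GRing.isMonoidMorphism.Build K R[i] to_complex
  to_complex_is_monoid_morphism.

Lemma to_complex_real (x : R) : to_complex (scalar_of_real k x) = (x%:C)%C.
Proof. by rewrite /to_complex /scalar_of_real; case: k. Qed.

Lemma to_complex_conj (x : K) : to_complex (scalar_conj x) = (to_complex x)^*.
Proof.
move: x; rewrite /to_complex /scalar_conj; case: k => x //=; exact: esym (conjc_real x).
Qed.

Lemma norm_to_complex (x : K) : `|to_complex x| = ((scalar_abs x)%:C)%C.
Proof.
move: x; rewrite /to_complex /scalar_abs; case: k => //= x.
by rewrite normc_def /= expr0n addr0 sqrtr_sqr.
Qed.

Lemma abs_to_complex (x : K) (y : R) :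
  (scalar_abs x = y) <-> (`|to_complex x| = y%:C%C).
Proof. by rewrite norm_to_complex; split=> [->|/complexI]. Qed.

Lemma absM : {morph @scalar_abs R k : x y / x * y}.
Proof.
by move=> x y; apply/abs_to_complex; rewrite rmorphM normrM !norm_to_complex rmorphM.
Qed.

Lemma abs0 : scalar_abs (0 : K) = 0.
Proof. by apply/abs_to_complex; rewrite rmorph0 normr0. Qed.

Lemma abs1 : scalar_abs (1 : K) = 1.
Proof. by apply/abs_to_complex; rewrite rmorph1 normr1. Qed.

Lemma absN (x : K) : scalar_abs (- x) = scalar_abs x.
Proof. by apply/abs_to_complex; rewrite rmorphN normrN norm_to_complex. Qed.

Lemma abs_ge0 (x : K) : 0 <= scalar_abs x.
Proof. by rewrite -ler0c -norm_to_complex normr_ge0. Qed.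

Lemma abs_eq0 (x : K) : (scalar_abs x == 0) = (x == 0).
Proof.
rewrite -(inj_eq (@complexI R)) -norm_to_complex normr_eq0.
by rewrite -(rmorph0 to_complex) (inj_eq (fmorph_inj to_complex)).
Qed.

Lemma absD (x y : K) : scalar_abs (x + y) <= scalar_abs x + scalar_abs y.
Proof. by rewrite -lecR rmorphD /= -!norm_to_complex rmorphD ler_normD. Qed.

Lemma abs_sum (I : Type) (r : seq I) (P : pred I) (F : I -> K) :
  scalar_abs (\sum_(i <- r | P i) F i) <= \sum_(i <- r | P i) scalar_abs (F i).
Proof.
elim/big_ind2 : _ => //; first by rewrite abs0.
by move=> x1 x2 y1 y2 h1 h2; apply: le_trans (absD _ _) _; exact: lerD.
Qed.

Lemma abs_prod (I : Type) (r : seq I) (P : pred I) (F : I -> K) :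
  scalar_abs (\prod_(i <- r | P i) F i) = \prod_(i <- r | P i) scalar_abs (F i).
Proof. by rewrite (big_morph _ absM abs1). Qed.

Lemma absX (x : K) n : scalar_abs (x ^+ n) = scalar_abs x ^+ n.
Proof. by elim: n => [|n IH]; rewrite ?expr0 ?abs1// !exprS absM IH. Qed.

Lemma abs_real (x : R) : scalar_abs (scalar_of_real k x) = `|x|.
Proof.
by apply/abs_to_complex; rewrite to_complex_real normc_def /= expr0n addr0 sqrtr_sqr.
Qed.

Lemma abs_numr (x : K) : `|x| = scalar_of_real k (scalar_abs x).
Proof.
by move: x; rewrite /scalar_of_real /scalar_abs; case: k => //= x; rewrite RRe_real.
Qed.

Lemma abs_sign (s : nat) : scalar_abs ((-1) ^+ s : K) = 1.
Proof. by rewrite absX absN abs1 expr1n. Qed.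

Lemma abs_det_le n (A : 'M[K]_n) (B : R) : 0 <= B ->
  (forall i j, scalar_abs (A i j) <= B) ->
  scalar_abs (\det A) <= n`!%:R * B ^+ n.
Proof.
move=> B0 AB; apply: le_trans (abs_sum _ _ _) _.
have -> : n`!%:R * B ^+ n = \sum_(s : 'S_n) B ^+ n.
  by rewrite sumr_const card_Sn mulr_natl.
apply: ler_sum => s _; rewrite absM abs_sign mul1r abs_prod.
rewrite -[n in B ^+ n]card_ord -prodr_const.
by apply: ler_prod => i _; rewrite abs_ge0 AB.
Qed.

End Scalars.

(** * Spectral decomposition of Gram matrices *)

Section Gram.
Local Open Scope sesquilinear_scope.
Context (R : realType) (d : nat).
Local Notation C := R[i].

Definition real_diag (s : 'rV[R]_d) : 'M[C]_d :=
  diag_mx (map_mx (fun x => ((x ^+ 2)%:C)%C) s).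

Lemma sorted_row (s : 'rV[R]_d) : exists p : 'S_d,
  forall i j : 'I_d, (i <= j)%N -> s 0 (p j) <= s 0 (p i).
Proof.
pose ge (x y : R) := y <= x.
have ge_tr : transitive ge by move=> a b c /= h1 h2; exact: le_trans h2 h1.
have ge_tot : total ge by move=> a b; exact: le_total.
pose t := [tuple s 0 i | i < d].
have sz : size (sort ge t) == d by rewrite size_sort size_tuple.
pose u : d.-tuple R := Tuple sz.
have /tuple_permP[p up] : perm_eq u t by rewrite /= perm_sort.
have E i : tnth u i = s 0 (p i).
  have /val_inj -> : val u = [tuple tnth t (p i) | i < d] by exact: up.
  by rewrite !tnth_mktuple.
exists p => i j ij; rewrite -!E !(tnth_nth 0).
have ge_rf : reflexive ge by move=> a; exact: lexx.
apply: (sorted_leq_nth ge_tr ge_rf) => //; rewrite ?inE ?size_sort ?size_tuple//.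
exact: sort_sorted.
Qed.

(** The spectral theorem for the Hermitian matrix [H] gives a unitary matrix, and permuting its rows
    sorts the eigenvalues. They are positive because [A] is invertible. *)
Lemma gram_spectral (A : 'M[C]_d) : A \in unitmx ->
  exists (P : 'M[C]_d) (s : 'rV[R]_d),
  [/\ P \is unitarymx, forall i, 0 < s 0 i,
      forall i j : 'I_d, (i <= j)%N -> s 0 j <= s 0 i &
      A^t* *m A = P^t* *m real_diag s *m P].
Proof.
move=> Au; set H := A^t* *m A.
have Hh : H \is normalmx.
  apply/normalmxP; rewrite /H trmx_mul map_mxM trmxCK //.
have /orthomx_spectralP := Hh.
set P := spectralmx H; set D := spectral_diag H => HE.
have Pu : P \is unitarymx by exact: spectral_unitarymx.
have PI : P *m P^t* = 1%:M by exact/unitarymxP.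
have IP : P^t* *m P = 1%:M by rewrite -invmx_unitary// mulVmx// unitarymx_unit.
(* The columns of [B] are orthogonal and their squared lengths are the eigenvalues, so a zero
   eigenvalue would be a zero column of an invertible matrix. *)
pose B := A *m P^t*.
have BD : B^t* *m B = diag_mx D.
  rewrite /B trmx_mul map_mxM trmxCK -mulmxA [_ *m (_ *m P^t*)]mulmxA -/H HE.
  by rewrite invmx_unitary// !mulmxA PI mul1mx -mulmxA PI mulmx1.
have Bu : B \in unitmx.
  by rewrite unitmx_mul Au -invmx_unitary// unitmx_inv unitarymx_unit.
have Dpos i : 0 < D 0 i.
  have /matrixP/(_ i i) := BD; rewrite !mxE eqxx mulr1n => <-.
  have DE : \sum_j (B^t*) i j * B j i = \sum_j `|B j i| ^+ 2.
    by apply: eq_bigr => j _; rewrite !mxE normCKC.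
  rewrite DE lt_def sumr_ge0 ?andbT; last by move=> j _; rewrite exprn_ge0.
  clearbody B; apply/negP => /eqP/psumr_eq0P Z0.
  have {}Z0 := Z0 (fun l _ => exprn_ge0 2 (normr_ge0 (B l i))).
  have B0 j : B j i = 0.
    by apply/eqP; rewrite -normr_eq0 -sqrf_eq0 Z0.
  have : B *m delta_mx i 0 = 0 :> 'cV_d.
    apply/matrixP => a b; rewrite !mxE big1 // => l _; rewrite !mxE.
    by case: eqVneq => [->|]; rewrite ?B0 ?mul0r // mulr0.
  move=> /(congr1 (mulmx (invmx B))); rewrite mulKmx// mulmx0.
  by move=> /matrixP/(_ i 0); rewrite !mxE !eqxx /= => /eqP; rewrite oner_eq0.
pose s0 : 'rV[R]_d := \row_i Num.sqrt (complex.Re (D 0 i)).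
have ReD i : 0 < complex.Re (D 0 i).
  by have := Dpos i; rewrite ltcE /= => /andP[].
have [p ps] := sorted_row s0.
exists (row_perm p P), (\row_i s0 0 (p i)); split.
- apply/unitarymxP/matrixP => i j.
  have /matrixP/(_ (p i) (p j)) := PI; rewrite !mxE (inj_eq perm_inj) => <-.
  by apply: eq_bigr => l _; rewrite !mxE.
- by move=> i; rewrite !mxE sqrtr_gt0.
- by move=> i j ij; rewrite !mxE; have := ps i j ij; rewrite !mxE.
rewrite HE invmx_unitary//; apply/matrixP => i j.
rewrite !mxE (reindex_inj (@perm_inj _ p)) /=; apply: eq_bigr => l _.
rewrite !mxE; congr (_ * _).
rewrite (bigD1 (p l)) //= [RHS](bigD1 l) //= !mxE !eqxx !mulr1n.
rewrite !big1 ?addr0 //; last 2 first.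
- by move=> a al; rewrite !mxE (negbTE al) mulr0n mulr0.
- by move=> a al; rewrite !mxE (negbTE al) mulr0n mulr0.
rewrite sqr_sqrtr ?ltW//; congr (_ * _).
by rewrite RRe_real// gtr0_real.
Qed.

End Gram.

(** * The norm of the matrix of minors *)

Section Minors.
Context (R : realType) (k : scalar_kind) (d j : nat).
Local Notation K := (scalars R k).

(** An entrywise norm of the [j]-th exterior power of [A]: comparable to the operator norm,
    submultiplicative by Cauchy-Binet, and defined without square roots. *)
Definition minors_norm (A : 'M[K]_d) : R :=
  \sum_(f : increasing_map d j) \sum_(h : increasing_map d j)
    scalar_abs (\det (mxsub (val f) (val h) A)).

Lemma minors_norm_ge0 A : 0 <= minors_norm A.
Proof. by apply: sumr_ge0 => f _; apply: sumr_ge0 => h _; exact: abs_ge0. Qed.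

Lemma le_minors_norm A (f h : increasing_map d j) :
  scalar_abs (\det (mxsub (val f) (val h) A)) <= minors_norm A.
Proof.
rewrite /minors_norm (bigD1 f) //= (bigD1 h) //= -addrA lerDl addr_ge0//.
  by apply: sumr_ge0 => g _; exact: abs_ge0.
by apply: sumr_ge0 => g _; apply: sumr_ge0 => g' _; exact: abs_ge0.
Qed.

Lemma minors_norm_le A (B : R) :
  (forall f h : increasing_map d j,
    scalar_abs (\det (mxsub (val f) (val h) A)) <= B) ->
  minors_norm A <= #|{: increasing_map d j}|%:R ^+ 2 * B.
Proof.
move=> AB; apply: (@le_trans _ _ (\sum_(f : increasing_map d j)
    \sum_(h : increasing_map d j) B)).
  by apply: ler_sum => f _; apply: ler_sum => h _; exact: AB.
have cardE (x : R) : \sum_(h : increasing_map d j) x = #|{: increasing_map d j}|%:R * x.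
  by rewrite sumr_const mulr_natl; congr (_ *+ _); apply: eq_card.
by rewrite !cardE mulrA expr2.
Qed.

Lemma minors_normM A B : minors_norm (A *m B) <= minors_norm A * minors_norm B.
Proof.
pose a (f g : increasing_map d j) := scalar_abs (\det (mxsub (val f) (val g) A)).
pose b (f g : increasing_map d j) := scalar_abs (\det (mxsub (val f) (val g) B)).
apply: (@le_trans _ _ (\sum_f \sum_h \sum_g a f g * b g h)).
  apply: ler_sum => f _; apply: ler_sum => h _; rewrite minors_mulmx.
  by apply: le_trans (abs_sum _ _ _) _; apply: ler_sum => g _; rewrite absM.
rewrite /minors_norm mulr_suml; apply: ler_sum => f _.
rewrite exchange_big mulr_suml /=; apply: ler_sum => g _.
rewrite -mulr_sumr; apply: ler_wpM2l; first exact: abs_ge0.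
rewrite [leRHS](bigD1 g) //= lerDl.
by apply: sumr_ge0 => g' _; apply: sumr_ge0 => h _; exact: abs_ge0.
Qed.

Lemma minors_norm_bounded (A : 'M[K]_d) : (forall a b, scalar_abs (A a b) <= 1) ->
  minors_norm A <= #|{: increasing_map d j}|%:R ^+ 2 * j`!%:R.
Proof.
move=> A1; apply: minors_norm_le => f h.
have := @abs_det_le R k j (mxsub (val f) (val h) A) 1 ler01.
rewrite expr1n mulr1; apply => a b; by rewrite mxE.
Qed.

Lemma increasing_map_ge (f : increasing_map d j) (a : 'I_j) : (a <= val f a)%N.
Proof.
case: a => a; elim: a => [//|a IH] aj.
have aj' : (a < j)%N by apply: ltnW.
apply: leq_ltn_trans (IH aj') _; exact: increasing_mapP.
Qed.

Definition initial_fun (jd : (j <= d)%N) : {ffun 'I_j -> 'I_d} :=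
  [ffun a => widen_ord jd a].

Lemma initial_subproof (jd : (j <= d)%N) :
  [forall a : 'I_j, forall b : 'I_j,
    (a < b)%N ==> (initial_fun jd a < initial_fun jd b)%N].
Proof.
by apply/forallP => a; apply/forallP => b; apply/implyP => ab; rewrite !ffunE.
Qed.

Definition initial_map (jd : (j <= d)%N) : increasing_map d j :=
  exist _ (initial_fun jd) (initial_subproof jd).

(** The identity has a minor equal to 1, and submultiplicativity applied to [A] and its inverse
    transfers this to [A]. *)
Lemma minors_norm_gt0 A : (j <= d)%N -> A \in unitmx -> 0 < minors_norm A.
Proof.
move=> jd Au; rewrite lt_def minors_norm_ge0 andbT; apply/negP => /eqP A0.
have f0 := initial_map jd.
have : minors_norm (1%:M) <= minors_norm A * minors_norm (invmx A).
  by rewrite -(mulmxV Au) minors_normM.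
rewrite A0 mul0r => /(le_trans (le_minors_norm _ f0 f0)).
have -> : mxsub (val f0) (val f0) 1%:M = 1%:M :> 'M[K]_j.
  apply/matrixP => a b; rewrite !mxE (inj_eq (@increasing_map_inj _ _ f0))//.
by rewrite det1 abs1 ler10.
Qed.

End Minors.

Lemma sandwich_le (R : numDomainType) (c p q h b : R) :
  0 <= p -> p <= c -> 0 <= q -> q <= c -> 0 <= h -> h <= b ->
  p * h * q <= c * b * c.
Proof.
move=> p0 pc q0 qc h0 hb.
by apply: ler_pM => //; [exact: mulr_ge0|exact: ler_pM].
Qed.

(** * Minors compared with products of singular values *)

Section DiagMinors.
Local Open Scope sesquilinear_scope.
Context (R : realType) (d j : nat) (jd : (j <= d)%N).
Let k := ComplexScalars.
Local Notation C := (scalars R k).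
Local Notation nn := (@minors_norm R k d j).
Let nnM := @minors_normM R k d j.
(** Bounds [minors_norm] of every matrix with entries of modulus at most one, unitary matrices in
    particular. *)
Let c : R := #|{: increasing_map d j}|%:R ^+ 2 * j`!%:R.

Let c_gt0 : 0 < c.
Proof.
rewrite mulr_gt0 ?ltr0n ?fact_gt0// exprn_gt0// ltr0n.
by apply/card_gt0P; exists (initial_map jd).
Qed.

Lemma unitary_entry_le1 (P : 'M[R[i]]_d) a b : P \is unitarymx ->
  complex.Re `|P a b| <= 1.
Proof.
move=> /unitarymxP/matrixP/(_ a a); rewrite !mxE eqxx.
rewrite (eq_bigr (fun l => `|P a l| ^+ 2)); last first.
  by move=> l _; rewrite !mxE normCK.
move=> E; have {}E : \sum_(l < d) `|P a l| ^+ 2 = 1 := E.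
rewrite -(@lecR R); set x := complex.Re _.
have -> : (x%:C)%C = `|P a b| by rewrite /x RRe_real.
rewrite rmorph1 -(@expr_le1 _ 2) // -E (bigD1 b) //= lerDl.
by apply: sumr_ge0 => l _; rewrite exprn_ge0.
Qed.

Lemma nn_unitary (P : 'M[R[i]]_d) : P \is unitarymx -> nn P <= c.
Proof. by move=> Pu; apply: (@minors_norm_bounded R k d j) => a b; exact: unitary_entry_le1. Qed.

Lemma det_sub_real_diag (s : 'rV[R]_d) (f h : 'I_j -> 'I_d) :
  \det (mxsub f h (real_diag s)) =
  (\prod_a (s 0 (f a) ^+ 2))%:C%C * \det (mxsub f h (1%:M : 'M[R[i]]_d)).
Proof.
rewrite rmorph_prod -[X in X * _](_ : \det (diag_mx (\row_a ((s 0 (f a) ^+ 2)%:C)%C)) = _); last first.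
  by rewrite det_diag; apply: eq_bigr => a _; rewrite mxE.
rewrite -det_mulmx mul_diag_mx; congr (\det _); apply/matrixP => a b.
by rewrite !mxE; case: eqP => _; rewrite ?mulr1n ?mulr0n ?mulr1 ?mulr0.
Qed.

Let head_prod (s : 'rV[R]_d) : R := \prod_(a < j) (s 0 (widen_ord jd a)).

(** The leading minor is the largest: an increasing map satisfies [a <= f a], and [s] decreases.
    Squares appear because [real_diag s] carries the eigenvalues of the Gram matrix. *)
Lemma nn_real_diag (s : 'rV[R]_d) : (forall i, 0 < s 0 i) ->
  (forall i l : 'I_d, (i <= l)%N -> s 0 l <= s 0 i) ->
  head_prod s ^+ 2 <= nn (real_diag s) <= c * head_prod s ^+ 2.
Proof.
move=> s0 smono; rewrite /head_prod -prodrXl; apply/andP; split.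
  apply: le_trans (@le_minors_norm R k d j _ (initial_map jd) (initial_map jd)).
  rewrite det_sub_real_diag (_ : mxsub _ _ 1%:M = 1%:M); last first.
    apply/matrixP => a b.
    by rewrite !mxE (inj_eq (@increasing_map_inj _ _ (initial_map jd))).
  rewrite det1 mulr1 (@abs_real R k) ger0_norm; last first.
    by apply: prodr_ge0 => a _; rewrite exprn_ge0// ltW.
  by rewrite le_eqVlt; apply/orP; left; apply/eqP/eq_bigr => a _; rewrite ffunE.
rewrite /c -mulrA; apply: (@minors_norm_le R k d j _ _) => f h.
rewrite det_sub_real_diag absM (@abs_real R k) ger0_norm; last first.
  by apply: prodr_ge0 => a _; rewrite exprn_ge0// ltW.
rewrite mulrC; apply: ler_pM; rewrite ?abs_ge0//.
- by apply: prodr_ge0 => a _; rewrite exprn_ge0// ltW.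
- have := @abs_det_le R k j (mxsub (val f) (val h) 1%:M) 1 ler01.
  rewrite expr1n mulr1; apply => a b; rewrite !mxE.
  by case: eqP => _; rewrite ?abs1 ?abs0.
apply: ler_prod => a _; apply/andP; split; first by rewrite exprn_ge0// ltW.
rewrite ler_pXn2r ?nnegrE ?(ltW (s0 _))// smono//; exact: increasing_map_ge.
Qed.

Lemma minors_norm_adjoint (A : 'M[R[i]]_d) : nn (A^t*) = nn A.
Proof.
rewrite /minors_norm exchange_big /=; apply: eq_bigr => f _; apply: eq_bigr => h _.
have -> : mxsub (val h) (val f) (A^t*) = map_mx (Num.conj : R[i] -> R[i]) (mxsub (val f) (val h) A)^T.
  by apply/matrixP => a b; rewrite !mxE.
rewrite det_map_mx det_tr; exact: (congr1 (@complex.Re R) (norm_conjC _)).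
Qed.

(** By Cauchy-Binet the diagonal minor of the Gram matrix at [h] is the sum of the squared moduli of
    the minors of [A] in the columns [h], so it controls each of them. *)
Lemma minors_norm_gram (A : 'M[R[i]]_d) :
  nn (A^t* *m A) <= nn A ^+ 2 <= #|{: increasing_map d j}|%:R ^+ 4 * nn (A^t* *m A).
Proof.
set n := #|_|%:R; apply/andP; split.
  by apply: le_trans (nnM _ _) _; rewrite minors_norm_adjoint expr2.
have H0 := @minors_norm_ge0 R k d j (A^t* *m A).
have : nn A <= n ^+ 2 * Num.sqrt (nn (A^t* *m A)).
  apply: (@minors_norm_le R k d j _ _) => f h.
  rewrite -(@ler_pXn2r _ 2) ?nnegrE ?abs_ge0 ?sqrtr_ge0// sqr_sqrtr//.
  apply: le_trans (@le_minors_norm R k d j _ h h).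
  rewrite (@minors_mulmx R[i]) (eq_bigr (fun g : increasing_map d j =>
     ((@scalar_abs R k (\det (mxsub (val g) (val h) A)) ^+ 2)%:C)%C)); last first.
    move=> g _.
    have -> : mxsub (val h) (val g) (A^t*) = map_mx (Num.conj : R[i] -> R[i]) (mxsub (val g) (val h) A)^T.
      by apply/matrixP => a b; rewrite !mxE.
    rewrite det_map_mx det_tr -normCKC rmorphXn; by congr (_ ^+ 2).
  rewrite -(rmorph_sum (real_complex R)) (@abs_real R k) ger0_norm; last first.
    by apply: sumr_ge0 => g _; exact: sqr_ge0.
  by rewrite (bigD1 f) //= lerDl; apply: sumr_ge0 => g _; exact: sqr_ge0.
move=> H; rewrite -[in leRHS](sqr_sqrtr H0) -[4%N]/(2 * 2)%N exprM -exprMn.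
by rewrite lerXn2r ?nnegrE ?(@minors_norm_ge0 R k d j)// mulr_ge0 ?sqrtr_ge0// exprn_ge0.
Qed.

(** Unitary factors change [minors_norm] by at most the factor [c], so the Gram matrix compares with
    its diagonal form, and the square of [minors_norm A] with the Gram matrix. The constant depends
    on [d] and [j] only. *)
Lemma minors_norm_singular_values : exists2 e : R, 0 < e &
  forall (A P : 'M[R[i]]_d) (s : 'rV[R]_d), P \is unitarymx ->
    (forall i, 0 < s 0 i) ->
    (forall i l : 'I_d, (i <= l)%N -> s 0 l <= s 0 i) ->
    A^t* *m A = P^t* *m real_diag s *m P ->
    head_prod s <= e * nn A /\ nn A <= e * head_prod s.
Proof.
pose n : R := #|{: increasing_map d j}|%:R.
have n0 : 0 < n.
  by rewrite ltr0n; apply/card_gt0P; exists (initial_map jd).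
have [e2 [e20 e2l e2r]] : exists e2 : R,
    [/\ 0 <= e2, n ^+ 4 * c ^+ 3 <= e2 & c ^+ 2 <= e2].
  have h1 : 0 <= n ^+ 4 * c ^+ 3 by rewrite mulr_ge0 ?exprn_ge0 ?ltW.
  have h2 : 0 <= c ^+ 2 by exact: sqr_ge0.
  by exists (n ^+ 4 * c ^+ 3 + c ^+ 2); rewrite addr_ge0 ?lerDl ?lerDr.
(* Since [e2] is at most the square of [1 + e2], the factor [1 + e2] serves in place of a square
   root of [e2]. *)
have sq (x y : R) : 0 <= x -> 0 <= y -> x ^+ 2 <= e2 * y ^+ 2 ->
    x <= (1 + e2) * y.
  move=> x0 y0 xy; rewrite -(@ler_pXn2r _ 2) ?nnegrE ?mulr_ge0 ?addr_ge0//.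
  apply: le_trans xy _; rewrite exprMn ler_wpM2r ?exprn_ge0//.
  by rewrite sqrrD expr1n mul1r -addrA ler_wpDl// mulr2n -addrA lerDl addr_ge0 ?exprn_ge0.
exists (1 + e2); first by rewrite ltr_pwDl.
move=> A P s Pu s0 smono HE.
have nP : nn P <= c by exact: nn_unitary.
have nP' : nn (P^t*) <= c by rewrite minors_norm_adjoint.
have /andP[D1 D2] := nn_real_diag s0 smono.
have /andP[H1 H2] := minors_norm_gram A.
have hp0 : 0 <= head_prod s by apply: prodr_ge0 => a _; exact: ltW.
have g0 (M : 'M[R[i]]_d) : 0 <= nn M by exact: (@minors_norm_ge0 R k d j).
have DE : real_diag s = P *m (A^t* *m A) *m P^t*.
  have PI : P *m P^t* = 1%:M by exact/unitarymxP.
  by rewrite HE !mulmxA PI mul1mx -mulmxA PI mulmx1.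
have N1 : nn (real_diag s) <= c * nn A ^+ 2 * c.
  rewrite DE; apply: le_trans (nnM _ _) _.
  apply: le_trans (ler_wpM2r (g0 _) (nnM _ _)) _.
  exact: (sandwich_le (g0 _) nP (g0 _) nP' (g0 _) H1).
have N2 : nn (A^t* *m A) <= c * (c * head_prod s ^+ 2) * c.
  rewrite HE; apply: le_trans (nnM _ _) _.
  apply: le_trans (ler_wpM2r (g0 _) (nnM _ _)) _.
  exact: (sandwich_le (g0 _) nP' (g0 _) nP (g0 _) D2).
split.
  apply: (sq _ _ hp0 (g0 A)); apply: le_trans D1 _; apply: le_trans N1 _.
  by rewrite mulrAC -expr2 ler_wpM2r ?sqr_ge0.
apply: (sq _ _ (g0 A) hp0); apply: le_trans H2 _.
apply: (@le_trans _ _ (n ^+ 4 * (c * (c * head_prod s ^+ 2) * c))).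
  by apply: ler_wpM2l N2; rewrite exprn_ge0// ltW.
have -> : n ^+ 4 * (c * (c * head_prod s ^+ 2) * c) = n ^+ 4 * c ^+ 3 * head_prod s ^+ 2.
  by rewrite [c ^+ 3]exprS expr2; ring.
by rewrite ler_wpM2r ?sqr_ge0.
Qed.

End DiagMinors.

(** * Uniqueness of singular values and the Cartan projection *)

Section SingularValues.
Local Open Scope sesquilinear_scope.
Context (R : realType) (k : scalar_kind) (d : nat).
Local Notation K := (scalars R k).
Local Notation toC := (@to_complex R k).

Lemma map_conj_transpose (A : 'M[K]_d) :
  map_mx toC (conj_transpose A) = (map_mx toC A)^t*.
Proof. by apply/matrixP => i j; rewrite !mxE to_complex_conj. Qed.

Lemma char_poly_unitary (P D : 'M[R[i]]_d) : P \is unitarymx ->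
  char_poly (P^t* *m D *m P) = char_poly D.
Proof.
move=> Pu; have IP : P^t* *m P = 1%:M.
  by rewrite -invmx_unitary// mulVmx// unitarymx_unit.
pose Q := map_mx (@polyC R[i]) P; pose Q' := map_mx (@polyC R[i]) (P^t*).
have QQ : Q' *m Q = 1%:M by rewrite -map_mxM IP map_mx1.
have E : char_poly_mx (P^t* *m D *m P) = Q' *m char_poly_mx D *m Q.
  rewrite /char_poly_mx mulmxBr mulmxBl !map_mxM; congr (_ - _).
  by rewrite scalar_mxC -mulmxA QQ mulmx1.
by rewrite /char_poly E !det_mulmx mulrAC -det_mulmx QQ det1 mul1r.
Qed.

(** The characteristic polynomial determines the multiset of squares, and the row is sorted. This
    pins down the value chosen by [xget] in [singular_values]. *)
Lemma is_singular_values_inj (A : 'M[K]_d) (s t : 'rV[R]_d) :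
  is_singular_values A s -> is_singular_values A t -> s = t.
Proof.
move=> [s0 sm sE] [t0 tm tE].
pose sq (u : 'rV[R]_d) := [seq scalar_of_real k (u 0 i ^+ 2) | i <- enum 'I_d].
have prodE (u : 'rV[R]_d) : \prod_(i < d) ('X - (scalar_of_real k (u 0 i ^+ 2))%:P) =
    \prod_(x <- sq u) ('X - x%:P).
  by rewrite big_map big_enum.
have : perm_eq (sq s) (sq t).
  by apply: prod_XsubC_eq; rewrite -!prodE -sE -tE.
move=> /(perm_map (fun x => Num.sqrt (scalar_abs x))).
have mapE (u : 'rV[R]_d) : (forall i, 0 <= u 0 i) ->
    [seq Num.sqrt (scalar_abs x) | x <- sq u] = [seq u 0 i | i <- enum 'I_d].
  move=> u0; rewrite -map_comp; apply: eq_map => i /=.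
  by rewrite abs_real ger0_norm ?exprn_ge0// sqrtr_sqr ger0_norm.
rewrite !mapE// => st.
pose ge (x y : R) := y <= x.
have srt (u : 'rV[R]_d) : (forall i j : 'I_d, (i <= j)%N -> u 0 j <= u 0 i) ->
    sorted ge [seq u 0 i | i <- enum 'I_d].
  move=> um; rewrite sorted_map.
  have : sorted leq [seq val a | a <- enum 'I_d] by rewrite val_enum_ord iota_sorted.
  by rewrite sorted_map; apply: sub_sorted => a b /=; exact: um.
have ge_tr : transitive ge by move=> a b c /= h1 h2; exact: le_trans h2 h1.
have ge_as : antisymmetric ge by move=> a b; rewrite andbC; exact: le_anti.
have E := sorted_eq ge_tr ge_as (srt s sm) (srt t tm) st.
apply/rowP => i; apply: (proj2 (eq_in_map _ _ _) E); exact: mem_enum.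
Qed.

(** The spectral decomposition over [R[i]] has the right characteristic polynomial, so by uniqueness
    its diagonal is the chosen row, for a real matrix too. *)
Lemma singular_values_spectral (A : 'M[K]_d) : A \in unitmx ->
  exists P : 'M[R[i]]_d,
  [/\ P \is unitarymx, forall i, 0 < singular_values A 0 i,
      forall i j : 'I_d, (i <= j)%N ->
        singular_values A 0 j <= singular_values A 0 i &
      (map_mx toC A)^t* *m map_mx toC A =
        P^t* *m real_diag (singular_values A) *m P].
Proof.
move=> Au; have Cu : map_mx toC A \in unitmx by rewrite map_unitmx.
have [P [s [Pu s0 sm HE]]] := gram_spectral Cu.
have sA : is_singular_values A s.
  split=> // [i|]; first exact: ltW.
  apply: (@map_poly_inj _ _ toC).
  rewrite map_char_poly map_mxM map_conj_transpose HE char_poly_unitary//.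
  rewrite char_poly_trig; last exact/diag_mx_is_trig.
  rewrite rmorph_prod; apply: eq_bigr => i _.
  by rewrite rmorphB /= map_polyX map_polyC /= to_complex_real !mxE eqxx mulr1n.
have -> : singular_values A = s.
  rewrite /singular_values; case: xgetP => [u -> uA|/(_ s)//].
  exact: is_singular_values_inj uA sA.
by exists P.
Qed.

Lemma abs_det_to_complex n (M : 'M[K]_n) :
  scalar_abs (\det M) =
  @scalar_abs R ComplexScalars (\det (map_mx toC M : 'M[R[i]]_n)).
Proof.
rewrite det_map_mx; apply: complexI; rewrite -norm_to_complex.
exact: (@norm_to_complex R ComplexScalars).
Qed.

(** The weight is the logarithm of the product of the [j.+1] largest singular values, since the
    index [j] stands for the root with number [j + 1]; that product is comparable to the minors of
    size [j.+1]. *)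
Lemma kappa_minors_norm (j : 'I_d.-1) : exists C : R, forall g : PSL K d,
  `|fundamental_weight j (kappa g) - ln (minors_norm j.+1 (lift_mx g))| <= C.
Proof.
have jd : (j.+1 <= d)%N by exact: ltnW (root_snd_subproof j).
have [e e0 eP] := minors_norm_singular_values R jd.
exists (ln e) => g; have gu := lift_mx_unit g.
have [P [Pu s0 sm HE]] := singular_values_spectral gu.
set s := singular_values _ in s0 sm HE.
have [h1 h2] := eP _ _ _ Pu s0 sm HE.
have nE : @minors_norm R ComplexScalars d j.+1 (map_mx toC (lift_mx g)) =
    minors_norm j.+1 (lift_mx g).
  rewrite /minors_norm; apply: eq_bigr => f _; apply: eq_bigr => h _.
  rewrite [RHS]abs_det_to_complex; congr scalar_abs; congr (\det _).
  by apply/matrixP => a b; rewrite !mxE.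
rewrite nE in h1 h2.
have n0 := minors_norm_gt0 jd gu.
set p := \prod_(a < _) _ in h1 h2.
have p0 : 0 < p by apply: prodr_gt0.
have -> : fundamental_weight j (kappa g) = ln p.
  have -> : fundamental_weight j (kappa g) = \sum_(a < j.+1) kappa g 0 (widen_ord jd a).
    exact: (big_ord_narrow jd).
  suff [] : 0 < \prod_(a < j.+1) s 0 (widen_ord jd a) /\
      \sum_(a < j.+1) kappa g 0 (widen_ord jd a) = ln (\prod_(a < j.+1) s 0 (widen_ord jd a)) by [].
  elim/big_rec2: _ => [|a x y _ [y0 ->]]; first by rewrite ln1.
  by rewrite lnM ?posrE// mulr_gt0// mxE.
rewrite ler_norml; apply/andP; split.
  rewrite lerNl opprB lerBlDr -lnM ?posrE// ler_ln ?posrE ?mulr_gt0//.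
by rewrite lerBlDr -lnM ?posrE// ler_ln ?posrE ?mulr_gt0.
Qed.

End SingularValues.

(** * Cartan projections *)

Section ATheta.
Context (R : realType).

(** Writes a sum of squares through partial sums and consecutive differences, that is, through
    fundamental weights and simple roots. *)
Lemma abel_summation (b : nat -> R) n :
  \sum_(i < n.+1) b i * b i = (\sum_(i < n.+1) b i) * b n -
    \sum_(l < n) (\sum_(i < l.+1) b i) * (b l.+1 - b l).
Proof.
elim: n => [|n IH]; first by rewrite !big_ord_recr !big_ord0 /= !add0r subr0.
rewrite big_ord_recr /= IH [\sum_(i < n.+2) b i]big_ord_recr /=.
rewrite [\sum_(l < n.+1) _ * _]big_ord_recr /=; ring.
Qed.

(** In the Abel summation of the squares of the entries every term vanishes: the total sum is zero,
    and at each index either the weight or the root is zero. Hence the sum of squares is zero. *)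
Lemma root_weight_eq0 (d : nat) (theta : {set 'I_d.-1}) (a : 'rV[R]_d) :
  \sum_i a 0 i = 0 ->
  (forall j, j \notin theta -> simple_root j a = 0) ->
  (forall j, j \in theta -> fundamental_weight j a = 0) -> a = 0.
Proof.
case: d theta a => [|n] theta a; first by move=> _ _ _; apply/rowP => -[].
move=> a0 aroot aweight.
pose b (i : nat) := a 0 (inord i).
have bE (i : 'I_n.+1) : b i = a 0 i by rewrite /b inord_val.
have sb l (ln : (l < n.+1)%N) : \sum_(i < l.+1) b i = \sum_(i < n.+1 | (i <= l)%N) a 0 i.
  rewrite (eq_bigl (fun i : 'I_n.+1 => (i < l.+1)%N)) //.
  rewrite (big_ord_narrow ln); apply: eq_bigr => i _; by rewrite -bE.
have := abel_summation b n.
have -> : \sum_(i < n.+1) b i = 0 by rewrite -[RHS]a0; apply: eq_bigr => i _; rewrite bE.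
have -> : \sum_(l < n) (\sum_(i < l.+1) b i) * (b l.+1 - b l) = 0.
  apply: big1 => l _; rewrite (sb l) ?(ltn_trans (ltn_ord l))//.
  have := aroot l; have := aweight l; case: (l \in theta) => /=.
    by move=> /(_ isT) + _; rewrite /fundamental_weight => ->; rewrite mul0r.
  move=> _ /(_ isT); rewrite /simple_root -!bE /= => /eqP.
  by rewrite subr_eq0 => /eqP ->; rewrite subrr mulr0.
rewrite mul0r subr0 => /psumr_eq0P H; apply/rowP => i; rewrite mxE -bE; apply/eqP.
by rewrite -sqrf_eq0 expr2 H// => l _; rewrite -expr2 sqr_ge0.
Qed.

Context (d : nat) (theta : {set 'I_d.-1}).
Local Notation A := (a_theta R theta).

Lemma fundamental_weightP (j : 'I_d.-1) (c : R) (a b : A) :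
  fundamental_weight j (c *: a + b : A) =
  c * fundamental_weight j a + fundamental_weight j b.
Proof.
rewrite /fundamental_weight mulr_sumr -big_split /=.
by apply: eq_bigr => i _; rewrite !mxE.
Qed.

Lemma fundamental_weight0 (j : 'I_d.-1) : fundamental_weight j (0 : A) = 0.
Proof. by rewrite /fundamental_weight big1// => i _; rewrite mxE. Qed.

Lemma fundamental_weightZ (j : 'I_d.-1) (c : R) (a : A) :
  fundamental_weight j (c *: a : A) = c * fundamental_weight j a.
Proof. by rewrite -[c *: a]addr0 fundamental_weightP fundamental_weight0 addr0. Qed.

Lemma fundamental_weightB (j : 'I_d.-1) (a b : A) :
  fundamental_weight j (a - b : A) = fundamental_weight j a - fundamental_weight j b.
Proof. by rewrite addrC -scaleN1r fundamental_weightP mulN1r addrC. Qed.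

Lemma fundamental_weight_inj (a b : A) :
  (forall j, j \in theta -> fundamental_weight j a = fundamental_weight j b) ->
  a = b.
Proof.
move=> ab; apply/eqP; rewrite -subr_eq0; apply/eqP/val_inj => /=.
have /andP[/eqP s0 /forallP r0] := valP (a - b : A).
apply: (root_weight_eq0 s0) => j jt.
  by have /implyP/(_ jt)/eqP := r0 j.
by rewrite fundamental_weightB ab// subrr.
Qed.

End ATheta.

Section ThetaCoordinates.
Context (R : realType).

(** The square system formed by the trace, the weights in [theta] and the roots outside [theta] has
    trivial kernel by [root_weight_eq0], so it is solvable. This existence is what the [xget] in
    [kappa_theta] and in [iwasawa_cocycle] relies on. *)
Lemma exists_fundamental_weights d (theta : {set 'I_d.-1}) (c : 'I_d.-1 -> R) :
  exists a : a_theta R theta,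
    forall j, j \in theta -> fundamental_weight j a = c j.
Proof.
case: d theta c => [|n] theta c; first by exists 0 => -[].
pose L (a : 'rV[R]_n.+1) : 'rV[R]_n.+1 := \row_i
  (if unlift ord_max i is Some j
   then if j \in theta then fundamental_weight j a else simple_root j a
   else \sum_l a 0 l).
have Llin : linear L.
  move=> x a b; apply/rowP => i; rewrite !mxE; case: unlift => [j|].
    case: ifP => _.
      rewrite /fundamental_weight mulr_sumr -big_split /=.
      by apply: eq_bigr => l _; rewrite !mxE.
    by rewrite /simple_root !mxE; ring.
  by rewrite mulr_sumr -big_split /=; apply: eq_bigr => l _; rewrite !mxE.
pose LL : {linear 'rV[R]_n.+1 -> 'rV[R]_n.+1} :=
  HB.pack L (GRing.isLinear.Build _ _ _ _ L Llin).
have Lu : lin1_mx LL \in unitmx.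
  rewrite -row_free_unit -kermx_eq0; apply/eqP/row_matrixP => i.
  set u := row i _.
  have : u *m lin1_mx LL = 0 by rewrite -row_mul mulmx_ker row0.
  rewrite mul_rV_lin1 row0 => /rowP Lu0; apply: (@root_weight_eq0 R _ theta).
  - by have := Lu0 ord_max; rewrite !mxE unlift_none.
  - by move=> j jt; have := Lu0 (lift ord_max j); rewrite !mxE liftK (negbTE jt).
  - by move=> j jt; have := Lu0 (lift ord_max j); rewrite !mxE liftK jt.
pose t : 'rV[R]_n.+1 := \row_i (if unlift ord_max i is Some j
   then if j \in theta then c j else 0 else 0).
pose a := t *m invmx (lin1_mx LL).
have : LL a = t by rewrite -mul_rV_lin1 mulmxKV.
clearbody a; rewrite /LL /= /L {LL Llin Lu}.
move=> /rowP La.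
have aA : a \in @in_a_theta R n.+1 theta.
  apply/andP; split.
    by have := La ord_max; rewrite !mxE unlift_none => ->.
  apply/forallP => j; apply/implyP => jt.
  by have := La (lift ord_max j); rewrite !mxE liftK (negbTE jt) => ->.
exists (ATheta aA) => j jt.
by have := La (lift ord_max j); rewrite !mxE liftK jt => ->.
Qed.

Lemma kappa_thetaP k d (theta : {set 'I_d.-1}) (g : PSL (scalars R k) d) j :
  j \in theta -> fundamental_weight j (kappa_theta theta g) =
                 fundamental_weight j (kappa g).
Proof.
move=> jt; rewrite /kappa_theta; case: xgetP => [a _ /(_ j jt)//|H].
by have [a aP] := exists_fundamental_weights theta
  (fun j => fundamental_weight j (kappa g)); have := H a aP.
Qed.

(** The functional is expanded in the basis [e] of [a_theta] dual to the fundamental weights; the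
    constant is the sum of the moduli of the [phi (e i)]. *)
Lemma functional_bound d (theta : {set 'I_d.-1}) (phi : {scalar a_theta R theta}) :
  exists2 C : R, 0 <= C & forall a b : a_theta R theta,
    `|phi a - phi b| <= C * \sum_(j in theta)
      `|fundamental_weight j a - fundamental_weight j b|.
Proof.
have [e eP] : exists e : 'I_d.-1 -> a_theta R theta, forall i j, j \in theta ->
    fundamental_weight j (e i) = (i == j)%:R.
  have [e eP] := choice (fun i => exists_fundamental_weights theta (fun j => (i == j)%:R)).
  by exists e => i j; exact: eP.
have C0 i : 0 <= `|phi (e i)| by [].
exists (\sum_(i in theta) `|phi (e i)|) => [|a b]; first exact: sumr_ge0.
have phiE (x : a_theta R theta) :
    phi x = \sum_(i in theta) fundamental_weight i x * phi (e i).
  have xE : x = \sum_(i in theta) fundamental_weight i x *: e i; last first.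
    rewrite [in LHS]xE raddf_sum; apply: eq_bigr => i _; exact: scalarZ.
  apply: fundamental_weight_inj => j jt.
  have sumE (r : seq 'I_d.-1) (P : pred 'I_d.-1) (G : 'I_d.-1 -> a_theta R theta) :
      fundamental_weight j (\sum_(i <- r | P i) G i) =
      \sum_(i <- r | P i) fundamental_weight j (G i).
    elim/big_rec2: _ => [|i y1 y2 _ <-]; first exact: fundamental_weight0.
    by rewrite -[G i]scale1r fundamental_weightP mul1r scale1r.
  rewrite sumE (bigD1 j) //= big1 ?addr0 => [|i /andP[it ij]].
    by rewrite fundamental_weightZ eP// eqxx mulr1.
  by rewrite fundamental_weightZ eP// (negbTE ij) mulr0.
rewrite !phiE -sumrB; apply: le_trans (ler_norm_sum _ _ _) _.
rewrite mulr_suml; apply: ler_sum => i it.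
rewrite -mulrBl normrM mulrC ler_wpM2l//.
by rewrite (bigD1 i) //= lerDl sumr_ge0.
Qed.

End ThetaCoordinates.

(** * Flags spanned by frames *)

Section Frames.
Context (K : fieldType) (d : nat).
Implicit Type j : 'I_d.-1.

Lemma root_leq j : (j.+1 <= d)%N.
Proof. exact: ltnW (root_snd_subproof j). Qed.

Definition head_ord j (b : 'I_j.+1) : 'I_d := widen_ord (root_leq j) b.
Definition tail_ord j (b : 'I_j.+1) : 'I_d := rev_ord (head_ord b).

Definition first_cols j (h : 'M[K]_d) : 'M[K]_(d, j.+1) := colsub (@head_ord j) h.
(** The last rows of the inverse frame, in reverse order: independent linear forms that cut out the
    span of the first [d - j - 1] columns of [h]. Their minors are the Pluecker coordinates of an
    annihilator. *)
Definition last_rows j (h : 'M[K]_d) : 'M[K]_(j.+1, d) :=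
  rowsub (@tail_ord j) (invmx h).

Definition minors n (V : 'M[K]_(d, n)) (f : increasing_map d n) : K :=
  \det (rowsub (val f) V).
Definition row_minors n (P : 'M[K]_(n, d)) (f : increasing_map d n) : K :=
  \det (colsub (val f) P).

Lemma det_mul_minors n (P : 'M[K]_(n, d)) (V : 'M[K]_(d, n)) :
  \det (P *m V) = \sum_f row_minors P f * minors V f.
Proof. exact: cauchy_binet. Qed.

Lemma head_ord_inj j : injective (@head_ord j).
Proof. by move=> a b /(congr1 val) /= /val_inj. Qed.

Lemma mulmx_first_cols j (A h : 'M[K]_d) :
  A *m first_cols j h = first_cols j (A *m h).
Proof. by apply/matrixP => a b; rewrite !mxE; apply: eq_bigr => c _; rewrite mxE. Qed.

Lemma last_rows_mulmx j (A h : 'M[K]_d) : A \in unitmx -> h \in unitmx ->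
  last_rows j (invmx A *m h) = last_rows j h *m A.
Proof.
move=> Au hu; rewrite /last_rows.
have -> : invmx (invmx A *m h) = invmx h *m A.
  have u : invmx A *m h \in unitmx by rewrite unitmx_mul unitmx_inv Au.
  rewrite -[RHS](mulmxK u) mulmxA -[invmx h *m A *m _]mulmxA mulmxV//.
  by rewrite mulmx1 mulVmx// mul1mx.
by apply/matrixP => a b; rewrite !mxE; apply: eq_bigr => c _; rewrite mxE.
Qed.

Lemma first_cols_left_inverse j (h : 'M[K]_d) : h \in unitmx ->
  rowsub (@head_ord j) (invmx h) *m first_cols j h = 1%:M.
Proof.
move=> hu; have : invmx h *m h = 1%:M by rewrite mulVmx.
move=> /matrixP E; apply/matrixP => a b; have := E (head_ord a) (head_ord b).
rewrite !mxE (inj_eq (@head_ord_inj j)) => <-.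
by apply: eq_bigr => c _; rewrite !mxE.
Qed.

Lemma last_rows_right_inverse j (h : 'M[K]_d) : h \in unitmx ->
  last_rows j h *m colsub (@tail_ord j) h = 1%:M.
Proof.
move=> hu; have : invmx h *m h = 1%:M by rewrite mulVmx.
move=> /matrixP E; apply/matrixP => a b; have := E (tail_ord a) (tail_ord b).
rewrite !mxE (inj_eq (inj_comp rev_ord_inj (@head_ord_inj j))) => <-.
by apply: eq_bigr => c _; rewrite !mxE.
Qed.

(** A left inverse exists, and Cauchy-Binet writes the determinant 1 as a combination of these
    minors. *)
Lemma minors_first_cols_neq0 j (h : 'M[K]_d) : h \in unitmx ->
  exists f, minors (first_cols j h) f != 0.
Proof.
move=> hu; apply/existsP; apply: contraT; rewrite negb_exists => /forallP H.
have := det_mul_minors (rowsub (@head_ord j) (invmx h)) (first_cols j h).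
rewrite first_cols_left_inverse// det1 big1 => [/eqP|f _]; first by rewrite oner_eq0.
by have := H f; rewrite negbK => /eqP ->; rewrite mulr0.
Qed.

Lemma row_minors_last_rows_neq0 j (h : 'M[K]_d) : h \in unitmx ->
  exists f, row_minors (last_rows j h) f != 0.
Proof.
move=> hu; apply/existsP; apply: contraT; rewrite negb_exists => /forallP H.
have := det_mul_minors (last_rows j h) (colsub (@tail_ord j) h).
rewrite last_rows_right_inverse// det1 big1 => [/eqP|f _]; first by rewrite oner_eq0.
by have := H f; rewrite negbK => /eqP ->; rewrite mul0r.
Qed.

(* If [V] and [V'] have proportional minors, then [p] with [p V = 0] kills    *)
(* [V'] too: replacing a row of a left inverse [L] of [V'] by [p] gives [Q]   *)
(* with [det (Q V') = c det (Q V) = 0].                                       *)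
Lemma proportional_minors_kernel n (V V' : 'M[K]_(d, n)) (L : 'M[K]_(n, d))
    (c : K) (p : 'rV[K]_d) : L *m V' = 1%:M ->
  (forall f, minors V' f = c * minors V f) -> p *m V = 0 -> p *m V' = 0.
Proof.
move=> LV VV pV; set w := p *m V'; apply/rowP => r; rewrite [RHS]mxE.
pose Q : 'M[K]_(n, d) := \matrix_(a, b) (if a == r then p 0 b else L a b).
have QE (U : 'M[K]_(d, n)) a b :
    (Q *m U) a b = if a == r then (p *m U) 0 b else (L *m U) a b.
  by rewrite !mxE; case: eqVneq => ar; apply: eq_bigr => l _; rewrite !mxE ?ar ?eqxx// (negbTE ar).
have Q0 : \det (Q *m V) = 0.
  rewrite (expand_det_row _ r) big1// => b _.
  by rewrite QE eqxx pV mxE mul0r.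
have : \det (Q *m V') = 0.
  rewrite det_mul_minors (eq_bigr (fun f => c * (row_minors Q f * minors V f))).
    by rewrite -mulr_sumr -det_mul_minors Q0 mulr0.
  by move=> f _; rewrite VV mulrCA.
move=> /eqP/det0P[v v0 vM]; apply/eqP; apply: contraNT v0 => wr.
have Mb b : v 0 r * w 0 b + (if b == r then 0 else v 0 b) = 0.
  have /rowP/(_ b) := vM; rewrite mxE [RHS]mxE (bigD1 r) //= QE eqxx.
  suff -> : \sum_(a < n | a != r) v 0 a * (Q *m V') a b =
      if b == r then 0 else v 0 b by [].
  case: eqVneq => [->|br].
    by rewrite big1// => a ar; rewrite QE (negbTE ar) LV mxE (negbTE ar) mulr0.
  rewrite (bigD1 b) //= QE (negbTE br) LV mxE eqxx mulr1 big1 ?addr0//.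
  by move=> a /andP[ar ab]; rewrite QE (negbTE ar) LV mxE (negbTE ab) mulr0.
have vr : v 0 r = 0.
  by have /eqP := Mb r; rewrite eqxx addr0 mulf_eq0 (negbTE wr) orbF => /eqP.
apply/eqP/rowP => b; rewrite mxE; have := Mb b.
by rewrite vr mul0r add0r; case: eqVneq => // ->.
Qed.

End Frames.

Lemma col_eq0 (K : nmodType) m n (M : 'M[K]_(m, n)) (b : 'I_n) :
  col b M = 0 -> forall a, M a b = 0.
Proof. by move=> /matrixP H a; have := H a 0; rewrite !mxE. Qed.

(** * Flags described by frames, transversality by determinants *)

Section FlagFrames.
Context (K : numFieldType) (d : nat) (theta : {set 'I_d.-1}).
Local Notation flagT := (flag K theta).

Definition frame_flag (h : GL K d) : flagT := linear_act h (standard_flag K theta).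

Lemma rev_root_add (j : 'I_d.-1) : (j.+1 + (rev_ord j).+1 = d)%N.
Proof. by case: j => j jd /=; lia. Qed.

Lemma mem_standard_span n (x : 'cV[K]_d) : (n <= d)%N ->
  reflect (forall i : 'I_d, (n <= i)%N -> x i 0 = 0)
    (x \in <<take n (standard_basis K d)>>%VS).
Proof.
move=> nd; have sz : size (standard_basis K d) = d by rewrite size_map -cardE card_ord.
have nthE (l : 'I_d) : (standard_basis K d)`_l = delta_mx l 0.
  by rewrite (nth_map l) ?size_enum_ord// nth_ord_enum.
apply: (iffP idP) => [xs i ni|xi].
  have : {in take n (standard_basis K d), forall y : 'cV[K]_d, y i 0 = 0}.
    move=> y /(nthP 0)[l]; rewrite size_takel ?sz// => ln <-.
    have ld : (l < d)%N by exact: leq_trans ln nd.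
    rewrite nth_take// (nthE (Ordinal ld)) mxE.
    by case: eqP => // E; move: ni; rewrite E /= leqNgt ln.
  move=> H; rewrite (coord_span xs) summxE big1// => l _.
  rewrite mxE [X in _ * X]H ?mulr0//.
  by apply: mem_nth; rewrite size_tuple ltn_ord.
rewrite (matrix_sum_delta x); apply: memv_suml => i _.
rewrite big_ord1; have [ni|ni] := ltnP i n; last by rewrite xi// scale0r mem0v.
apply: memvZ; apply: memv_span; rewrite -nthE.
by apply/(nthP 0); exists i; rewrite ?size_takel ?sz// nth_take.
Qed.

Lemma mem_frame_flagP (h : GL K d) (j : root_in theta) (x : 'cV[K]_d) :
  reflect (exists y, x = first_cols (val j) h *m y) (x \in frame_flag h j).
Proof.
have hu := linear_group_unit h.
rewrite /frame_flag /= ffunE /= ffunE.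
apply: (iffP memv_imgP) => [[u us ->]|[y ->]].
  exists (\col_b u (head_ord b) 0); rewrite lfunE /=; apply/matrixP => a c.
  rewrite !mxE ord1 (bigID (fun i : 'I_d => (i < (val j).+1)%N)) /=.
  rewrite [X in _ + X]big1 ?addr0 => [|i]; last first.
    by rewrite -leqNgt => ji; move/mem_standard_span: us => ->; rewrite ?mulr0 ?root_leq.
  rewrite (big_ord_narrow (root_leq (val j))).
  by apply: eq_bigr => b _; rewrite !mxE.
exists (invmx h *m (first_cols (val j) h *m y)); last first.
  by rewrite lfunE /= mulmxA mulmxV// mul1mx.
apply/mem_standard_span; first exact: root_leq.
move=> i ji; rewrite mulmxA mulmx_first_cols mulVmx// mxE big1// => b _.
rewrite !mxE; case: eqP => [E|]; last by rewrite mul0r.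
by move: ji; rewrite E /= leqNgt ltn_ord.
Qed.

Lemma first_cols_mem (h : GL K d) (j : root_in theta) b :
  col b (first_cols (val j) h) \in frame_flag h j.
Proof. by apply/mem_frame_flagP; exists (delta_mx b 0); rewrite colE. Qed.

Lemma mem_frame_flag_kernel (h : GL K d) (j : root_in theta) (i : 'I_d.-1)
    (x : 'cV[K]_d) : (i.+1 + (val j).+1 = d)%N ->
  (x \in frame_flag h j) = (last_rows i h *m x == 0).
Proof.
move=> ij; have hu := linear_group_unit h.
have lE b : (last_rows i h *m x) b 0 = (invmx h *m x) (tail_ord b) 0.
  by rewrite !mxE; apply: eq_bigr => c _; rewrite !mxE.
rewrite /frame_flag /= ffunE /= ffunE.
apply/memv_imgP/eqP => [[u us xE]|xk].
  apply/matrixP => b c; rewrite ord1 lE xE lfunE /= mulKmx// mxE.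
  move/mem_standard_span: us => -> //; first exact: root_leq.
  by move: ij (ltn_ord b) => /=; lia.
exists (invmx h *m x); last by rewrite lfunE /= mulmxA mulmxV// mul1mx.
apply/mem_standard_span; first exact: root_leq.
move=> l jl; have bP : (d - l.+1 < i.+1)%N.
  by move: ij jl (ltn_ord l) (ltn_ord i) => /=; lia.
have <- : tail_ord (Ordinal bP) = l by apply/val_inj => /=; move: (ltn_ord l); lia.
by rewrite -lE xk mxE.
Qed.

Lemma transverse_frameP (h k : GL K d) : symmetric_roots theta ->
  transverse_flags (frame_flag h) (frame_flag k) <->
  forall i : root_in theta, \det (last_rows (val i) k *m first_cols (val i) h) != 0.
Proof.
move=> sym; have hu := linear_group_unit h.
have key (i j : root_in theta) : ((val i).+1 + (val j).+1 = d)%N ->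
    \det (last_rows (val i) k *m first_cols (val i) h) != 0 <->
    (frame_flag h i :&: frame_flag k j)%VS = 0%VS.
  move=> ij; set M := _ *m _; split=> [M0|cap0].
    apply/eqP; rewrite -subv0; apply/subvP => x.
    rewrite memv_cap memv0 => /andP[/mem_frame_flagP[y ->]].
    rewrite (mem_frame_flag_kernel _ _ ij) mulmxA -/M => /eqP My0.
    have Mu : M \in unitmx by rewrite unitmxE unitfE.
    by rewrite -[y](mulKmx Mu) My0 !mulmx0.
  rewrite -det_tr; apply/negP => /det0P[v v0 /(congr1 trmx)].
  rewrite trmx_mul trmxK trmx0 => Mv.
  have : first_cols (val i) h *m v^T \in (frame_flag h i :&: frame_flag k j)%VS.
    rewrite memv_cap (mem_frame_flag_kernel _ _ ij) mulmxA -/M Mv eqxx andbT.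
    by apply/mem_frame_flagP; exists v^T.
  rewrite cap0 memv0 => /eqP/(congr1 (mulmx (rowsub (@head_ord d (val i)) (invmx h)))).
  rewrite mulmxA first_cols_left_inverse// mul1mx mulmx0 => /(congr1 trmx).
  by rewrite trmxK trmx0; apply/eqP.
split=> [tr i|H i j ij]; last first.
  have c0 : (frame_flag h i :&: frame_flag k j)%VS = 0%VS by apply/key.
  have dimF (F : flagT) (l : root_in theta) : \dim (F l) = (val l).+1.
    by case: F => F /= /andP[/forallP/(_ l)/eqP].
  have dE : \dim (fullv : {vspace 'cV[K]_d}) = d by rewrite dimvf /dim /= muln1.
  have := dimv_sum_cap (frame_flag h i) (frame_flag k j).
  rewrite c0 dimv0 addn0 !dimF ij => E.
  by split=> //; apply/eqP; rewrite eqEdim subvf dE E leqnn.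
have jt : rev_ord (val i) \in theta by rewrite sym; exact: valP.
pose j : root_in theta := Sub (rev_ord (val i)) jt.
have ij : ((val i).+1 + (val j).+1 = d)%N.
  by rewrite /j SubK rev_root_add.
by apply/(key i j ij); have [] := tr i j ij.
Qed.

Lemma frame_flag_minors (h k : GL K d) (j : root_in theta) :
  frame_flag h j = frame_flag k j ->
  exists2 c : K, c != 0 &
    forall f, minors (first_cols (val j) h) f = c * minors (first_cols (val j) k) f.
Proof.
move=> hk; have [B BE] : exists B, first_cols (val j) h = first_cols (val j) k *m B.
  have H b : exists y, col b (first_cols (val j) h) = first_cols (val j) k *m y.
    by apply/mem_frame_flagP; rewrite -hk first_cols_mem.
  have [y yE] := choice H; exists (\matrix_(a, b) y b a 0).
  apply/matrixP => a b; have /matrixP/(_ a 0) := yE b; rewrite !mxE => ->.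
  by apply: eq_bigr => c _; rewrite !mxE.
have E f : minors (first_cols (val j) h) f = \det B * minors (first_cols (val j) k) f.
  by rewrite /minors BE mulrC -det_mulmx mul_rowsub_mx.
exists (\det B) => //; have [f] := minors_first_cols_neq0 (val j) (linear_group_unit h).
by rewrite E; apply: contra => /eqP ->; rewrite mul0r.
Qed.

(** The last rows of [h] vanish on the common subspace, so in the frame [k] only their values on the
    remaining columns matter; this makes them combinations of the last rows of [k]. *)
Lemma frame_flag_row_minors (h k : GL K d) (j : root_in theta) (i : 'I_d.-1) :
  (i.+1 + (val j).+1 = d)%N -> frame_flag h j = frame_flag k j ->
  exists c : K,
    forall f, row_minors (last_rows i h) f = c * row_minors (last_rows i k) f.
Proof.
move=> ij hk; have [B BE] : exists B, last_rows i h = B *m last_rows i k.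
  pose B := last_rows i h *m colsub (@tail_ord _ i) k; exists B.
  have ku := linear_group_unit k.
  have k0 : last_rows i h *m first_cols (val j) k = 0.
    apply/matrixP => a b; have := @first_cols_mem k j b.
    rewrite -hk (mem_frame_flag_kernel _ _ ij) colE mulmxA -colE => /eqP/col_eq0->.
    by rewrite mxE.
  rewrite -[LHS]mulmx1 -(mulmxV ku) mulmxA /B.
  apply/matrixP => a b; rewrite mxE [RHS]mxE.
  rewrite (bigID (fun l : 'I_d => (l < (val j).+1)%N)) /= big1 ?add0r => [|l lj].
    rewrite (reindex_inj rev_ord_inj) /=.
    rewrite (eq_bigl (fun l : 'I_d => (l < i.+1)%N)); last first.
      by move=> l /=; move: ij (ltn_ord l) => /=; lia.
    rewrite (big_ord_narrow (root_leq i)); apply: eq_bigr => l _.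
    by rewrite !mxE; congr (_ * _); apply: eq_bigr => c _; rewrite !mxE.
  have /matrixP/(_ a (Ordinal lj)) := k0; rewrite mxE [RHS]mxE => k0'.
  rewrite [X in X * _](_ : _ = 0) ?mul0r// -[RHS]k0' mxE; apply: eq_bigr => c _.
  by rewrite !mxE; congr (_ * k _ _); apply/val_inj.
exists (\det B) => f; by rewrite /row_minors BE -det_mulmx mulmx_colsub.
Qed.

(** Pluecker coordinates determine a subspace: by [proportional_minors_kernel] the forms that
    annihilate the subspace of [k] annihilate that of [h], and the dimensions agree. *)
Lemma eq_frame_flag (h k : GL K d) :
  (forall j : root_in theta, exists c : K, forall f,
    minors (first_cols (val j) h) f = c * minors (first_cols (val j) k) f) ->
  frame_flag h = frame_flag k.
Proof.
move=> H; apply/val_inj/ffunP => j.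
have dimF (F : flagT) : \dim (subspaces_of F j) = (val j).+1.
  by case: F => F /= /andP[/forallP/(_ j)/eqP].
apply/eqP; rewrite eqEdim (dimF (frame_flag h)) (dimF (frame_flag k)) leqnn andbT.
have ij : ((rev_ord (val j)).+1 + (val j).+1 = d)%N.
  by rewrite addnC rev_root_add.
apply/subvP => x /mem_frame_flagP[y ->].
rewrite (mem_frame_flag_kernel _ _ ij) mulmxA.
suff -> : last_rows (rev_ord (val j)) k *m first_cols (val j) h = 0 by rewrite mul0mx.
have [c cE] := H j.
apply/row_matrixP => a; rewrite row_mul row0.
apply: (proportional_minors_kernel (first_cols_left_inverse _ (linear_group_unit h)) cE).
rewrite -row_mul; apply/rowP => b.
have := @first_cols_mem k j b; rewrite (mem_frame_flag_kernel _ _ ij) colE mulmxA -colE.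
by rewrite [RHS]mxE mxE => /eqP/col_eq0->.
Qed.

End FlagFrames.

(** * Transitivity and the group actions *)

Section FlagTransitivity.
Local Open Scope quotient_scope.
Context (K : numFieldType) (d : nat) (theta : {set 'I_d.-1}).
Local Notation flagT := (flag K theta).

Lemma flag_dim (F : flagT) (j : root_in theta) : \dim (F j) = (val j).+1.
Proof. by case: F => F /= /andP[/forallP/(_ j)/eqP]. Qed.

Lemma flag_sub (F : flagT) (i j : root_in theta) :
  (val i <= val j)%N -> (F i <= F j)%VS.
Proof. by case: F => F /= /andP[_ /forallP/(_ i)/forallP/(_ j)/implyP]. Qed.

(** Induction on the length [t]: the next vector is taken in the smallest subspace of the flag of
    dimension larger than [t], or anywhere outside the span if there is none. *)
Lemma flag_adapted_basis (F : flagT) t : (t <= d)%N ->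
  exists b : seq 'cV[K]_d, [/\ size b = t, free b &
    forall j : root_in theta,
      ((val j < t)%N -> <<take (val j).+1 b>>%VS = F j) /\
      ((t <= val j)%N -> (<<b>> <= F j)%VS)].
Proof.
elim: t => [_|t IH td].
  by exists [::]; rewrite nil_free; split=> // j; split=> // _; rewrite span_nil sub0v.
have [b [bt bf bF]] := IH (ltnW td).
have db : \dim <<b>> = t by rewrite -bt; apply/eqP.
have ext v : v \notin <<b>>%VS -> free (rcons b v) /\ \dim <<rcons b v>> = t.+1.
  move=> vb; have fr : free (rcons b v).
    have -> : free (rcons b v) = free (v :: b) by apply: perm_free; rewrite perm_rcons.
    by rewrite free_cons vb.
  by split=> //; rewrite (eqP fr) size_rcons bt.
have takeE j v : (j < t)%N -> take j.+1 (rcons b v) = take j.+1 b.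
  by move=> jt; rewrite -cats1 takel_cat// bt.
have [/existsP[j0 j0t]|] := boolP [exists j : root_in theta, (t <= val j)%N]; last first.
  rewrite negb_exists => /forallP H.
  have /subvPn[v _ vb] : ~~ (fullv <= <<b>>)%VS.
    by apply/negP => /dimvS; rewrite db dimvf /dim /= muln1 leqNgt td.
  have [fr _] := ext v vb; exists (rcons b v); split=> // [|j].
    by rewrite size_rcons bt.
  have jt : (val j < t)%N by rewrite ltnNge H.
  split=> [_|]; last by rewrite leqNgt ltnS (ltnW jt).
  by rewrite takeE//; apply: (bF j).1.
have [j jt jmin] := arg_minnP (P := fun j : root_in theta => (t <= val j)%N)
  (fun j : root_in theta => val (val j)) j0t.
have /subvPn[v vF vb] : ~~ (F j <= <<b>>)%VS.
  by apply/negP => /dimvS; rewrite db flag_dim leqNgt ltnS jt.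
have [fr db'] := ext v vb; exists (rcons b v); split=> // [|i].
  by rewrite size_rcons bt.
have bF' (i' : root_in theta) : (t <= val i')%N -> (<<rcons b v>> <= F i')%VS.
  move=> it; rewrite -cats1 span_cat subv_add (bF i').2//= span_seq1 -memvE.
  by apply: (subvP (flag_sub F (jmin i' it))).
split=> [|ti]; last by apply: bF'; exact: ltnW.
rewrite ltnS leq_eqVlt => /orP[/eqP it|it]; last by rewrite takeE//; apply: (bF i).1.
rewrite take_oversize ?size_rcons ?bt ?it//.
by apply/eqP; rewrite eqEdim bF' ?it//= flag_dim db' it.
Qed.

Definition gl_of (A : 'M[K]_d) (Au : A \in unitmx) : GL K d :=
  @LinearGroup K false d A Au.

Lemma flag_frame (F : flagT) : exists h : GL K d, F = frame_flag theta h.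
Proof.
have [b [bd bf bF]] := flag_adapted_basis F (leqnn d).
pose h : 'M[K]_d := \matrix_(i, l) b`_l i 0.
have hx (x : 'cV[K]_d) : h *m x = \sum_(l < d) x l 0 *: b`_l.
  apply/matrixP => i c; rewrite ord1 !mxE summxE; apply: eq_bigr => l _.
  by rewrite !mxE mulrC.
have hu : h \in unitmx.
  rewrite -unitmx_tr -row_free_unit -kermx_eq0; apply/eqP/row_matrixP => r.
  have : row r (kermx h^T) *m h^T = 0 by rewrite -row_mul mulmx_ker row0.
  move=> /(congr1 trmx); rewrite trmx_mul trmxK trmx0 hx => H.
  rewrite row0; set x := row r _ in H *; apply/rowP => l; rewrite [RHS]mxE.
  have bd' : size b == d by apply/eqP.
  have /freeP/(_ (fun l => x 0 l)) : free (Tuple bd') by [].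
  apply; rewrite -[RHS]H; apply: eq_bigr => l' _; by rewrite [x^T l' 0]mxE.
exists (gl_of hu); apply/val_inj/ffunP => j; apply/eqP.
rewrite eq_sym eqEdim (flag_dim F) (flag_dim (frame_flag theta (gl_of hu))) leqnn andbT.
apply/subvP => x /mem_frame_flagP[y ->].
rewrite -[F j]/(subspaces_of F j) -(bF j).1 ?(leq_trans _ (root_leq (val j)))//.
rewrite [X in X \in _](_ : _ = \sum_(l < (val j).+1) y l 0 *: b`_l); last first.
  apply/matrixP => i c; rewrite ord1 !mxE summxE; apply: eq_bigr => l _.
  by rewrite !mxE mulrC.
apply: memv_suml => l _; apply: memvZ; apply: memv_span; apply/(nthP 0).
by exists l; rewrite ?nth_take// size_takel// bd root_leq.
Qed.

Lemma lmulM (A B : 'M[K]_d) (U : {vspace 'cV[K]_d}) :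
  (lmul A @: (lmul B @: U) = lmul (A *m B) @: U)%VS.
Proof.
rewrite -limg_comp; apply/eq_in_limg => u _.
by rewrite comp_lfunE !lfunE /= mulmxA.
Qed.

Lemma lmul1 (U : {vspace 'cV[K]_d}) : (lmul 1%:M @: U = U)%VS.
Proof.
rewrite -[RHS]lim1g; apply/eq_in_limg => u _.
by rewrite id_lfunE lfunE /= mul1mx.
Qed.

Lemma lmulZ (c : K) (A : 'M[K]_d) (U : {vspace 'cV[K]_d}) : c != 0 ->
  (lmul (c *: A) @: U = lmul A @: U)%VS.
Proof.
move=> c0; apply/eqP; rewrite eqEsubv; apply/andP; split; apply/subvP => x.
  move=> /memv_imgP[u uU ->]; rewrite lfunE /= -scalemxAl scalemxAr.
  by apply/memv_imgP; exists (c *: u); rewrite ?memvZ// lfunE.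
move=> /memv_imgP[u uU ->]; rewrite lfunE /=; apply/memv_imgP.
exists (c^-1 *: u); rewrite ?memvZ// lfunE /=.
by rewrite -scalemxAl -scalemxAr scalerA divff// scale1r.
Qed.

Lemma lift_mxM special (g h : projective_group K special d) :
  exists2 c : K, c != 0 & lift_mx (g * h)%g = c *: (lift_mx g *m lift_mx h).
Proof.
have /eqP/pi_projective_eq[c c0 E] : \pi_(projective_group K special d) (generic_quotient.repr (g * h)%g) =
    \pi_(projective_group K special d) (lg_mul (generic_quotient.repr g) (generic_quotient.repr h)) by rewrite reprK.
by exists c.
Qed.

Lemma lift_mx1 special : exists2 c : K, c != 0 &
  lift_mx (1%g : projective_group K special d) = c *: 1%:M.
Proof.
have /eqP/pi_projective_eq[c c0 E] : \pi_(projective_group K special d) (generic_quotient.repr (1%g : projective_group K special d)) =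
    \pi_(projective_group K special d) (lg_one K special d) by rewrite reprK.
by exists c.
Qed.

Lemma flag_actM special (g h : projective_group K special d) (F : flagT) :
  flag_act (g * h)%g F = flag_act g (flag_act h F).
Proof.
apply/val_inj/ffunP => j /=; rewrite !ffunE lmulM.
by have [c c0 ->] := lift_mxM g h; rewrite lmulZ.
Qed.

Lemma flag_act1 special (F : flagT) :
  flag_act (1%g : projective_group K special d) F = F.
Proof.
apply/val_inj/ffunP => j /=; rewrite !ffunE.
by have [c c0 ->] := lift_mx1 special; rewrite lmulZ// lmul1.
Qed.

Lemma flag_act_frame special (g : projective_group K special d) (h : GL K d) A
    (Au : A \in unitmx) : A = lift_mx g *m h ->
  flag_act g (frame_flag theta h) = frame_flag theta (gl_of Au).
Proof.
by move=> AE; apply/val_inj/ffunP => j /=; rewrite !ffunE lmulM /= AE.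
Qed.

Lemma proj_actM special (g h : projective_group K special d) (x : projective_space K d) :
  proj_act (g * h)%g x = proj_act g (proj_act h x).
Proof.
apply/val_inj; rewrite /= lmulM.
by have [c c0 ->] := lift_mxM g h; rewrite lmulZ.
Qed.

Lemma proj_act1 special (x : projective_space K d) :
  proj_act (1%g : projective_group K special d) x = x.
Proof.
apply/val_inj; rewrite /=.
by have [c c0 ->] := lift_mx1 special; rewrite lmulZ// lmul1.
Qed.

(* [k] times the reversal permutation matrix. *)
Lemma transverse_base (k : GL K d) : exists h : GL K d, forall i : 'I_d.-1,
  last_rows i k *m first_cols i h = 1%:M.
Proof.
have ku := linear_group_unit k.
have hu : k *m perm_mx (perm rev_ord_inj) \in unitmx.
  by rewrite unitmx_mul ku unitmx_perm.
exists (gl_of hu) => i.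
apply/matrixP => a b; rewrite [LHS]mxE.
have -> : \sum_l last_rows i k a l * first_cols i (gl_of hu) l b =
    (invmx k *m (k *m perm_mx (perm rev_ord_inj))) (tail_ord a) (head_ord b).
  by rewrite [RHS]mxE; apply: eq_bigr => l _; rewrite !mxE.
by rewrite mulKmx// !mxE permE rev_ordK; congr (_ %:R); congr nat_of_bool.
Qed.

End FlagTransitivity.

(** * Convergence of flags and of points *)

Section Sequences.
Context (K : numFieldType).

Lemma cvg_big_sum (I : Type) (r : seq I) (P : pred I) (u : I -> nat -> K) (l : I -> K) :
  (forall i, P i -> u i @ \oo --> l i) ->
  (fun n => \sum_(i <- r | P i) u i n) @ \oo --> \sum_(i <- r | P i) l i.
Proof.
move=> H; elim: r => [|i r IH].
  by rewrite big_nil (_ : (fun n => _) = cst 0); [exact: cvg_cst|apply/funext => n; rewrite big_nil].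
have E n : \sum_(i' <- i :: r | P i') u i' n =
    (if P i then u i n + \sum_(i' <- r | P i') u i' n else \sum_(i' <- r | P i') u i' n).
  by rewrite big_cons.
rewrite big_cons; under eq_fun do rewrite E.
by case: ifP => Pi //; apply: cvgD => //; exact: H.
Qed.

Lemma cvg_big_prod (I : Type) (r : seq I) (P : pred I) (u : I -> nat -> K) (l : I -> K) :
  (forall i, P i -> u i @ \oo --> l i) ->
  (fun n => \prod_(i <- r | P i) u i n) @ \oo --> \prod_(i <- r | P i) l i.
Proof.
move=> H; elim: r => [|i r IH].
  by rewrite big_nil (_ : (fun n => _) = cst 1); [exact: cvg_cst|apply/funext => n; rewrite big_nil].
have E n : \prod_(i' <- i :: r | P i') u i' n =
    (if P i then u i n * \prod_(i' <- r | P i') u i' n else \prod_(i' <- r | P i') u i' n).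
  by rewrite big_cons.
rewrite big_cons; under eq_fun do rewrite E.
by case: ifP => Pi //; apply: cvgM => //; exact: H.
Qed.

Definition mx_cvg m n (A : nat -> 'M[K]_(m, n)) (L : 'M[K]_(m, n)) : Prop :=
  forall i j, (fun p => A p i j) @ \oo --> L i j.

Lemma mx_cvg_det n (A : nat -> 'M[K]_n) (L : 'M[K]_n) :
  mx_cvg A L -> (fun p => \det (A p)) @ \oo --> \det L.
Proof.
move=> AL; apply: cvg_big_sum => s _; apply: cvgM; first exact: cvg_cst.
by apply: cvg_big_prod => i _; exact: AL.
Qed.

Lemma mx_cvg_mul m n q (A : nat -> 'M[K]_(m, n)) (B : nat -> 'M[K]_(n, q))
    (LA : 'M[K]_(m, n)) (LB : 'M[K]_(n, q)) :
  mx_cvg A LA -> mx_cvg B LB -> mx_cvg (fun p => A p *m B p) (LA *m LB).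
Proof.
move=> hA hB i j; rewrite mxE (_ : (fun p => _) = (fun p => \sum_l A p i l * B p l j)).
  by apply: cvg_big_sum => l _; exact: cvgM.
by apply/funext => p; rewrite mxE.
Qed.

Lemma mx_cvg_cst m n (A : 'M[K]_(m, n)) : mx_cvg (fun=> A) A.
Proof. by move=> i j; exact: cvg_cst. Qed.

Lemma mx_cvg_scale m n (c : nat -> K) (A : nat -> 'M[K]_(m, n)) (lc : K) LA :
  c @ \oo --> lc -> mx_cvg A LA -> mx_cvg (fun p => c p *: A p) (lc *: LA).
Proof.
move=> hc hA i j; rewrite mxE (_ : (fun p => _) = (fun p => c p * A p i j)).
  exact: cvgM.
by apply/funext => p; rewrite mxE.
Qed.

Lemma mx_cvg_sub m n m' n' (f : 'I_m' -> 'I_m) (g : 'I_n' -> 'I_n)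
    (A : nat -> 'M[K]_(m, n)) L :
  mx_cvg A L -> mx_cvg (fun p => mxsub f g (A p)) (mxsub f g L).
Proof.
move=> H i j; rewrite mxE (_ : (fun p => _) = (fun p => A p (f i) (g j))); first exact: H.
by apply/funext => p; rewrite mxE.
Qed.

Lemma mx_cvg_inv n (A : nat -> 'M[K]_n) (L : 'M[K]_n) :
  (forall p, A p \in unitmx) -> L \in unitmx ->
  mx_cvg A L -> mx_cvg (fun p => invmx (A p)) (invmx L).
Proof.
move=> Au Lu AL i j.
have E (M : 'M[K]_n) : M \in unitmx -> invmx M i j = (\det M)^-1 * cofactor M j i.
  by move=> Mu; rewrite /invmx Mu !mxE.
rewrite E// (_ : (fun p => _) = (fun p => (\det (A p))^-1 * cofactor (A p) j i)).
  apply: cvgM.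
    apply: (@cvgV _ _ _ _ (fun p => \det (A p))); last exact: mx_cvg_det.
    by rewrite -unitfE -unitmxE.
  apply: cvgM; first exact: cvg_cst.
  apply: mx_cvg_det => a b.
  rewrite !mxE (_ : (fun p => _) = (fun p => A p (lift j a) (lift i b))) //.
  by apply/funext => p; rewrite !mxE.
by apply/funext => p; rewrite E.
Qed.

Lemma subseq_cvg (T : topologicalType) (u : nat -> T) (l : T) (f : nat -> nat) :
  increasing_seq f -> u @ \oo --> l -> (u \o f) @ \oo --> l.
Proof.
move=> fi ul; apply: cvg_comp ul.
have fn n : (n <= f n)%N.
  elim: n => // n IH; apply: leq_ltn_trans IH _.
  by have := leW_mono fi n n.+1; rewrite !ltEnat /= ltnSn => ->.
move=> A [N _ NA]; exists N => // n /= Nn; apply: NA => /=.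
exact: leq_trans Nn (fn n).
Qed.

Lemma mx_cvg_subseq m n (A : nat -> 'M[K]_(m, n)) (L : 'M[K]_(m, n)) f :
  increasing_seq f -> mx_cvg A L -> mx_cvg (A \o f) L.
Proof. by move=> fi AL i j; apply: (subseq_cvg fi (AL i j)). Qed.

Lemma increasing_comp (f g : nat -> nat) :
  increasing_seq f -> increasing_seq g -> increasing_seq (f \o g).
Proof. by move=> fi gi n m; rewrite -[RHS]gi -[RHS]fi. Qed.

End Sequences.

(** * Limits and compactness over the scalars *)

Section ScalarLimits.
Context (R : realType) (k : scalar_kind).
Local Notation K := (scalars R k).

(** In the partial order of [R[i]] a positive element is real, so radii of balls in [scalars R k]
    may be taken in [R]. *)
Lemma scalar_gt0 (e : K) : 0 < e -> exists2 x : R, 0 < x & e = scalar_of_real k x.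
Proof.
move: e; rewrite /scalar_of_real; case: k => e /= e0; first by exists e.
exists (complex.Re e); first by move: e0; rewrite ltcE /= => /andP[].
by rewrite RRe_real// gtr0_real.
Qed.

Lemma scalar_of_real_lt (x y : R) : (scalar_of_real k x < scalar_of_real k y) = (x < y).
Proof. by rewrite /scalar_of_real; case: k => //=; rewrite ltcR. Qed.

Lemma scalar_cvgP (u : nat -> K) (l : K) :
  u @ \oo --> l <-> (fun n => scalar_abs (u n - l)) @ \oo --> (0 : R).
Proof.
split=> [/cvgrPdist_lt H|/cvgrPdist_lt H]; apply/cvgrPdist_lt => e e0.
  have e0' : 0 < scalar_of_real k e.
    rewrite -(_ : scalar_of_real k 0 = 0) ?scalar_of_real_lt//.
    by rewrite /scalar_of_real; case: k.
  have := H _ e0'; apply: filterS => n; rewrite abs_numr scalar_of_real_lt.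
  by rewrite sub0r normrN ger0_norm ?abs_ge0// -absN opprB.
have [x x0 ->] := scalar_gt0 e0.
have := H _ x0; apply: filterS => n; rewrite abs_numr scalar_of_real_lt.
by rewrite sub0r normrN ger0_norm ?abs_ge0// -absN opprB.
Qed.

Lemma cvg_scalar_abs (u : nat -> K) (l : K) :
  u @ \oo --> l -> (fun n => scalar_abs (u n)) @ \oo --> scalar_abs l.
Proof.
move=> /scalar_cvgP/cvgrPdist_lt H; apply/cvgrPdist_lt => e e0.
have := H _ e0; apply: filterS => n; rewrite sub0r normrN ger0_norm ?abs_ge0//.
apply: le_lt_trans; rewrite ler_norml; apply/andP; split.
  have := absD l (u n - l); rewrite subrKC => h; lra.
have := absD (u n) (l - u n); rewrite subrKC -(absN (l - u n)) opprB => h; lra.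
Qed.

Lemma cvg_scalar_of_real (u : nat -> R) (l : R) :
  u @ \oo --> l -> (fun n => scalar_of_real k (u n)) @ \oo --> scalar_of_real k l.
Proof.
move=> ul; apply/scalar_cvgP.
have E n : scalar_abs (scalar_of_real k (u n) - scalar_of_real k l) = `|u n - l|.
  rewrite -(abs_real k); congr scalar_abs.
  by rewrite /scalar_of_real; case: k => //=; rewrite rmorphB.
under eq_fun do rewrite E.
by rewrite -(normr0 R); apply: cvg_norm; apply/subr_cvg0.
Qed.

Lemma real_bolzano (u : nat -> R) (M : R) : (forall n, `|u n| <= M) ->
  exists2 f : nat -> nat, increasing_seq f & exists l : R, (u \o f) @ \oo --> l.
Proof.
move=> uM; have : bounded_fun u.
  exists M; split; first exact: num_real.
  by move=> x Mx n _ /=; apply: le_trans (uM n) _; exact: ltW.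
by move=> /bolzano_weierstrass[f fi /cvg_ex[l fl]]; exists f => //; exists l.
Qed.

End ScalarLimits.

Section ScalarBolzano.
Context (R : realType) (k : scalar_kind).
Local Notation K := (scalars R k).

Lemma scalar_bolzano (u : nat -> K) (M : R) : (forall n, scalar_abs (u n) <= M) ->
  exists2 f : nat -> nat, increasing_seq f & exists l : K, (u \o f) @ \oo --> l.
Proof.
move: u; rewrite /scalar_abs; case: k => /= u uM; first exact: real_bolzano uM.
have reM n : `|complex.Re (u n)| <= M.
  apply: le_trans (uM n); case: (u n) => x y /=.
  by rewrite -sqrtr_sqr ler_wsqrtr// lerDl sqr_ge0.
have imM n : `|complex.Im (u n)| <= M.
  apply: le_trans (uM n); case: (u n) => x y /=.
  by rewrite -sqrtr_sqr ler_wsqrtr// lerDr sqr_ge0.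
have [f fi [a fa]] := real_bolzano reM.
have [g gi [b gb]] := real_bolzano (u := (fun n => complex.Im (u n)) \o f) (fun n => imM (f n)).
exists (f \o g); first exact: increasing_comp.
exists (a%:C + 'i * b%:C)%C.
have ca := @cvg_scalar_of_real _ ComplexScalars _ _ (subseq_cvg gi fa).
have cb := @cvg_scalar_of_real _ ComplexScalars _ _ gb.
rewrite (_ : u \o (f \o g) = fun n => ((complex.Re (u (f (g n))))%:C +
    'i * (complex.Im (u (f (g n))))%:C)%C); last first.
  by apply/funext => n; rewrite -complexE.
have cc := cvgD ca (cvgM (@cvg_cst (scalars R ComplexScalars) ('i)%C _ \oo _) cb).
exact: cc.
Qed.

Lemma family_bolzano (I : finType) (u : I -> nat -> K) (M : R) :
  (forall i n, scalar_abs (u i n) <= M) ->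
  exists2 f : nat -> nat, increasing_seq f &
    exists l : I -> K, forall i, (u i \o f) @ \oo --> l i.
Proof.
move=> uM; suff [f fi [l fl]] : exists2 f : nat -> nat, increasing_seq f &
    exists l : I -> K, forall i, i \in enum I -> (u i \o f) @ \oo --> l i.
  by exists f => //; exists l => i; apply: fl; rewrite mem_enum.
elim: (enum I) => [|i s [f fi [l fl]]].
  by exists id; [by []|exists (fun=> 0)].
have [g gi [a ga]] := scalar_bolzano (u := u i \o f) (fun n => uM i (f n)).
exists (f \o g); first exact: increasing_comp.
exists (fun j => if j == i then a else l j) => j; rewrite inE.
case: eqVneq => [-> _|_ /= js]; first exact: ga.
exact: (subseq_cvg gi (fl j js)).
Qed.

Lemma mx_bolzano m n (A : nat -> 'M[K]_(m, n)) (M : R) :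
  (forall p i j, scalar_abs (A p i j) <= M) ->
  exists2 f : nat -> nat, increasing_seq f & exists L : 'M[K]_(m, n), mx_cvg (A \o f) L.
Proof.
move=> AM.
have [f fi [l fl]] := @family_bolzano ('I_m * 'I_n)%type (fun ij p => A p ij.1 ij.2) M
  (fun ij p => AM p ij.1 ij.2).
exists f => //; exists (\matrix_(i, j) l (i, j)) => i j.
by rewrite mxE; exact: (fl (i, j)).
Qed.

End ScalarBolzano.

(** * Lifting convergent sequences through quotient maps *)

Section SequentialLifts.

(** Diagonal choice: [s n] is picked in the smallest of [B 0, ..., B n] that still meets the fibre
    over [t n]. As the sets decrease, it then lies in all the larger ones. *)
Lemma lift_sequence (S T : Type) (f : S -> T) (B : nat -> set S) (t : nat -> T) :
  (forall n m, (n <= m)%N -> B m `<=` B n) ->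
  (forall n, exists s, f s = t n) ->
  (forall p, exists N, forall n, (N <= n)%N -> exists2 s, B p s & f s = t n) ->
  exists s : nat -> S, (forall n, f (s n) = t n) /\
    forall p, exists N, forall n, (N <= n)%N -> B p (s n).
Proof.
move=> Bdec ft tB.
have H n : exists s, f s = t n /\
    forall p, (p <= n)%N -> (exists2 s', B p s' & f s' = t n) -> B p s.
  suff : forall q, exists s, f s = t n /\
      forall p, (p < q)%N -> (exists2 s', B p s' & f s' = t n) -> B p s.
    by move=> /(_ n.+1)[s [fs sB]]; exists s; split.
  elim=> [|q [s [fs sB]]]; first by have [s fs] := ft n; exists s.
  have [[s' Bs' fs']|no] := pselect (exists2 s', B q s' & f s' = t n).
    exists s'; split=> // p; rewrite ltnS => pq _; exact: Bdec pq _ Bs'.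
  exists s; split=> // p; rewrite ltnS leq_eqVlt => /orP[/eqP ->//|]; exact: sB.
have [s sP] := choice H; exists s; split=> [n|p]; first exact: (sP n).1.
have [N NP] := tB p; exists (maxn N p) => n; rewrite geq_max => /andP[Nn pn].
by apply: (sP n).2 => //; exact: NP.
Qed.

Context (K : numFieldType).
(** The radii [p.+1%:R^-1] then give countable bases of neighbourhoods, so the topologies below can
    be tested on sequences. *)
Hypothesis archK : forall e : K, 0 < e -> exists n : nat, n.+1%:R^-1 < e.

Definition mx_near m n (A : 'M[K]_(m, n)) (p : nat) : set 'M[K]_(m, n) :=
  [set B | forall i j, `|A i j - B i j| < p.+1%:R^-1].

Lemma mx_near_decreasing m n (A : 'M[K]_(m, n)) p q : (p <= q)%N ->
  mx_near A q `<=` mx_near A p.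
Proof.
move=> pq B AB i j; apply: lt_le_trans (AB i j) _.
by rewrite lef_pV2 ?posrE ?ltr0n// ler_nat.
Qed.

Lemma nbhs_mx_near m n (A : 'M[K]_(m, n)) (S : set 'M[K]_(m, n)) :
  nbhs A S <-> exists p, mx_near A p `<=` S.
Proof.
split=> [[P PA PS]|[p pS]]; last first.
  exists (fun i j => [set x | `|A i j - x| < p.+1%:R^-1]) => [i j|B AB].
    apply/nbhs_ballP; exists p.+1%:R^-1; first by rewrite /= invr_gt0 ltr0n.
    by rewrite -ball_normE.
  exact: pS.
have H (ij : 'I_m * 'I_n) : exists p, forall x, `|A ij.1 ij.2 - x| < p.+1%:R^-1 -> P ij.1 ij.2 x.
  have /nbhs_ballP[e /= e0 eP] := PA ij.1 ij.2.
  have [p pe] := archK e0; exists p => x xp; apply: eP.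
  by rewrite -ball_normE /=; exact: lt_trans pe.
have [p pP] := choice H.
exists (\max_ij p ij) => B AB; apply: PS => i j; apply: (pP (i, j)).
apply: lt_le_trans (AB i j) _; rewrite lef_pV2 ?posrE ?ltr0n// ler_nat ltnS.
exact: (leq_bigmax (i, j)).
Qed.

Lemma mx_cvg_near m n (A : nat -> 'M[K]_(m, n)) (L : 'M[K]_(m, n)) :
  mx_cvg A L <-> forall p, exists N, forall q, (N <= q)%N -> mx_near L p (A q).
Proof.
split=> [AL p|AL i j].
  have H (ij : 'I_m * 'I_n) : exists N, forall q, (N <= q)%N ->
      `|L ij.1 ij.2 - A q ij.1 ij.2| < p.+1%:R^-1.
    have /cvgrPdist_lt/(_ p.+1%:R^-1) := AL ij.1 ij.2.
    by rewrite invr_gt0 ltr0n => /(_ isT)[N _ NP]; exists N => q; exact: NP.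
  have [N NP] := choice H; exists (\max_ij N ij) => q Nq i j; apply: (NP (i, j)).
  exact: leq_trans (leq_bigmax (i, j)) Nq.
apply/cvgrPdist_lt => e e0; have [p pe] := archK e0; have [N NP] := AL p.
by exists N => // q /= Nq; apply: lt_trans (NP q Nq i j) pe.
Qed.

Lemma open_mxP m n (S : set 'M[K]_(m, n)) :
  open S <-> forall A, S A -> exists p, mx_near A p `<=` S.
Proof.
rewrite openE; split=> H A /H; first by move/nbhs_mx_near.
by move=> AS; apply/nbhs_mx_near.
Qed.

Section Induced.
Context (m n : nat) (S : choiceType) (v : S -> 'M[K]_(m, n)).
Local Notation W := (initial_topology v).

Lemma open_inducedP (U : set W) :
  open U <-> forall s, U s -> exists p, forall s', mx_near (v s) p (v s') -> U s'.
Proof.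
split=> [[V Vopen <-] s Vs|H].
  by have /open_mxP/(_ _ Vs)[p pV] := Vopen; exists p => s' /pV.
exists (\bigcup_(sp in [set sp : S * nat |
    forall s', mx_near (v sp.1) sp.2 (v s') -> U s']) (mx_near (v sp.1) sp.2)°).
  by apply: bigcup_open => sp _; exact: open_interior.
apply/seteqP; split=> [s' [sp spU /interior_subset]|s Us]; first exact: spU.
have [p pU] := H s Us; exists (s, p) => //=.
by apply/nbhs_mx_near; exists p.
Qed.

Lemma nbhs_inducedP (s : W) (U : set W) :
  nbhs s U <-> exists p, forall s', mx_near (v s) p (v s') -> U s'.
Proof.
split=> [|[p pU]].
  rewrite nbhsE => -[V [Vopen Vs] VU].
  by have /open_inducedP/(_ _ Vs)[p pV] := Vopen; exists p => s' /pV/VU.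
rewrite nbhsE; exists (v @^-1` (mx_near (v s) p)°); last first.
  by move=> s' /interior_subset; exact: pU.
split; first by exists (mx_near (v s) p)° => //; exact: open_interior.
by apply/nbhs_mx_near; exists p.
Qed.

Context (T : choiceType) (f : S -> T).
(** Openness of the quotient map: points near [f s] can be lifted near any other preimage of
    [f s]. *)
Hypothesis f_open : forall s s', f s = f s' -> forall p, exists q, forall s1,
  mx_near (v s) q (v s1) -> exists2 s2, f s2 = f s1 & mx_near (v s') p (v s2).
Local Notation Q := (final_topology (f : W -> T)).

Lemma quotient_openP (U : set Q) :
  open U <-> forall s, U (f s) -> exists p, forall s', mx_near (v s) p (v s') -> U (f s').
Proof. exact: open_inducedP. Qed.

Lemma quotient_cvg (u : nat -> S) (s : S) :
  mx_cvg (v \o u) (v s) -> (fun n => f (u n) : Q) @ \oo --> (f s : Q).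
Proof.
move=> /mx_cvg_near us U; rewrite nbhsE => -[V [/quotient_openP Vopen Vs] VU].
have [p pV] := Vopen s Vs; have [N NP] := us p.
by exists N => // q /= Nq; apply/VU/pV/NP.
Qed.

(** By [f_open] the image of a small ball around [s] is open in the quotient, so the terms of [t]
    eventually have lifts in that ball; [lift_sequence] combines these lifts. *)
Lemma quotient_lift (t : nat -> T) (s : S) : (forall x, exists s, f s = x) ->
  (t : nat -> Q) @ \oo --> (f s : Q) ->
  exists u : nat -> S, (forall n, f (u n) = t n) /\ mx_cvg (v \o u) (v s).
Proof.
move=> f_surj ts.
have [|q||u [fu uB]] := @lift_sequence S T f (fun p => v @^-1` mx_near (v s) p) t.
- by move=> p q pq s' /= /(mx_near_decreasing pq).
- exact: f_surj.
- move=> p.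
  pose V : set Q := [set x | exists2 s', f s' = x & (mx_near (v s) p)° (v s')].
  have Vopen : open V.
    apply/quotient_openP => s1 [s2 f12 s2V].
    have : nbhs (v s2) (mx_near (v s) p)° by apply: open_nbhs_nbhs; split=> //; exact: open_interior.
    move=> /nbhs_mx_near[q qV]; have [q' q'P] := f_open (esym f12) q.
    exists q' => s' /q'P[s3 f3 /qV]; by exists s3.
  have : nbhs (f s : Q) V.
    apply: open_nbhs_nbhs; split=> //; exists s => //.
    by apply/nbhs_mx_near; exists p.
  move=> /ts[N _ NP]; exists N => q Nq; have [s' fs' /interior_subset] := NP q Nq.
  by exists s'.
by exists u; split=> //; apply/mx_cvg_near => p; exact: uB.
Qed.

Lemma quotient_closedP (U : set Q) :
  (forall (u : nat -> S) s, mx_cvg (v \o u) (v s) -> (forall q, U (f (u q))) -> U (f s)) ->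
  closed U.
Proof.
move=> H; rewrite -[U]setCK; apply: open_closedC; apply/quotient_openP => s Us.
apply: contrapT => /forallNP no; apply: Us.
have {}no p : exists s', mx_near (v s) p (v s') /\ U (f s').
  have /existsNP[s'] := no p; rewrite not_implyE => -[sp /contrapT Us'].
  by exists s'.
have [u uP] := choice no; apply: (H u) => [|q]; last exact: (uP q).2.
apply/mx_cvg_near => p; exists p => q pq.
by apply: (mx_near_decreasing pq); exact: (uP q).1.
Qed.

End Induced.

End SequentialLifts.

Section Archimedean.

Lemma real_small (R : realType) (e : R) : 0 < e -> exists n : nat, n.+1%:R^-1 < e.
Proof.
move=> e0; have [n ne] := @ltr_add_invr R 0 e e0; exists n.
by rewrite add0r in ne.
Qed.

Lemma scalar_small (R : realType) k (e : scalars R k) : 0 < e ->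
  exists n : nat, n.+1%:R^-1 < e.
Proof.
move=> /scalar_gt0[x x0 ->]; have [n nx] := real_small x0; exists n.
rewrite (_ : n.+1%:R^-1 = scalar_of_real k n.+1%:R^-1) ?scalar_of_real_lt//.
by rewrite /scalar_of_real; case: k {e} => //=; rewrite fmorphV rmorph_nat.
Qed.

End Archimedean.

Section FlagTopology.
Context (K : numFieldType) (d : nat) (theta : {set 'I_d.-1}).
Hypothesis archK : forall e : K, 0 < e -> exists n : nat, n.+1%:R^-1 < e.
Local Notation flagT := (flag K theta).
Local Notation frame := (frame_flag theta).

Lemma mx_near_mulr n (A M : 'M[K]_n) p : exists q, forall B,
  mx_near A q B -> mx_near (A *m M) p (B *m M).
Proof.
apply: contrapT => /forallNP no.
have {}no q : exists B, mx_near A q B /\ ~ mx_near (A *m M) p (B *m M).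
  by have /existsNP[B] := no q; rewrite not_implyE; exists B.
have [B BP] := choice no.
have BA : mx_cvg B A.
  apply/(mx_cvg_near archK) => q; exists q => q' qq'.
  by apply: (mx_near_decreasing qq'); exact: (BP q').1.
have /(mx_cvg_near archK)/(_ p)[N NP] := mx_cvg_mul BA (@mx_cvg_cst K _ _ M).
by have [_] := BP N; apply; exact: NP.
Qed.

(** Right multiplication by [invmx h *m h'] is continuous, and since this matrix fixes the standard
    flag it does not change the flag of a frame. *)
Lemma frame_open (h h' : GL K d) : frame h = frame h' -> forall p, exists q,
  forall h1 : GL K d, mx_near (h : 'M[K]_d) q h1 ->
  exists2 h2 : GL K d, frame h2 = frame h1 & mx_near (h' : 'M[K]_d) p h2.
Proof.
move=> hh' p; have hu := linear_group_unit h; have hu' := linear_group_unit h'.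
have [q qP] := mx_near_mulr h (invmx h *m h') p.
exists q => h1 /qP; rewrite mulmxA mulmxV// mul1mx => near1.
have h1u := linear_group_unit h1.
have Au : (h1 : 'M[K]_d) *m (invmx h *m h') \in unitmx.
  by rewrite !unitmx_mul h1u unitmx_inv hu.
exists (gl_of Au) => //; apply/val_inj/ffunP => j /=; rewrite !ffunE /=.
rewrite -lmulM; congr (_ @: _)%VS; rewrite -lmulM.
have /(congr1 (fun F : flagT => subspaces_of F j)) := hh'.
rewrite /= !ffunE /= => <-; rewrite lmulM mulVmx// lmul1.
by rewrite ?ffunE.
Qed.

Lemma frame_cvg (u : nat -> GL K d) (h : GL K d) :
  mx_cvg (fun n => u n : 'M[K]_d) h -> (fun n => frame (u n)) @ \oo --> frame h.
Proof. by move=> uh; apply: (quotient_cvg archK (f := frame)). Qed.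

Lemma flag_lift (t : nat -> flagT) (h : GL K d) : t @ \oo --> frame h ->
  exists u : nat -> GL K d, (forall n, frame (u n) = t n) /\
    mx_cvg (fun n => u n : 'M[K]_d) h.
Proof.
move=> th; apply: (quotient_lift archK frame_open) th => F.
by have [g ->] := flag_frame F; exists g.
Qed.

Lemma flag_closedP (U : set flagT) :
  (forall (u : nat -> GL K d) (h : GL K d), mx_cvg (fun n => u n : 'M[K]_d) h ->
    (forall n, U (frame (u n))) -> U (frame h)) -> closed U.
Proof. exact: (quotient_closedP archK (f := frame)). Qed.

End FlagTopology.

Section ProjectiveTopology.
Context (K : numFieldType) (m : nat).
Hypothesis archK : forall e : K, 0 < e -> exists n : nat, n.+1%:R^-1 < e.
Local Notation P := (projective_space K m).

Lemma point_eqP (u v : nonzero_vector K m) :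
  proj_of u = proj_of v <-> exists2 c : K, c != 0 & (u : 'cV[K]_m) = c *: (v : 'cV_m).
Proof.
split=> [/(congr1 (@line_of K m)) /= uv|[c c0 uv]].
  have : (u : 'cV[K]_m) \in <[v : 'cV_m]>%VS by rewrite -uv memv_line.
  move=> /vlineP[c uE]; exists c => //; apply: contraTneq (valP u) => c0.
  by rewrite /= uE c0 scale0r eqxx.
apply/val_inj; rewrite /= uv; apply/eqP; rewrite eqEdim.
have cv : c *: (v : 'cV[K]_m) != 0 by rewrite -uv; exact: (valP u).
rewrite -memvE memvZ ?memv_line//= !dim_vline cv.
by rewrite (_ : vector_of v != 0)//; exact: (valP v).
Qed.

Lemma point_surj (x : P) : exists v : nonzero_vector K m, proj_of v = x.
Proof.
case: x => x x1; have x1' : \dim x = 1%N by apply/eqP.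
have v0 : vpick x != 0 by rewrite vpick0 -dimv_eq0 x1'.
exists (NonzeroVector v0); apply/val_inj => /=; apply/eqP.
by rewrite eqEdim -memvE memv_pick dim_vline v0 x1'.
Qed.

Lemma proj_of_open (u v : nonzero_vector K m) : proj_of u = proj_of v -> forall p,
  exists q, forall u1 : nonzero_vector K m, mx_near (u : 'cV[K]_m) q u1 ->
  exists2 v1 : nonzero_vector K m, proj_of v1 = proj_of u1 & mx_near (v : 'cV[K]_m) p v1.
Proof.
move=> /esym/point_eqP[c c0 vE] p.
have cp : 0 < p.+1%:R^-1 / `|c| by rewrite divr_gt0 ?invr_gt0 ?ltr0n ?normr_gt0.
have [q qP] := archK cp; exists q => u1 u1q.
have cu0 : c *: (u1 : 'cV[K]_m) != 0.
  by rewrite scaler_eq0 (negbTE c0); exact: (valP u1).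
exists (NonzeroVector cu0); first by apply/point_eqP; exists c.
move=> i j /=; rewrite vE !mxE -mulrBr normrM mulrC -ltr_pdivlMr ?normr_gt0//.
exact: lt_trans (u1q i j) qP.
Qed.

Lemma point_cvg (u : nat -> nonzero_vector K m) (v : nonzero_vector K m) :
  mx_cvg (fun n => u n : 'cV[K]_m) v -> (fun n => proj_of (u n)) @ \oo --> proj_of v.
Proof. by move=> uv; apply: (quotient_cvg archK (f := @proj_of K m)). Qed.

Lemma point_lift (t : nat -> P) (v : nonzero_vector K m) : t @ \oo --> proj_of v ->
  exists u : nat -> nonzero_vector K m, (forall n, proj_of (u n) = t n) /\
    mx_cvg (fun n => u n : 'cV[K]_m) v.
Proof. by move=> tv; apply: (quotient_lift archK proj_of_open) tv; exact: point_surj. Qed.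

Lemma proj_openP (U : set P) :
  open U <-> forall v : nonzero_vector K m, U (proj_of v) ->
    exists p, forall u : nonzero_vector K m, mx_near (v : 'cV[K]_m) p u -> U (proj_of u).
Proof. exact: (quotient_openP archK (f := @proj_of K m)). Qed.

End ProjectiveTopology.

(** * Convex domains and shadows *)

Section Cone.
Context (R : realType) (m : nat) (Omega : set (projective_space R m)).
Local Notation vec := 'cV[R]_m.
Implicit Types (f : 'rV[R]_m) (u v w : vec).

Definition form f v : R := (f *m v) 0 0.

Lemma formD f u v : form f (u + v) = form f u + form f v.
Proof. by rewrite /form mulmxDr mxE. Qed.

Lemma formZ f (c : R) v : form f (c *: v) = c * form f v.
Proof. by rewrite /form -scalemxAr mxE. Qed.

Lemma formN f v : form f (- v) = - form f v.
Proof. by rewrite -scaleN1r formZ mulN1r. Qed.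

Lemma formB f u v : form f (u - v) = form f u - form f v.
Proof. by rewrite formD formN. Qed.

Lemma form0 f : form f 0 = 0.
Proof. by rewrite /form mulmx0 mxE. Qed.

Definition represents (x : projective_space R m) v := line_of x = <[v]>%VS.

Lemma represents_neq0 x v : represents x v -> v != 0.
Proof.
move=> xv; have := valP x; rewrite /= xv dim_vline.
by case: (v != 0).
Qed.

Lemma represents_inj x y v : represents x v -> represents y v -> x = y.
Proof. by move=> xv yv; apply/val_inj; rewrite /= xv yv. Qed.

Lemma representsZ x v (c : R) : c != 0 -> represents x v -> represents x (c *: v).
Proof.
move=> c0 xv; rewrite /represents xv; apply/eqP; rewrite eq_sym eqEdim.
rewrite -memvE memvZ ?memv_line//= !dim_vline scaler_eq0 (negbTE c0) /=.
by rewrite (represents_neq0 xv).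
Qed.

Lemma represents_prop x v w : represents x v -> represents x w ->
  exists2 c : R, c != 0 & w = c *: v.
Proof.
move=> xv xw; have : w \in <[v]>%VS by rewrite -xv xw memv_line.
move=> /vlineP[c wE]; exists c => //.
by have := represents_neq0 xw; rewrite wE scaler_eq0 negb_or => /andP[].
Qed.

Lemma represents_mem x v : v \in line_of x -> v != 0 -> represents x v.
Proof.
move=> vx v0; apply/eqP; rewrite eq_sym eqEdim -memvE vx dim_vline v0.
by rewrite (eqP (valP x)).
Qed.

(** One half of the double cone over [Omega], the form [f] of the chart selecting the sign. Points
    become rays, so that convex combinations and limits can be taken on vectors. *)
Definition cone f v : Prop := 0 < form f v /\ exists2 x, Omega x & represents x v.

Context (f : 'rV[R]_m).
Hypothesis Omega_open : open Omega.
Hypothesis chart : convex_bounded_chart Omega f.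
Local Notation C := (cone f).

Lemma coneZ v (c : R) : 0 < c -> C v -> C (c *: v).
Proof.
move=> c0 [fv [x Ox xv]]; split; first by rewrite formZ mulr_gt0.
by exists x => //; apply: representsZ => //; rewrite gt_eqF.
Qed.

Lemma chart_form_neq0 x v : Omega x -> represents x v -> form f v != 0.
Proof.
move=> Ox xv; have [_ /(_ x Ox)[w [wx fw]] _ _] := chart.
have w0 : w != 0.
  by apply: contra_eq_neq fw => ->; rewrite mulmx0 mxE eq_sym oner_eq0.
have [c c0 wE] := represents_prop xv (represents_mem wx w0).
by apply: contra_eq_neq fw => fv0; rewrite -/(form f w) wE formZ fv0 mulr0 eq_sym oner_eq0.
Qed.

Lemma cone_of_point x v : Omega x -> represents x v -> C v \/ C (- v).
Proof.
move=> Ox xv; have fv := chart_form_neq0 Ox xv.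
have [fv0|fv0|/eqP] := ltgtP (form f v) 0; last by rewrite (negbTE fv).
  right; split; first by rewrite formN oppr_gt0.
  by exists x => //; rewrite -scaleN1r; apply: representsZ.
by left; split=> //; exists x.
Qed.

Lemma point_of_cone x v : C v -> represents x v -> Omega x.
Proof. by move=> [_ [y Oy yv]] xv; rewrite (represents_inj xv yv). Qed.

Lemma exists_cone x : Omega x -> exists2 v, C v & represents x v.
Proof.
move=> Ox; have [v vE] := point_surj x.
have xv : represents x v by rewrite -vE.
have [Cv|Cv] := cone_of_point Ox xv; first by exists v.
exists (- (v : vec)) => //; by rewrite -scaleN1r; apply: representsZ.
Qed.

Lemma cone_chart_image v : C v -> chart_image f Omega ((form f v)^-1 *: v).
Proof.
move=> [fv [x Ox xv]]; exists x => //; split; last first.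
  by rewrite -/(form f _) formZ mulVf// gt_eqF.
by rewrite xv memvZ// memv_line.
Qed.

Lemma chart_image_cone v : chart_image f Omega v -> C v.
Proof.
move=> [x Ox [vx fv]]; split; first by rewrite /form fv ltr01.
exists x => //; apply: represents_mem => //.
by apply: contra_eq_neq fv => ->; rewrite mulmx0 mxE eq_sym oner_eq0.
Qed.

(** After normalisation by [f] the sum is a positive multiple of a convex combination in the
    chart. *)
Lemma coneD u v : C u -> C v -> C (u + v).
Proof.
move=> Cu Cv; have [fu _] := Cu; have [fv _] := Cv.
have s0 : 0 < form f u + form f v by exact: addr_gt0.
have t0 : 0 <= form f u / (form f u + form f v) by rewrite divr_ge0// ltW.
have t1 : form f u / (form f u + form f v) <= 1.
  by rewrite ler_pdivrMr// mul1r lerDl ltW.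
have [_ _ cvx _] := chart.
have /(_ (Itv01 t0 t1)) := cvx ((form f u)^-1 *: u) ((form f v)^-1 *: v).
have mu := cone_chart_image Cu; have mv := cone_chart_image Cv.
rewrite !inE => /(_ mu mv)/chart_image_cone/(coneZ s0).
congr (C _).
rewrite -[conv _ _ _]/((form f u / (form f u + form f v)) *: ((form f u)^-1 *: u) +
  (1 - form f u / (form f u + form f v)) *: ((form f v)^-1 *: v)).
rewrite scalerDr !scalerA; congr (_ + _).
  rewrite (_ : _ / form f u = 1) ?scale1r//; field.
  by rewrite (gt_eqF s0) (gt_eqF fu).
rewrite (_ : _ / form f v = 1) ?scale1r//; field.
by rewrite (gt_eqF s0) (gt_eqF fv).
Qed.

Lemma form_cvg (u : nat -> vec) v : mx_cvg u v ->
  (fun n => form f (u n)) @ \oo --> form f v.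
Proof.
move=> uv; have h := mx_cvg_mul (@mx_cvg_cst R _ _ f) uv.
have := h 0 0; rewrite /form.
by [].
Qed.

Lemma cone_open v : C v -> exists p, mx_near v p `<=` C.
Proof.
move=> Cv; have [fv [x Ox xv]] := Cv; have v0 := represents_neq0 xv.
have xE : x = proj_of (NonzeroVector v0) by apply: (represents_inj xv).
have [p pO] : exists p, forall u : nonzero_vector R m,
    mx_near v p u -> Omega (proj_of u).
  by have /(proj_openP (@real_small R))/(_ (NonzeroVector v0)) := Omega_open; rewrite -xE; apply.
apply: contrapT => /forallNP no.
have {}no q : exists u, mx_near v q u /\ ~ C u.
  by have /existsNP[u] := no q; rewrite not_implyE; exists u.
have [u uP] := choice no.
have uv : mx_cvg u v.
  apply/(mx_cvg_near (@real_small R)) => q; exists q => q' qq'.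
  by apply: (mx_near_decreasing qq'); exact: (uP q').1.
have fuv : (fun n => form f (u n)) @ \oo --> form f v.
  exact: form_cvg.
have /cvgrPdist_lt/(_ _ fv)[N _ NP] := fuv.
pose q := maxn N p; have [_] := uP q; apply.
have fuq : 0 < form f (u q).
  have := NP q (leq_maxl _ _); rewrite /= => /ltr_normlP[_]; lra.
split=> //; have uq0 : u q != 0.
  by apply: contraTneq fuq => ->; rewrite form0 ltxx.
exists (proj_of (NonzeroVector uq0)) => //; apply: pO.
by apply: (mx_near_decreasing (leq_maxr N p)); exact: (uP q).1.
Qed.

Lemma cone_mx_cvg (u : nat -> vec) v : C v -> mx_cvg u v ->
  exists N, forall n, (N <= n)%N -> C (u n).
Proof.
move=> /cone_open[p pC] /(mx_cvg_near (@real_small R))/(_ p)[N NP].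
by exists N => n Nn; exact/pC/NP.
Qed.

Lemma mx_cvg_line (v w : vec) (t : nat -> R) (l : R) : t @ \oo --> l ->
  mx_cvg (fun n => v + t n *: w) (v + l *: w).
Proof.
move=> tl i j; rewrite !mxE (_ : (fun p => _) = fun p => v i j + t p * w i j).
  by apply: cvgD; [exact: cvg_cst|apply: cvgM => //; exact: cvg_cst].
by apply/funext => p; rewrite !mxE.
Qed.

Lemma harmonic_cvg : (fun n : nat => n.+1%:R^-1 : R) @ \oo --> (0 : R).
Proof. exact: cvg_harmonic. Qed.

Lemma cone_segment v w : C v -> exists2 e : R, 0 < e & C (v + e *: w).
Proof.
move=> Cv; have h := @mx_cvg_line v w _ _ harmonic_cvg.
rewrite scale0r addr0 in h; have [N NP] := cone_mx_cvg Cv h.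
by exists N.+1%:R^-1; [rewrite invr_gt0 ltr0n|exact: NP].
Qed.

Context (v0 : vec).
Hypothesis Cv0 : C v0.

(** The closure of the open cone, described algebraically by pushing along the interior direction
    [v0]. *)
Definition ccone v : Prop := forall e : R, 0 < e -> C (v + e *: v0).

Lemma cone_ccone v : C v -> ccone v.
Proof. by move=> Cv e e0; apply: coneD => //; exact: coneZ. Qed.

(** A small multiple of [v0] can be taken from [u], which is interior, and given to [v]. *)
Lemma ccone_addl v u : ccone v -> C u -> C (v + u).
Proof.
move=> Cv Cu; have [e e0 Ce] := cone_segment (- v0) Cu.
rewrite (_ : v + u = (v + e *: v0) + (u + e *: - v0)); first exact/coneD/Ce/Cv.
by rewrite scalerN addrACA subrr addr0.
Qed.

Lemma ccone_limit (u : nat -> vec) v : mx_cvg u v -> (forall n, ccone (u n)) -> ccone v.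
Proof.
move=> uv Cu e e0.
have h : mx_cvg (fun n => (v + e *: v0) - u n) (e *: v0).
  rewrite -[X in mx_cvg _ X](addrK v) [_ + v]addrC => i j; rewrite !mxE (_ : (fun p => _) = fun p => (v i j + e * v0 i j) - u p i j).
    by apply: cvgB; [exact: cvg_cst|exact: uv].
  by apply/funext => p; rewrite !mxE.
have [N NP] := cone_mx_cvg (coneZ e0 Cv0) h.
by have := ccone_addl (Cu N) (NP N (leqnn N)); rewrite addrC subrK.
Qed.

Lemma cconeD u v : ccone u -> ccone v -> ccone (u + v).
Proof.
move=> Cu Cv e e0; have e2 : 0 < e / 2 by rewrite divr_gt0.
rewrite (_ : u + v + _ = (u + (e / 2) *: v0) + (v + (e / 2) *: v0)).
  by apply: coneD; [exact: Cu|exact: Cv].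
by rewrite addrACA -scalerDl -splitr.
Qed.

Lemma ccone0 : ccone 0.
Proof. by move=> e e0; rewrite add0r; exact: coneZ. Qed.

Lemma cconeZ v (c : R) : 0 <= c -> ccone v -> ccone (c *: v).
Proof.
rewrite le_eqVlt => /orP[/eqP <- _|c0 Cv e e0]; first by rewrite scale0r; exact: ccone0.
rewrite (_ : _ + _ = c *: (v + (e / c) *: v0)).
  by apply: coneZ => //; apply: Cv; rewrite divr_gt0.
by rewrite scalerDr scalerA mulrC divfK// gt_eqF.
Qed.

(** Boundedness of the chart image gives the inequality on the open cone after rescaling, and it
    passes to the closed cone along multiples of [v0] tending to zero. Properness and compactness
    below come from here. *)
Lemma cone_bounded : exists2 B : R, 0 <= B &
  forall v, ccone v -> forall i, `|v i 0| <= B * form f v.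
Proof.
have [_ _ _ [M [Mreal MP]]] := chart.
have B0 : 0 <= `|M| + 1 by rewrite addr_ge0.
exists (`|M| + 1) => // v Cv i.
have coneB u : C u -> `|u i 0| <= (`|M| + 1) * form f u.
  move=> Cu; have [fu _] := Cu.
  have /MP /(_ _ (cone_chart_image Cu)) : M < `|M| + 1.
    by rewrite (le_lt_trans (ler_norm M))// ltrDl.
  move=> /= h; have : `|((form f u)^-1 *: u) i 0| <= `|M| + 1.
    apply/ler_addgt0Pr => e e0.
    have : ball (0 : vec) (`|M| + 1 + e) ((form f u)^-1 *: u).
      rewrite mx_norm_ball /ball_ /= sub0r normrN; apply: le_lt_trans h _.
      by rewrite ltrDl.
    by move=> [_ /(_ i 0)]; rewrite -ball_normE /= mxE sub0r normrN => /ltW.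
  by rewrite mxE normrM gtr0_norm ?invr_gt0// [_^-1 * _]mulrC ler_pdivrMr.
have h := @mx_cvg_line v v0 _ _ harmonic_cvg; rewrite scale0r addr0 in h.
have hl : (fun n => `|(v + n.+1%:R^-1 *: v0) i 0|) @ \oo --> `|v i 0|.
  by apply: cvg_norm; exact: h.
have hr : (fun n => (`|M| + 1) * form f (v + n.+1%:R^-1 *: v0)) @ \oo -->
    (`|M| + 1) * form f v.
  apply: cvgM; first exact: cvg_cst.
  exact: form_cvg.
apply: (ler_cvg_to hl hr); apply: nearW => n; apply: coneB; apply: Cv.
by rewrite invr_gt0 ltr0n.
Qed.

Lemma ccone_form_ge0 v : ccone v -> 0 <= form f v.
Proof.
move=> Cv; have h := @mx_cvg_line v v0 _ _ harmonic_cvg; rewrite scale0r addr0 in h.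
have hr : (fun n => form f (v + n.+1%:R^-1 *: v0)) @ \oo --> form f v.
  exact: form_cvg.
apply: (ler_cvg_to (@cvg_cst R 0 _ \oo _) hr); apply: nearW => n.
by have [|/ltW] := Cv n.+1%:R^-1; first by rewrite invr_gt0 ltr0n.
Qed.

Lemma ccone_form_gt0 v : ccone v -> v != 0 -> 0 < form f v.
Proof.
move=> Cv vn0; rewrite lt_def ccone_form_ge0// andbT.
apply: contra vn0 => /eqP fv; have [B _ BP] := cone_bounded.
apply/eqP/matrixP => i j; rewrite ord1 mxE; apply/eqP; rewrite -normr_le0.
by have := BP v Cv i; rewrite fv mulr0.
Qed.

Lemma ccone_proper v : ccone v -> ccone (- v) -> v = 0.
Proof.
move=> Cv CNv; apply: contrapT => /eqP vn0.
have := ccone_form_gt0 Cv vn0; have := ccone_form_ge0 CNv.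
by rewrite formN => h1 h2; lra.
Qed.

Lemma ccone_cone x v : ccone v -> represents x v -> Omega x -> C v.
Proof.
by move=> Cv xv Ox; split; [exact: ccone_form_gt0 Cv (represents_neq0 xv)|exists x].
Qed.

(** If neither [v] nor its opposite is in the closed cone, both have neighbourhoods free of the open
    cone, and these give a neighbourhood of [x] disjoint from [Omega]. Conversely [x] is a limit of
    the points obtained by pushing [v] along [v0]. *)
Lemma closureP x : closure Omega x <-> exists2 v, ccone v & represents x v.
Proof.
split=> [clx|[v Cv xv]].
  have [v vE] := point_surj x.
  have xv : represents x v by rewrite -vE.
  have [Cv|nCv] := pselect (ccone v); first by exists v.
  have [Cv|nCNv] := pselect (ccone (- (v : vec))).
    exists (- (v : vec)) => //; by rewrite -scaleN1r; apply: representsZ.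
  have away (w : vec) : ~ ccone w -> exists p, forall u, mx_near w p u -> ~ C u.
    move=> /existsNP[e]; rewrite not_implyE => -[e0 nC].
    apply: contrapT => /forallNP no.
    have {}no q : exists u, mx_near w q u /\ C u.
      have /existsNP[u] := no q; rewrite not_implyE => -[wu /contrapT Cu].
      by exists u.
    have [u uP] := choice no; apply: nC.
    have uw : mx_cvg u w.
      apply/(mx_cvg_near (@real_small R)) => q; exists q => q' qq'.
      by apply: (mx_near_decreasing qq'); exact: (uP q').1.
    by apply: (ccone_limit uw) => // n; apply: cone_ccone; exact: (uP n).2.
  have [p pP] := away _ nCv; have [q qP] := away _ nCNv.
  pose V : set (projective_space R m) := [set y | exists2 u : nonzero_vector R m,
    proj_of u = y & mx_near (v : vec) (maxn p q) u].
  have /clx[y [Oy [u uy vu]]] : nbhs x V.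
    have Vopen : open [set y | exists2 u : nonzero_vector R m,
        proj_of u = y & (mx_near (v : vec) (maxn p q))° u].
      apply/(proj_openP (@real_small R)) => u1 [u2 u12 u2V].
      have : nbhs (u2 : vec) (mx_near (v : vec) (maxn p q))°.
        by apply: open_nbhs_nbhs; split=> //; exact: open_interior.
      move=> /(nbhs_mx_near (@real_small R))[r rV].
      have [r' r'P] := proj_of_open (@real_small R) (esym u12) r.
      by exists r' => s /r'P[s3 s3E /rV]; exists s3.
    rewrite nbhsE; eexists; [split; first exact: Vopen|].
      exists v => //; apply/(nbhs_mx_near (@real_small R)); by exists (maxn p q).
    by move=> y [u uy /interior_subset]; exists u.
  have yu : represents y u by rewrite -uy.
  exfalso; have [Cu|Cu] := cone_of_point Oy yu.
    by apply: (pP _ _ Cu); apply: (mx_near_decreasing (leq_maxl p q)).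
  apply: (qP _ _ Cu) => i j; rewrite !mxE opprK addrC distrC.
  by have := mx_near_decreasing (leq_maxr p q) vu i j.
have vn0 := represents_neq0 xv.
have xE : x = proj_of (NonzeroVector vn0) by apply: (represents_inj xv).
have h := @mx_cvg_line v v0 _ _ harmonic_cvg; rewrite scale0r addr0 in h.
have Cn n : C (v + n.+1%:R^-1 *: v0) by apply: Cv; rewrite invr_gt0 ltr0n.
have nz n : v + n.+1%:R^-1 *: v0 != 0.
  by apply: contraTneq (Cn n).1 => ->; rewrite form0 ltxx.
move=> V; rewrite xE => /(@point_cvg _ _ (@real_small R) (fun n => NonzeroVector (nz n)) (NonzeroVector vn0) h).
move=> [N _ NP]; exists (proj_of (NonzeroVector (nz N))); split; last by apply: NP => /=.
exact: (point_of_cone (Cn N)).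
Qed.

Lemma boundaryP x : boundary Omega x <-> exists v, [/\ ccone v, ~ C v & represents x v].
Proof.
have Oi : interior Omega = Omega by apply/interior_id.
rewrite /boundary Oi; split=> [[/closureP[v Cv xv] nOx]|[v [Cv nCv xv]]].
  by exists v; split=> // /point_of_cone/(_ xv).
split; first by apply/closureP; exists v.
by move=> Ox; apply: nCv; exact: ccone_cone xv Ox.
Qed.

End Cone.

(** * The Hilbert metric as an order relation *)

Section HilbertMetric.
Context (R : realType) (m : nat) (Omega : set (projective_space R m)).
Local Notation vec := 'cV[R]_m.
Context (f : 'rV[R]_m).
Hypothesis Omega_open : open Omega.
Hypothesis chart : convex_bounded_chart Omega f.
Context (v0 : vec).
Local Notation C := (cone Omega f).
Local Notation CC := (ccone Omega f v0).
Hypothesis Cv0 : C v0.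

(** If the form took both signs on the convex cone, a positive combination of two vectors would kill
    it. *)
Lemma form_sign (g : 'rV[R]_m) : (forall v, C v -> form g v != 0) ->
  exists2 s : R, s * s = 1 & forall v, C v -> 0 < s * form g v.
Proof.
move=> gn0; have [gp|gp] := ltP 0 (form g v0).
  exists 1; rewrite ?mulr1// => v Cv; rewrite mul1r ltNge; apply/negP => gv.
  have gv' : form g v < 0 by rewrite lt_neqAle gn0.
  have Cw : C ((- form g v) *: v0 + form g v0 *: v).
    by apply: (coneD chart); apply: coneZ => //; rewrite oppr_gt0.
  by have := gn0 _ Cw; rewrite formD !formZ mulNr mulrC addNr eqxx.
have gp' : form g v0 < 0 by rewrite lt_neqAle gn0.
exists (-1); rewrite ?mulrNN ?mulr1// => v Cv; rewrite mulN1r oppr_gt0 ltNge.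
apply/negP => gv; have gv' : 0 < form g v by rewrite lt_def gn0.
have Cw : C (form g v *: v0 + (- form g v0) *: v).
  by apply: (coneD chart); apply: coneZ => //; rewrite oppr_gt0.
by have := gn0 _ Cw; rewrite formD !formZ mulNr mulrC subrr eqxx.
Qed.

(** [hilbert_dist] chooses its own chart. Two charts define the same cone up to sign, which lets the
    chosen one be replaced by [f]. *)
Lemma cone_sign (f' : 'rV[R]_m) (s : R) : convex_bounded_chart Omega f' ->
  s * s = 1 -> (forall v, C v -> 0 < s * form f' v) ->
  forall v, cone Omega f' v <-> C (s *: v).
Proof.
move=> chart' ss sf' v; have s0 : s != 0.
  by apply: contra_eq_neq ss => ->; rewrite mulr0 eq_sym oner_eq0.
split=> [[f'v [x Ox xv]]|Csv].
  have [] := cone_of_point chart Ox (representsZ s0 xv) => // CN.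
  have := sf' _ CN; rewrite formN formZ mulrN mulrA ss mul1r => h; lra.
have [_ [x Ox xsv]] := Csv; have h := sf' _ Csv.
rewrite formZ mulrA ss mul1r in h; split=> //; exists x => //.
by have := representsZ s0 xsv; rewrite scalerA ss scale1r.
Qed.

Lemma boundary_chart_sign (f' : 'rV[R]_m) (s : R) x v :
  convex_bounded_chart Omega f' ->
  s * s = 1 -> (forall v, C v -> 0 < s * form f' v) ->
  boundary Omega x -> in_chart f' x v ->
  [/\ CC (s *: v), ~ C (s *: v) & represents x v].
Proof.
move=> chart' ss sf' bx [vx fv].
have [w [Cw nCw xw]] := (boundaryP Omega_open chart Cv0 x).1 bx.
have v_n0 : v != 0 by apply: contra_eq_neq fv => ->; rewrite mulmx0 mxE eq_sym oner_eq0.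
have xv := represents_mem vx v_n0.
have [c c0 vE] := represents_prop xw xv.
have Cs := cone_sign chart' ss sf'.
have fw : 0 < s * form f' w.
  have Csv0 : cone Omega f' (s *: v0) by apply/Cs; rewrite scalerA ss scale1r.
  have CC' : ccone Omega f' (s *: v0) (s *: w).
    move=> e e0; apply/Cs; rewrite scalerA mulrC -scalerA -scalerDr scalerA ss scale1r.
    exact: Cw.
  have s0 : s != 0.
    by apply: contra_eq_neq ss => ->; rewrite mulr0 eq_sym oner_eq0.
  have := ccone_form_gt0 chart' CC'; rewrite formZ; apply.
  by rewrite scaler_eq0 negb_or s0 (represents_neq0 xw).
have sc : 0 < s * c.
  have fv' : form f' v = 1 := fv.
  rewrite vE formZ in fv'.
  by rewrite -(pmulr_lgt0 _ fw) mulrACA ss mul1r fv' ltr01.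
have svE : s *: v = (s * c) *: w by rewrite vE scalerA.
split=> //; first by rewrite svE; apply: (cconeZ Cv0) => //; exact: ltW.
rewrite svE => /(coneZ (c := (s * c)^-1)); rewrite invr_gt0 => /(_ sc).
by rewrite scalerA mulVf ?scale1r// gt_eqF.
Qed.

Definition hilbert_set (p q : projective_space R m) : set R :=
  [set r | exists f x y (vx vp vq vy : 'cV[R]_m) (s t : R),
    [/\ convex_bounded_chart Omega f,
        boundary Omega x /\ boundary Omega y,
        [/\ in_chart f x vx, in_chart f p vp, in_chart f q vq &
            in_chart f y vy],
        [/\ vx != vy, 0 <= s <= t, t <= 1,
            vp = (1 - s) *: vx + s *: vy & vq = (1 - t) *: vx + t *: vy] &
        r = ln ((`|vx - vq| * `|vy - vp|) / (`|vx - vp| * `|vy - vq|))]].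

(** The data of [hilbert_set] moved to the fixed cone: [X] and [Y] are the ends of the chord through
    [U] and [W], and the cross ratio is written in the parameters [a] and [b]. *)
Definition chord (p q : projective_space R m) (r : R) : Prop :=
  exists (U W X Y : vec) (a b : R),
  [/\ [/\ represents p U, represents q W, C U & C W],
      [/\ CC X, ~ C X, CC Y & ~ C Y],
      [/\ 0 < a, a <= b & b < 1],
      U = (1 - a) *: X + a *: Y /\ W = (1 - b) *: X + b *: Y &
      r = ln ((b * (1 - a)) / (a * (1 - b)))].

Lemma chord_of_hilbert_set p q r : Omega p -> Omega q -> hilbert_set p q r ->
  chord p q r.
Proof.
move=> Op Oq [f' [x [y [vx [vp [vq [vy [a [b]]]]]]]]].
move=> [chart' [bx by_] [cx cp cq cy] [xy /andP[a0 ab] b1 vpE vqE] ->].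
have [s ss sf'] : exists2 s : R, s * s = 1 & forall v, C v -> 0 < s * form f' v.
  by apply: form_sign => v [_ [z Oz zv]]; apply: (chart_form_neq0 chart' Oz zv).
have [Cx nCx _] := boundary_chart_sign chart' ss sf' bx cx.
have [Cy nCy _] := boundary_chart_sign chart' ss sf' by_ cy.
have s0 : s != 0.
  by apply: contra_eq_neq ss => ->; rewrite mulr0 eq_sym oner_eq0.
have rep z v : in_chart f' z v -> represents z (s *: v).
  move=> [vz fv]; apply: representsZ => //; apply: represents_mem => //.
  by apply: contra_eq_neq fv => ->; rewrite mulmx0 mxE eq_sym oner_eq0.
have cC z v : Omega z -> in_chart f' z v -> C (s *: v).
  move=> Oz cz; have [vz fv] := cz; apply/(cone_sign chart' ss sf').
  have fv' : form f' v = 1 := fv.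
  split; first by rewrite fv' ltr01.
  exists z => //; have := representsZ s0 (rep z v cz); by rewrite scalerA ss scale1r.
have CU := cC _ _ Op cp; have CW := cC _ _ Oq cq.
have sE (t : R) : s *: ((1 - t) *: vx + t *: vy) = (1 - t) *: (s *: vx) + t *: (s *: vy).
  by rewrite scalerDr !scalerA ![s * _]mulrC.
have a_gt0 : 0 < a.
  rewrite lt_def a0 andbT; apply/negP => /eqP aE; apply: nCx.
  by move: CU; rewrite vpE aE subr0 scale1r scale0r addr0.
have b_lt1 : b < 1.
  rewrite lt_neqAle b1 andbT; apply/negP => /eqP bE; apply: nCy.
  by move: CW; rewrite vqE bE subrr scale1r scale0r add0r.
exists (s *: vp), (s *: vq), (s *: vx), (s *: vy), a, b; split=> //.
- by split=> //; exact: rep.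
- by rewrite -!sE vpE vqE.
have n0 : `|vx - vy| != 0 by rewrite normr_eq0 subr_eq0.
have xE (t : R) : 0 <= t -> `|vx - ((1 - t) *: vx + t *: vy)| = t * `|vx - vy|.
  move=> t0; rewrite (_ : _ - _ = t *: (vx - vy)) ?normrZ ?ger0_norm//.
  by apply/matrixP => i j; rewrite !mxE; ring.
have yE (t : R) : t <= 1 -> `|vy - ((1 - t) *: vx + t *: vy)| = (1 - t) * `|vx - vy|.
  move=> t1; rewrite (_ : _ - _ = (1 - t) *: (vy - vx)).
    by rewrite normrZ ger0_norm ?subr_ge0// distrC.
  by apply/matrixP => i j; rewrite !mxE; ring.
have b_gt0 : 0 < b by exact: lt_le_trans ab.
have a_lt1 : a < 1 by exact: le_lt_trans b_lt1.
rewrite vpE vqE !xE ?yE ?ltW//; congr ln; field.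
by rewrite n0 subr_eq0 (gt_eqF b_lt1) (gt_eqF a_gt0).
Qed.

(** Birkhoff's description of the Hilbert metric: in the order of the closed cone, suitable
    representatives satisfy [u <= w <= e^l u]. *)
Definition comparable (p q : projective_space R m) (l : R) : Prop :=
  exists u w : vec, [/\ represents p u, represents q w, C u /\ C w,
    CC (w - u) & CC (expR l *: u - w)].

Lemma chord_comparable p q r : chord p q r -> comparable p q r.
Proof.
move=> [U [W [X [Y [a [b [[pU qW CU CW] [CX _ CY _] [a0 ab b1] [UE WE] ->]]]]]]].
have b0 : 0 < b by exact: lt_le_trans ab.
have a1 : a < 1 by exact: le_lt_trans b1.
have c0 : 0 < (1 - a) / (1 - b) by rewrite divr_gt0 ?subr_gt0.
have nb : 1 - b != 0 by rewrite subr_eq0 gt_eqF.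
have na : a != 0 by rewrite gt_eqF.
(* This multiple of [W] has the same [X]-coefficient as [U], so [w - u] is a multiple of [Y]; the
   factor [expR l] then equalises the [Y]-coefficients. *)
exists U, (((1 - a) / (1 - b)) *: W); split=> //.
- by apply: representsZ => //; rewrite gt_eqF.
- by split=> //; exact: coneZ.
- rewrite (_ : _ - _ = ((b - a) / (1 - b)) *: Y).
    by apply: (cconeZ Cv0) => //; rewrite divr_ge0 ?subr_ge0// ltW.
  rewrite UE WE; apply/matrixP => i j; rewrite !mxE; field; exact: nb.
rewrite lnK ?posrE ?divr_gt0 ?mulr_gt0 ?subr_gt0//.
rewrite (_ : _ - _ = (((1 - a) / (1 - b)) * ((b - a) / a)) *: X).
  by apply: (cconeZ Cv0) => //; rewrite mulr_ge0 ?divr_ge0 ?subr_ge0// ltW.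
rewrite UE WE; apply/matrixP => i j; rewrite !mxE; field; by rewrite nb na.
Qed.

(** With [al] positive, adding enough of the interior combination of [X] and [Y] would cancel [X]
    and place a multiple of [Y] in the open cone, although [Y] is not in it. *)
Lemma extremal_coefficient (X Y : vec) (a al be : R) : 0 < a -> a < 1 ->
  C ((1 - a) *: X + a *: Y) -> CC Y -> ~ C Y -> CC (- al *: X + be *: Y) -> al <= 0.
Proof.
move=> a0 a1 CU CY nCY CXY; rewrite leNgt; apply/negP => al0; apply: nCY.
have a1' : 0 < 1 - a by rewrite subr_gt0.
have := ccone_addl Omega_open chart (cconeZ Cv0 (ltW a1') CXY) (coneZ al0 CU).
rewrite [Z in C Z](_ : _ = ((1 - a) * be + al * a) *: Y); last first.
  by apply/matrixP => i j; rewrite !mxE; ring.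
move=> CkY; have [] := CkY; rewrite formZ => kf _.
have fY := ccone_form_ge0 CY.
have k0 : 0 < (1 - a) * be + al * a.
  rewrite ltNge; apply/negP => k0; have := mulr_le0_ge0 k0 fY; lra.
have := coneZ (c := ((1 - a) * be + al * a)^-1) _ CkY.
by rewrite invr_gt0 scalerA mulVf ?gt_eqF// scale1r; apply.
Qed.

(** Each of the two inequalities, written in [X] and [Y], bounds a coefficient by
    [extremal_coefficient]; together they bound the cross ratio by [expR l]. *)
Lemma chord_minimal p q r l : chord p q r -> comparable p q l -> r <= l.
Proof.
move=> [U [W [X [Y [a [b [[pU qW CU CW] [CX nCX CY nCY] [a0 ab b1] [UE WE] ->]]]]]]].
move=> [u [w [pu qw [Cu Cw] C1 C2]]].
have b0 : 0 < b by exact: lt_le_trans ab.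
have a1 : a < 1 by exact: le_lt_trans b1.
have [c c_n0 uE] := represents_prop pU pu.
have [e e_n0 wE] := represents_prop qW qw.
have pos (z : R) (v : vec) : C v -> C (z *: v) -> 0 < z.
  move=> [fv _] []; rewrite formZ => h _; by rewrite -(pmulr_lgt0 _ fv).
have c0 : 0 < c by apply: (pos c U); rewrite -?uE.
have e0 : 0 < e by apply: (pos e W); rewrite -?wE.
have h1 : c * (1 - a) - e * (1 - b) <= 0.
  apply: (@extremal_coefficient X Y a _ (e * b - c * a)) => //; first by rewrite -UE.
  rewrite [Z in CC Z](_ : _ = w - u) // uE wE UE WE.
  by apply/matrixP => i j; rewrite !mxE; ring.
have h2 : e * b - expR l * c * a <= 0.
  have a' : 0 < 1 - b by rewrite subr_gt0.
  apply: (@extremal_coefficient Y X (1 - b) _ (expR l * c * (1 - a) - e * (1 - b))) => //.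
  - by rewrite ltrBlDr ltrDl.
  - by rewrite opprB addrCA subrr addr0 addrC -WE.
  rewrite [Z in CC Z](_ : _ = expR l *: u - w) // uE wE UE WE.
  by apply/matrixP => i j; rewrite !mxE; ring.
rewrite -ler_expR lnK ?posrE ?divr_gt0 ?mulr_gt0 ?subr_gt0//.
rewrite ler_pdivrMr ?mulr_gt0 ?subr_gt0//.
have E0 := expR_gt0 l.
have h3 : (e * b) * (1 - a) <= (expR l * c * a) * (1 - a).
  by apply: ler_wpM2r; [lra|lra].
have h4 : (c * (1 - a)) * (expR l * a) <= (e * (1 - b)) * (expR l * a).
  by apply: ler_wpM2r; [rewrite mulr_ge0// ltW|lra].
by rewrite -(ler_pM2l e0); lra.
Qed.

(** The exit time is the supremum of the times spent in the closed cone, finite because [f] is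
    constant along the ray and the chart is bounded. *)
Lemma ray_exit (U D : vec) : C U -> D != 0 -> form f D = 0 ->
  exists2 t : R, 0 < t & CC (U + t *: D) /\ ~ C (U + t *: D).
Proof.
move=> CU D0 fD; pose E := [set t : R | CC (U + t *: D)].
have [B B0 BP] := cone_bounded chart v0.
have [i Di] : exists i, D i 0 != 0.
  apply: contrapT => /forallNP no; move: D0 => /eqP; apply; apply/matrixP => i j.
  by rewrite ord1 mxE; apply/eqP; apply: contrapT => /negP; exact: no.
have Eub : has_ubound E.
  exists ((B * form f U + `|U i 0|) / `|D i 0|) => t /BP/(_ i).
  rewrite formD formZ fD mulr0 addr0 !mxE => h.
  rewrite ler_pdivlMr ?normr_gt0//.
  have := lerB_normD (t * D i 0) (U i 0); rewrite normrM => h'.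
  have h3 : t * `|D i 0| <= `|t| * `|D i 0| by rewrite ler_wpM2r// ler_norm.
  have : `|t * D i 0 + U i 0| <= B * form f U by rewrite addrC.
  by move=> h''; lra.
have [e e0 Ce] := cone_segment Omega_open D CU.
have Ee : E e by exact: (cone_ccone chart Cv0).
have Esup : has_sup E by split=> //; exists e.
have et : e <= sup E by exact: sup_ubound.
exists (sup E); first exact: lt_le_trans et.
have CCt : CC (U + sup E *: D).
  move=> z z0; have [dl dl0 Cd] := cone_segment Omega_open D (coneZ z0 Cv0).
  have [t Et tlt] := sup_adherent dl0 Esup.
  have tle : t <= sup E by exact: sup_ubound.
  rewrite [Z in C Z](_ : _ = (U + t *: D) + (z *: v0 + (sup E - t) *: D)); last first.
    by apply/matrixP => a b; rewrite !mxE; ring.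
  apply: (ccone_addl Omega_open chart Et).
  have [->|tne] := eqVneq t (sup E); first by rewrite subrr scale0r addr0; exact: coneZ.
  have tlt' : t < sup E by rewrite lt_neqAle tne.
  have x0 : 0 < (sup E - t) / dl by rewrite divr_gt0 ?subr_gt0.
  have x1 : 0 < 1 - (sup E - t) / dl by rewrite subr_gt0 ltr_pdivrMr// mul1r; lra.
  rewrite [Z in C Z](_ : _ = (1 - (sup E - t) / dl) *: (z *: v0) +
      ((sup E - t) / dl) *: (z *: v0 + dl *: D)).
    by apply: (coneD chart); apply: coneZ => //; exact: coneZ.
  by apply/matrixP => a b; rewrite !mxE; field; rewrite gt_eqF.
split=> // Ct; have [z z0 Cz] := cone_segment Omega_open D Ct.
have : E (sup E + z).
  by rewrite /E /= scalerDl addrA; exact: (cone_ccone chart Cv0).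
by move=> /(sup_ubound Eub); lra.
Qed.

Lemma ccone_boundary v : CC v -> ~ C v -> v != 0 ->
  exists2 x, boundary Omega x & represents x v.
Proof.
move=> Cv nCv vn0; exists (proj_of (NonzeroVector vn0)) => //.
by apply/(boundaryP Omega_open chart Cv0); exists v.
Qed.

Lemma hilbert_set_nonempty p q : Omega p -> Omega q -> p != q ->
  exists r, hilbert_set p q r.
Proof.
move=> Op Oq pq.
have norm1 z : Omega z -> exists v, [/\ C v, represents z v & form f v = 1].
  move=> Oz; have [v Cv zv] := exists_cone chart Oz; have [fv _] := Cv.
  have i0 : 0 < (form f v)^-1 by rewrite invr_gt0.
  exists ((form f v)^-1 *: v); split; first exact: coneZ.
    by apply: representsZ => //; rewrite gt_eqF.
  by rewrite formZ mulVf// gt_eqF.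
have [U [CU pU fU]] := norm1 p Op; have [W [CW qW fW]] := norm1 q Oq.
have D0 : W - U != 0.
  rewrite subr_eq0; apply: contra pq => /eqP WU; apply/eqP.
  by apply: (represents_inj pU); rewrite -WU.
have fD : form f (W - U) = 0 by rewrite formB fU fW subrr.
have [t t0 [CY nCY]] := ray_exit CW D0 fD.
have ND0 : U - W != 0 by rewrite -opprB oppr_eq0.
have fND : form f (U - W) = 0 by rewrite formB fU fW subrr.
have [t' t'0 [CX nCX]] := ray_exit CU ND0 fND.
set Y := W + _ in CY nCY; set X := U + _ in CX nCX.
have fX : form f X = 1 by rewrite formD formZ fND mulr0 addr0.
have fY : form f Y = 1 by rewrite formD formZ fD mulr0 addr0.
have X0 : X != 0 by apply: contra_eq_neq fX => ->; rewrite form0 eq_sym oner_eq0.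
have Y0 : Y != 0 by apply: contra_eq_neq fY => ->; rewrite form0 eq_sym oner_eq0.
have [x bx xX] := ccone_boundary CX nCX X0.
have [y by_ yY] := ccone_boundary CY nCY Y0.
have ic z v : represents z v -> form f v = 1 -> in_chart f z v.
  by move=> zv fv; split=> //; rewrite zv memv_line.
have S0 : 0 < 1 + t + t' by rewrite !addr_gt0.
(* With [D = W - U] one has [X = U - t' D] and [Y = W + t D], so the chord has length [1 + t + t']
   in units of [D]. *)
eexists; exists f, x, y, X, U, W, Y, (t' / (1 + t + t')), ((t' + 1) / (1 + t + t')).
split=> //; first by split; exact: ic.
split.
- rewrite -subr_eq0 (_ : X - Y = - (1 + t + t') *: (W - U)).
    by rewrite scaler_eq0 (negbTE D0) orbF oppr_eq0 gt_eqF.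
  by apply/matrixP => i j; rewrite !mxE; ring.
- apply/andP; split; first by rewrite divr_ge0// ltW.
  by rewrite ler_pM2r ?invr_gt0// lerDl.
- by rewrite ler_pdivrMr// mul1r; lra.
- by apply/matrixP => i j; rewrite !mxE; field; rewrite gt_eqF.
- by apply/matrixP => i j; rewrite !mxE; field; rewrite gt_eqF.
Qed.

(** By [chord_comparable] the cross ratio itself is admissible, and by [chord_minimal] it is the
    least. If no chord exists then [p = q], and the default value 0 of [xget] is the correct
    distance. *)
Lemma hilbert_distP p q l : Omega p -> Omega q ->
  hilbert_dist Omega p q <= l <-> comparable p q l.
Proof.
move=> Op Oq; rewrite /hilbert_dist -/(hilbert_set p q).
case: xgetP => [r _ /(chord_of_hilbert_set Op Oq) ch|none].
  split=> [rl|]; last exact: chord_minimal.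
  have [u [w [pu qw [Cu Cw] C1 C2]]] := chord_comparable ch.
  exists u, w; split=> //.
  rewrite (_ : _ - _ = (expR r *: u - w) + (expR l - expR r) *: u).
    apply: (cconeD chart) => //; apply: (cconeZ Cv0); first by rewrite subr_ge0 ler_expR.
    exact: (cone_ccone chart Cv0).
  by apply/matrixP => i j; rewrite !mxE; ring.
have pq : p = q.
  apply: contrapT => /eqP pq; have [r rP] := hilbert_set_nonempty Op Oq pq.
  exact: none rP.
subst q; split=> [l0|[u [w [pu pw [Cu Cw] C1 C2]]]].
  have [u Cu pu] := exists_cone chart Op; exists u, u; split=> //.
    by rewrite subrr; exact: (ccone0 Cv0).
  rewrite -[X in _ - X]scale1r -scalerBl; apply: (cconeZ Cv0).
    by rewrite subr_ge0 -expR0 ler_expR.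
  exact: (cone_ccone chart Cv0).
have [fu _] := Cu; have h1 := ccone_form_ge0 C1; have h2 := ccone_form_ge0 C2.
rewrite !formB formZ in h1 h2.
rewrite -ler_expR expR0 -(ler_pM2r fu); nra.
Qed.

End HilbertMetric.

(** * Shadows and automorphisms in the cone *)

Section ShadowCone.
Context (R : realType) (m : nat) (Omega : set (projective_space R m)).
Local Notation vec := 'cV[R]_m.
Context (f : 'rV[R]_m).
Hypothesis Omega_open : open Omega.
Hypothesis chart : convex_bounded_chart Omega f.
Context (v0 : vec).
Local Notation C := (cone Omega f).
Local Notation CC := (ccone Omega f v0).
Hypothesis Cv0 : C v0.

Lemma closure_form_neq0 z v : closure Omega z -> represents z v -> form f v != 0.
Proof.
move=> /(closureP Omega_open chart Cv0)[w Cw zw] zv.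
have [c c0 ->] := represents_prop zw zv.
have fw := ccone_form_gt0 chart Cw (represents_neq0 zw).
by rewrite formZ mulf_neq0// gt_eqF.
Qed.

(** [closed_segment] allows any representatives [v] and [w]. Those of opposite sign are excluded
    because their segment would leave the closure of [Omega], so only nonnegative combinations
    remain. *)
Lemma half_open_segmentP b x z vb vx : C vb -> represents b vb ->
  CC vx -> ~ C vx -> represents x vx ->
  half_open_segment Omega b x z <-> exists2 t : R, 0 <= t & represents z (vb + t *: vx).
Proof.
move=> Cb bvb Cx nCx xvx; have [fb _] := Cb.
have fx := ccone_form_gt0 chart Cx (represents_neq0 xvx).
have nOx : ~ Omega x by move=> /(ccone_cone chart Cx xvx).
have Ob : Omega b by exact: point_of_cone Cb bvb.
split=> [[[v [w [bv xw seg [t /andP[t0 t1] zE]]]] zx]|[t t0 zt]].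
  have [c c0 vE] := represents_prop bvb bv.
  have [e e0 wE] := represents_prop xvx xw.
  have tlt1 : t < 1.
    rewrite lt_neqAle t1 andbT; apply/negP => /eqP tE; apply: zx; apply/val_inj.
    by rewrite /= zE tE subrr scale0r add0r scale1r xw.
  (* Otherwise [f] vanishes at a point of the segment, with parameter [s] below, and no point of the
     closure lies in the kernel of [f]. *)
  have ce : 0 < c * e.
    rewrite lt_neqAle eq_sym mulf_neq0//= leNgt; apply/negP => ce.
    pose d := c * form f vb - e * form f vx.
    have d0 : d != 0.
      apply/negP => /eqP dE; have : e * d = (c * e) * form f vb - e ^+ 2 * form f vx.
        by rewrite /d; ring.
      rewrite dE mulr0 => h; have h1 : (c * e) * form f vb < 0 by rewrite pmulr_llt0.
      have h2 : 0 <= e ^+ 2 * form f vx by rewrite mulr_ge0 ?sqr_ge0// ltW.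
      lra.
    pose s := c * form f vb / d.
    have s01 : 0 < s < 1.
      have cd : 0 < c * d.
        have -> : c * d = c ^+ 2 * form f vb - (c * e) * form f vx by rewrite /d; ring.
        have h1 : 0 <= c ^+ 2 * form f vb by rewrite mulr_ge0 ?sqr_ge0// ltW.
        have h2 : (c * e) * form f vx < 0 by rewrite pmulr_llt0.
        lra.
      have dd : 0 < d * d by rewrite -expr2 exprn_even_gt0.
      have -> : s = (c * d) * form f vb / (d * d) by rewrite /s; field.
      have cdf : 0 < c * d * form f vb by exact: mulr_gt0.
      rewrite (divr_gt0 cdf dd) /= ltr_pdivrMr// mul1r.
      have ed : e * d < 0.
        have -> : e * d = (c * e) * form f vb - e ^+ 2 * form f vx by rewrite /d; ring.
        have h1 : (c * e) * form f vb < 0 by rewrite pmulr_llt0.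
        have h2 : 0 <= e ^+ 2 * form f vx by rewrite mulr_ge0 ?sqr_ge0// ltW.
        lra.
      have -> : d * d = (c * d) * form f vb - (e * d) * form f vx by rewrite {2}/d; ring.
      have h2 : (e * d) * form f vx < 0 by rewrite pmulr_llt0.
      lra.
    have /andP[s0 s1] := s01.
    pose V := (1 - s) *: v + s *: w.
    have fV : form f V = 0.
      rewrite formD !formZ vE wE !formZ /s /d; field; exact: d0.
    have V0 : V != 0.
      apply/negP => /eqP VE; apply: nOx; apply: point_of_cone Cb _.
      have k0 : (1 - s) * c != 0 by rewrite mulf_neq0// subr_eq0 gt_eqF.
      have se0 : - (s * e) / ((1 - s) * c) != 0.
        have s_n0 : s != 0 by rewrite gt_eqF.
        by apply: mulf_neq0; rewrite ?invr_eq0// oppr_eq0; apply: mulf_neq0.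
      have vbE : vb = (- (s * e) / ((1 - s) * c)) *: vx.
        have h : ((1 - s) * c) *: vb + (s * e) *: vx = 0.
          by rewrite -[RHS]VE /V vE wE !scalerA.
        apply: (scalerI k0); rewrite [RHS]scalerA [X in _ = X *: _]mulrC divfK//.
        by rewrite scaleNr; apply/eqP; rewrite -addr_eq0 h.
      by rewrite vbE; apply: representsZ.
    have cl : closure Omega (proj_of (NonzeroVector V0)).
      by apply: seg; exists s => //; rewrite !ltW.
    have := closure_form_neq0 (v := V) cl; rewrite fV eqxx => /(_ erefl).
    by [].
  have c' : 0 < 1 - t by rewrite subr_gt0.
  have k0 : (1 - t) * c != 0 by rewrite mulf_neq0// gt_eqF.
  exists (t * e / ((1 - t) * c)).
    have -> : t * e / ((1 - t) * c) = t * (c * e) / ((1 - t) * (c * c)).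
      by field; rewrite c0 subr_eq0 gt_eqF.
    have cc : 0 <= c * c by rewrite -expr2 sqr_ge0.
    by apply: divr_ge0; [exact: mulr_ge0 t0 (ltW ce)|exact: mulr_ge0 (ltW c') cc].
  have zV : represents z ((1 - t) *: v + t *: w) by [].
  have := representsZ (c := ((1 - t) * c)^-1) _ zV; rewrite invr_eq0 => /(_ k0).
  congr (represents z _); rewrite vE wE; apply/matrixP => i j; rewrite !mxE.
  by field; rewrite c0 subr_eq0 gt_eqF.
have Ct : C (vb + t *: vx).
  rewrite addrC; apply: (ccone_addl Omega_open chart) => //; first exact: cconeZ Cv0 _ _ t0 Cx.
have t1 : 0 < 1 + t by rewrite ltr_pwDl.
split; last first.
  by move=> /= zx; apply: nOx; rewrite -zx; exact: point_of_cone Ct zt.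
exists vb, vx; split=> //.
  move=> y [s /andP[s0 s1] yE]; apply/(closureP Omega_open chart Cv0).
  exists ((1 - s) *: vb + s *: vx) => //; apply: (cconeD chart).
    by apply: (cconeZ Cv0); [rewrite subr_ge0|exact: (cone_ccone chart Cv0)].
  exact: cconeZ Cv0 _ _ s0 Cx.
exists (t / (1 + t)).
  by rewrite (divr_ge0 t0 (ltW t1)) /= ler_pdivrMr// mul1r lerDr.
have := representsZ (c := (1 + t)^-1) _ zt; rewrite invr_eq0 (gt_eqF t1) => /(_ isT).
move=> ->; congr (<[_]>%VS); apply/matrixP => i j; rewrite !mxE.
by field; rewrite gt_eqF.
Qed.

Lemma hilbert_dist_ge0 p q : Omega p -> Omega q -> 0 <= hilbert_dist Omega p q.
Proof.
move=> Op Oq; have := lexx (hilbert_dist Omega p q).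
move=> /(hilbert_distP Omega_open chart Cv0 _ Op Oq).1[u [w [pu qw [Cu Cw] C1 C2]]].
have [fu _] := Cu; have h1 := ccone_form_ge0 C1; have h2 := ccone_form_ge0 C2.
rewrite !formB formZ in h1 h2.
by rewrite -ler_expR expR0 -(ler_pM2r fu); nra.
Qed.

(** In the order of the closed cone, [vp <= c vb + c' vx <= e^l vp]: a point of the ray from [b] to
    [x] at distance at most [l] from [p]. The strict [l < r] matches the strict inequality on the
    infimum. *)
Definition shadow_cone (r : R) (vb vp vx : vec) : Prop :=
  exists c c' l : R, [/\ 0 < c, 0 <= c', l < r,
    CC (c *: vb + c' *: vx - vp) & CC (expR l *: vp - (c *: vb + c' *: vx))].

Lemma shadowP r b p x vb vp vx : C vb -> represents b vb -> C vp -> represents p vp ->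
  CC vx -> ~ C vx -> represents x vx ->
  shadow Omega r b p x <-> shadow_cone r vb vp vx.
Proof.
move=> Cb bvb Cp pvp Cx nCx xvx.
have Ob : Omega b by exact: point_of_cone Cb bvb.
have Op : Omega p by exact: point_of_cone Cp pvp.
have bx : boundary Omega x by apply/(boundaryP Omega_open chart Cv0); exists vx.
have segP z := half_open_segmentP z Cb bvb Cx nCx xvx.
have Ct (t : R) : 0 <= t -> C (vb + t *: vx).
  by move=> t0; rewrite addrC; apply: (ccone_addl Omega_open chart) => //; exact: cconeZ Cv0 _ _ t0 Cx.
have segO z : half_open_segment Omega b x z -> Omega z.
  by move=> /segP[t /Ct Ctt zt]; exact: point_of_cone Ctt zt.
have lb0 : lbound [set hilbert_dist Omega p q | q in half_open_segment Omega b x] 0.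
  by move=> _ [q /segO Oq <-]; exact: hilbert_dist_ge0.
split=> [[_ infr]|[c [c' [l [c0 c'0 lr C1 C2]]]]].
  have ne : [set hilbert_dist Omega p q | q in half_open_segment Omega b x] !=set0.
    exists (hilbert_dist Omega p b), b => //; apply/segP; exists 0 => //.
    by rewrite scale0r addr0.
  have [_ [q qs <-] qr] := inf_lt ne infr.
  have Oq := segO q qs; have [t t0 qt] := (segP q).1 qs.
  have /(hilbert_distP Omega_open chart Cv0 _ Op Oq).1 := lexx (hilbert_dist Omega p q).
  move=> [u [w [pu qw [Cu Cw] C1 C2]]].
  have [a a_n0 uE] := represents_prop pvp pu.
  have [e e_n0 wE] := represents_prop qt qw.
  have pos (z : R) (v : vec) : C v -> C (z *: v) -> 0 < z.
    by move=> [fv _] []; rewrite formZ => h _; rewrite -(pmulr_lgt0 _ fv).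
  have a0 : 0 < a by apply: (pos a vp); rewrite -?uE.
  have e0 : 0 < e by apply: (pos e _ (Ct t t0)); rewrite -wE.
  have ai0 : 0 <= a^-1 by rewrite invr_ge0 ltW.
  exists (e / a), (e * t / a), (hilbert_dist Omega p q); split=> //.
  - exact: divr_gt0.
  - by rewrite mulr_ge0// mulr_ge0// ltW.
  - have := cconeZ Cv0 ai0 C1; congr CC; rewrite uE wE.
    by apply/matrixP => i j; rewrite !mxE; field; rewrite gt_eqF.
  - have := cconeZ Cv0 ai0 C2; congr CC; rewrite uE wE.
    by apply/matrixP => i j; rewrite !mxE; field; rewrite gt_eqF.
split=> //; have C3 : C (c *: vb + c' *: vx).
  rewrite addrC; apply: (ccone_addl Omega_open chart); last exact: coneZ.
  exact: cconeZ Cv0 _ _ c'0 Cx.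
have n0 : c *: vb + c' *: vx != 0.
  by apply: contraTneq C3.1 => ->; rewrite form0 ltxx.
pose q : projective_space R m := proj_of (NonzeroVector n0).
have qr : represents q (c *: vb + c' *: vx) by [].
have qs : half_open_segment Omega b x q.
  apply/segP; exists (c' / c); first by rewrite divr_ge0// ltW.
  have := representsZ (c := c^-1) _ qr; rewrite invr_eq0 (gt_eqF c0) => /(_ isT).
  congr represents; apply/matrixP => i j; rewrite !mxE; field; by rewrite gt_eqF.
have Oq := segO q qs.
apply: le_lt_trans lr; apply: (@le_trans _ _ (hilbert_dist Omega p q)).
  by apply: ge_inf; [exists 0|exists q].
apply/(hilbert_distP Omega_open chart Cv0 _ Op Oq).
by exists vp, (c *: vb + c' *: vx).
Qed.

Lemma represents_act special (g : projective_group R special m) x v :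
  represents x v -> represents (proj_act g x) (lift_mx g *m v).
Proof. by move=> xv; rewrite /represents /= xv limg_line lfunE. Qed.

(** A lift of [g] maps the cone to itself or to its opposite, by [form_sign] applied to [f] composed
    with the lift; [s] corrects the sign. *)
Lemma automorphism_cone (g : PGL R m) : automorphisms Omega g ->
  exists s : R, [/\ s != 0, forall v, C (s *: (lift_mx g *m v)) <-> C v &
    forall v, CC v -> CC (s *: (lift_mx g *m v))].
Proof.
move=> gO; have act x : Omega x -> Omega (proj_act g x).
  by move=> Ox; rewrite -gO; exists x.
have formM v : form (f *m lift_mx g) v = form f (lift_mx g *m v).
  by rewrite /form mulmxA.
have [s ss sf] : exists2 s : R, s * s = 1 & forall v, C v -> 0 < s * form (f *m lift_mx g) v.
  apply: (form_sign chart Cv0) => v [_ [x Ox xv]]; rewrite formM.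
  exact: (chart_form_neq0 chart (act x Ox) (represents_act g xv)).
have s0 : s != 0.
  by apply: contra_eq_neq ss => ->; rewrite mulr0 eq_sym oner_eq0.
have pos v : C v -> C (s *: (lift_mx g *m v)).
  move=> Cv; have [_ [x Ox xv]] := Cv; split; first by rewrite formZ -formM; exact: sf.
  by exists (proj_act g x); [exact: act|apply: representsZ => //; exact: represents_act].
exists s; split=> // v.
  split=> [CBv|]; last exact: pos.
  have [_ [y Oy yv]] := CBv.
  have : Omega y by []. 
  rewrite -{1}gO => -[x Ox xy].
  have [u Cu xu] := exists_cone chart Ox.
  have yu := represents_act g xu; rewrite xy in yu.
  have [c c0 E] := represents_prop yu yv.
  have vE : v = (s^-1 * c) *: u.
    rewrite -[v](mulKmx (lift_mx_unit g)).
    rewrite -[lift_mx g *m v](scalerK s0) E -!scalemxAr !scalerA mulKmx//.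
    exact: lift_mx_unit.
  have k0 : s^-1 * c != 0 by rewrite mulf_neq0// invr_eq0.
  have xv : represents x v by rewrite vE; exact: representsZ.
  have [//|CNv] := cone_of_point chart Ox xv.
  have := (pos _ CNv).1; rewrite mulmxN scalerN formN => h.
  by have := CBv.1; lra.
move=> Cv; have h := @mx_cvg_line _ _ (s *: (lift_mx g *m v)) (s *: (lift_mx g *m v0)) _ _ (@harmonic_cvg R).
rewrite scale0r addr0 in h; apply: (ccone_limit Omega_open chart Cv0 h) => n.
apply: (cone_ccone chart Cv0).
have := pos (v + n.+1%:R^-1 *: v0) (Cv _ _); rewrite invr_gt0 ltr0n => /(_ isT).
by rewrite mulmxDr scalerDr -scalemxAr !scalerA mulrC.
Qed.

Lemma shadow_act (g : PGL R m) r b p x : automorphisms Omega g -> Omega b -> Omega p ->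
  shadow Omega r b p x -> shadow Omega r (proj_act g b) (proj_act g p) (proj_act g x).
Proof.
move=> /automorphism_cone[s [s0 gC gCC]] Ob Op sx.
have [vx [Cx nCx xvx]] := (boundaryP Omega_open chart Cv0 x).1 sx.1.
have [vb Cb bvb] := exists_cone chart Ob; have [vp Cp pvp] := exists_cone chart Op.
have rep y v : represents y v -> represents (proj_act g y) (s *: (lift_mx g *m v)).
  by move=> yv; apply: representsZ => //; exact: represents_act.
have [c [c' [l [c0 c'0 lr C1 C2]]]] := (shadowP r Cb bvb Cp pvp Cx nCx xvx).1 sx.
apply/(shadowP r ((gC vb).2 Cb) (rep _ _ bvb) ((gC vp).2 Cp) (rep _ _ pvp)
  (gCC _ Cx) (fun h => nCx ((gC vx).1 h)) (rep _ _ xvx)).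
exists c, c', l; split=> //.
  have := gCC _ C1; congr CC.
  by rewrite mulmxBr mulmxDr -!scalemxAr scalerBr scalerDr !scalerA ![s * _]mulrC.
have := gCC _ C2; congr CC.
by rewrite mulmxBr mulmxDr -!scalemxAr scalerBr scalerDr !scalerA ![s * _]mulrC.
Qed.

End ShadowCone.

(** * Limit sets *)

Section ProperDiscontinuity.
Context (R : realType) (m : nat) (Omega : set (projective_space R m)).
Local Notation vec := 'cV[R]_m.
Local Notation P := (projective_space R m).
Context (f : 'rV[R]_m).
Hypothesis Omega_open : open Omega.
Hypothesis chart : convex_bounded_chart Omega f.
Context (v0 : vec).
Local Notation C := (cone Omega f).
Local Notation CC := (ccone Omega f v0).
Hypothesis Cv0 : C v0.

Lemma real_mx_bolzano p q (A : nat -> 'M[R]_(p, q)) (M : R) :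
  (forall n i j, `|A n i j| <= M) ->
  exists2 h : nat -> nat, increasing_seq h & exists L : 'M[R]_(p, q), mx_cvg (A \o h) L.
Proof. exact: (@mx_bolzano R RealScalars). Qed.

Lemma represents_cvg (t : nat -> P) (u : nat -> vec) (x : P) v :
  (forall n, represents (t n) (u n)) -> represents x v -> mx_cvg u v -> t @ \oo --> x.
Proof.
move=> tu xv uv.
have u0 n := represents_neq0 (tu n); have v_n0 := represents_neq0 xv.
have -> : t = (fun n => proj_of (NonzeroVector (u0 n))).
  by apply/funext => n; apply: represents_inj (tu n) _.
have -> : x = proj_of (NonzeroVector v_n0) by apply: represents_inj xv _.
exact: (point_cvg (@real_small R)).
Qed.

Lemma cvg_represents (t : nat -> P) (x : P) v : represents x v -> t @ \oo --> x ->
  exists u : nat -> vec, (forall n, represents (t n) (u n)) /\ mx_cvg u v.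
Proof.
move=> xv tx; have v_n0 := represents_neq0 xv.
have xE : x = proj_of (NonzeroVector v_n0) by apply: represents_inj xv _.
rewrite xE in tx; have [u [ut uv]] := point_lift (@real_small R) tx.
by exists u; split=> // n; rewrite -ut.
Qed.

(** Proportionality of vectors is an equality of products of coordinates, which passes to the
    limit. *)
Lemma proj_cvg_unique (t : nat -> P) (x y : P) : t @ \oo --> x -> t @ \oo --> y -> x = y.
Proof.
have [v vx] := point_surj x; have [w wy] := point_surj y.
have xv : represents x v by rewrite -vx.
have yw : represents y w by rewrite -wy.
move=> /(cvg_represents xv)[u [tu uv]] /(cvg_represents yw)[u' [tu' u'w]].
have prop n i j : u n i 0 * u' n j 0 = u n j 0 * u' n i 0.
  have [c _ ->] := represents_prop (tu n) (tu' n); rewrite !mxE; ring.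
have lim i j : (v : vec) i 0 * (w : vec) j 0 = (v : vec) j 0 * (w : vec) i 0.
  have h1 : (fun n => u n i 0 * u' n j 0) @ \oo --> (v : vec) i 0 * (w : vec) j 0.
    by apply: cvgM; [exact: uv|exact: u'w].
  have h2 : (fun n => u n i 0 * u' n j 0) @ \oo --> (v : vec) j 0 * (w : vec) i 0.
    under eq_fun do rewrite prop.
    by apply: cvgM; [exact: uv|exact: u'w].
  exact: (cvg_unique (@norm_hausdorff _ _) h1 h2).
have [i vi] : exists i, (v : vec) i 0 != 0.
  apply: contrapT => /forallNP no; have /eqP := represents_neq0 xv; apply.
  by apply/matrixP => i j; rewrite ord1 mxE; apply/eqP; apply: contrapT => /negP; exact: no.
have wE : (w : vec) = ((w : vec) i 0 / (v : vec) i 0) *: (v : vec).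
  apply/matrixP => j l; rewrite ord1 mxE; apply: (mulfI vi).
  by rewrite lim; field.
have c0 : (w : vec) i 0 / (v : vec) i 0 != 0.
  by apply: contraNneq (represents_neq0 yw) => c0; rewrite wE c0 scale0r.
have := representsZ c0 xv; rewrite -wE => xw; exact: represents_inj xw yw.
Qed.

(** Normalising the lift makes sequences of such matrices relatively compact, with nonzero
    limits. *)
Lemma cone_matrix (g : PGL R m) : automorphisms Omega g ->
  exists B : 'M[R]_m, [/\ \sum_i \sum_j `|B i j| = 1,
    exists2 c : R, c != 0 & B = c *: lift_mx g,
    forall v, C (B *m v) <-> C v & forall v, CC v -> CC (B *m v)].
Proof.
move=> /(automorphism_cone Omega_open chart Cv0)[s [s0 sC sCC]].
pose A := s *: lift_mx g; pose nu := \sum_i \sum_j `|A i j|.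
have AE v : A *m v = s *: (lift_mx g *m v) by rewrite -scalemxAl.
have A0 : A != 0.
  apply/negP => /eqP A0; have := (sC v0).2 Cv0; rewrite -AE A0 mul0mx.
  by move=> [+ _]; rewrite form0 ltxx.
have nu0 : 0 < nu.
  rewrite lt_def; apply/andP; split; last by do 2!(apply: sumr_ge0 => ? _).
  apply: contra A0 => /eqP/psumr_eq0P H; apply/eqP/matrixP => i j; rewrite [RHS]mxE.
  have /psumr_eq0P := H (fun i _ => sumr_ge0 _ (fun j _ => normr_ge0 (A i j))) i isT.
  by move=> /(_ (fun j _ => normr_ge0 (A i j)) j isT)/eqP; rewrite normr_eq0 => /eqP.
have nui : 0 < nu^-1 by rewrite invr_gt0.
exists (nu^-1 *: A); split.
- rewrite (eq_bigr (fun i => nu^-1 * \sum_j `|A i j|)); last first.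
    move=> i _; rewrite mulr_sumr; apply: eq_bigr => j _.
    by rewrite mxE normrM ger0_norm// ltW.
  by rewrite -mulr_sumr mulVf// gt_eqF.
- by exists (nu^-1 * s); rewrite ?mulf_neq0 ?(gt_eqF nui)// scalerA.
- move=> v; rewrite -scalemxAl AE; split; last by move=> /sC/coneZ; apply.
  move=> /(coneZ nu0); rewrite scalerA mulfV ?gt_eqF// scale1r; exact: (sC v).1.
- by move=> v /sCC Cv; rewrite -scalemxAl AE; exact: (cconeZ Cv0 (ltW nui) Cv).
Qed.

Lemma pi_cvg special (D : nat -> linear_group R special m) (L : linear_group R special m) :
  mx_cvg (fun n => D n : 'M[R]_m) L ->
  (fun n => \pi_(projective_group R special m)%qT (D n)) @ \oo -->
  \pi_(projective_group R special m)%qT L.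
Proof.
move=> DL V nV.
have /(nbhs_inducedP (@real_small R))[p pU] := @pi_continuous _
  {eq_quot (@proportional_equiv R special m)}%qT L V nV.
have /(mx_cvg_near (@real_small R))/(_ p)[N NP] := DL.
by exists N => // n /= Nn; exact/pU/NP.
Qed.

Context (Gamma0 : set (PGL R m)).
Hypothesis disc : discrete_subgroup Gamma0.
Hypothesis autG : Gamma0 `<=` automorphisms Omega.

Lemma Gamma1 : Gamma0 1%g.
Proof. by have [[G1 _] _] := disc; exact: set_mem G1. Qed.

Lemma GammaM g h : Gamma0 g -> Gamma0 h -> Gamma0 (g * h)%g.
Proof.
by have [G _] := disc; move=> /mem_set Gg /mem_set Gh; apply: set_mem;
  exact: (group_closedM G).
Qed.

Lemma GammaV g : Gamma0 g -> Gamma0 g^-1%g.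
Proof.
by have [G _] := disc; move=> /mem_set Gg; apply: set_mem; exact: (group_closedV G).
Qed.

(** A limit [L] of normalised lifts sends [p] into the open cone, which forces [L] to be invertible.
    Then successive quotients tend to the identity, and discreteness makes them trivial from some
    index on. *)
Lemma proper_discontinuity (g : nat -> PGL R m) (p x : P) : (forall n, Gamma0 (g n)) ->
  Omega p -> Omega x -> (fun n => proj_act (g n) p) @ \oo --> x ->
  exists h, forall N, exists2 n, (N <= n)%N & g n = h.
Proof.
move=> Gg Op Ox gx.
have [B BP] := choice (fun n => cone_matrix (autG (Gg n))).
have B1 n i j : `|B n i j| <= 1.
  have [<- _ _ _] := BP n; rewrite (bigD1 i) //= (bigD1 j) //= -addrA lerDl.
  by rewrite addr_ge0// ?sumr_ge0// => ? _; apply: sumr_ge0 => ? _.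
have [h hi [L BL]] := real_mx_bolzano B1.
have L0 : L != 0.
  apply/negP => /eqP L0.
  have : (fun n => \sum_i \sum_j `|B (h n) i j|) @ \oo --> (\sum_i \sum_j `|L i j| : R).
    apply: cvg_big_sum => i _; apply: cvg_big_sum => j _; apply: cvg_norm; exact: BL.
  rewrite L0 big1 => [|i _]; last by rewrite big1// => j _; rewrite mxE normr0.
  have -> : (fun n => \sum_i \sum_j `|B (h n) i j|) = (fun=> 1 : R).
    by apply/funext => n; have [] := BP (h n).
  move=> /(cvg_unique (@norm_hausdorff _ _) (cvg_cst _))/eqP.
  by rewrite oner_eq0.
have BLv (v : vec) : mx_cvg (fun n => B (h n) *m v) (L *m v).
  by apply: mx_cvg_mul => //; exact: mx_cvg_cst.
have LCC v : CC v -> CC (L *m v).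
  move=> Cv; apply: (ccone_limit Omega_open chart Cv0 (BLv v)) => n.
  by have [_ _ _] := BP (h n); apply.
have [vp Cp pvp] := exists_cone chart Op.
(* Any vector [w] can be added to the interior vector [vp] with a small coefficient of either sign,
   so [L vp = 0] would put [L w] and its opposite in the closed cone, hence [L = 0]. *)
have Lvp0 : L *m vp != 0.
  apply/negP => /eqP Lvp; move: L0 => /eqP; apply.
  have Lw (w : vec) : L *m w = 0.
    have [e1 e10 C1] := cone_segment Omega_open w Cp.
    have [e2 e20 C2] := cone_segment Omega_open (- w) Cp.
    have := LCC _ (cone_ccone chart Cv0 C1); have := LCC _ (cone_ccone chart Cv0 C2).
    rewrite !mulmxDr Lvp !add0r -!scalemxAr.
    move=> /(cconeZ Cv0 (c := e2^-1)); rewrite invr_ge0 ltW// => /(_ isT).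
    rewrite scalerA mulVf ?gt_eqF// scale1r mulmxN => D1.
    move=> /(cconeZ Cv0 (c := e1^-1)); rewrite invr_ge0 ltW// => /(_ isT).
    rewrite scalerA mulVf ?gt_eqF// scale1r => D2.
    exact: (ccone_proper chart D2 D1).
  apply/matrixP => i j; have := Lw (delta_mx j 0) => /matrixP/(_ i 0).
  by rewrite -colE !mxE.
have Bp n : represents (proj_act (g n) p) (B n *m vp).
  have [_ [c c0 ->] _ _] := BP n; rewrite -scalemxAl; apply: representsZ => //.
  exact: represents_act.
have LvpC : C (L *m vp).
  pose y : P := proj_of (NonzeroVector Lvp0).
  have yL : represents y (L *m vp) by [].
  have ghy : (fun n => proj_act (g (h n)) p) @ \oo --> y.
    exact: (represents_cvg (fun n => Bp (h n)) yL (BLv vp)).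
  have xy : x = y by apply: (proj_cvg_unique _ ghy); exact: (subseq_cvg hi gx).
  apply: (ccone_cone chart _ yL); rewrite -?xy//.
  exact/LCC/(cone_ccone chart Cv0).
(* If [L w = 0], the whole line [vp + t w] is sent by [L] to one interior vector, so the line lies
   in the cone, against properness. *)
have Lu : L \in unitmx.
  rewrite -unitmx_tr unitmxE unitfE; apply/negP => /det0P[w' w0' wL].
  pose w := w'^T; have Lw : L *m w = 0.
    by apply: trmx_inj; rewrite trmx_mul trmxK wL trmx0.
  have w0 : w != 0 by rewrite -(inj_eq (@trmx_inj _ _ _)) trmxK trmx0.
  have dir (z : vec) : (forall t : R, 0 < t -> CC (vp + t *: z)) -> CC z.
    move=> H; have hz := @mx_cvg_line _ _ z vp _ _ (@harmonic_cvg R).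
    rewrite scale0r addr0 in hz; apply: (ccone_limit Omega_open chart Cv0 hz) => n.
    have n0 : (0 : R) < n.+1%:R by rewrite ltr0n.
    have ni : (0 : R) <= n.+1%:R^-1 by rewrite invr_ge0 ltW.
    have := cconeZ Cv0 ni (H _ n0); rewrite scalerDr scalerA mulVf ?gt_eqF// scale1r.
    by rewrite addrC.
  have [t nt] : exists t : R, ~ CC (vp + t *: w).
    apply: contrapT => /forallNP H; have {}H t : CC (vp + t *: w) by apply: contrapT; exact: H.
    have := ccone_proper chart (dir w (fun t _ => H t)) (dir (- w) _).
    move=> E; move: w0; rewrite E ?eqxx// => t _.
    by rewrite scalerN -scaleNr; exact: H.
  have := BLv (vp + t *: w); rewrite mulmxDr -scalemxAr Lw scaler0 addr0.
  move=> /(cone_mx_cvg Omega_open LvpC)[N /(_ N (leqnn N))].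
  have [_ _ BC _] := BP (h N).
  by move=> /BC/(cone_ccone chart Cv0); exact: nt.
have Bu n : B n \in unitmx.
  by have [_ [c c0 ->] _ _] := BP n; rewrite unitmxZ ?unitfE// lift_mx_unit.
have Du n : invmx (B (h n)) *m B (h n.+1) \in unitmx by rewrite unitmx_mul unitmx_inv !Bu.
pose D n : GL R m := gl_of (Du n).
have D1 : mx_cvg (fun n => D n : 'M[R]_m) (lg_one R false m).
  rewrite /= -(mulVmx Lu); apply: mx_cvg_mul.
    by apply: mx_cvg_inv => // n; exact: Bu.
  by move=> i j; have := BL i j; rewrite -cvg_shiftS.
have [_ /(_ _ Gamma1)[_ [V V1 VG]]] := disc.
have piD n : \pi_(PGL R m)%qT (D n) = ((g (h n))^-1 * g (h n.+1))%g.
  have E k : \pi_(PGL R m)%qT (gl_of (Bu k)) = g k.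
    have [_ [c c0 BE] _ _] := BP k.
    rewrite -[RHS]reprK; apply/eqP/pi_projective_eq; by exists c.
  have -> : D n = lg_mul (lg_inv (gl_of (Bu (h n)))) (gl_of (Bu (h n.+1))) by exact: val_inj.
  rewrite pi_pg_mul E; congr (_ * _)%g; apply: (@mulgI _ (g (h n))); rewrite mulgV.
  rewrite -{1}E -[LHS]pi_pg_mul; congr (\pi_(PGL R m)%qT _).
  exact: lg_mulrV.
have [N _ NP] : ((fun n => \pi_(PGL R m)%qT (D n)) @ \oo) V.
  by apply: (pi_cvg D1); exact: V1.
have step n : (N <= n)%N -> g (h n.+1) = g (h n).
  move=> Nn; have : (V `&` Gamma0) (\pi_(PGL R m)%qT (D n)).
    split; first exact: NP.
    by rewrite piD; apply: GammaM => //; exact: GammaV.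
  rewrite VG /= piD => /(congr1 (fun z => g (h n) * z)%g).
  by rewrite mulgA mulgV mul1g mulg1.
have hn n : (n <= h n)%N.
  elim: n => // n IH; apply: leq_ltn_trans IH _.
  by have := leW_mono hi n n.+1; rewrite !ltEnat /= ltnSn => ->.
exists (g (h N)) => M; exists (h (N + M)%N); first by apply: leq_trans (hn _); rewrite leq_addl.
elim: M => [|M IH]; first by rewrite addn0.
by rewrite addnS step ?leq_addr.
Qed.

End ProperDiscontinuity.

(** * Orbits and the limit set *)

Section LimitSet.
Context (R : realType) (m : nat) (Omega : set (projective_space R m)).
Local Notation vec := 'cV[R]_m.
Local Notation P := (projective_space R m).
Context (f : 'rV[R]_m).
Hypothesis Omega_open : open Omega.
Hypothesis chart : convex_bounded_chart Omega f.
Context (v0 : vec).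
Local Notation C := (cone Omega f).
Local Notation CC := (ccone Omega f v0).
Hypothesis Cv0 : C v0.

Lemma proj_act_cvg special (g : projective_group R special m) (t : nat -> P) (x : P) :
  t @ \oo --> x -> (fun n => proj_act g (t n)) @ \oo --> proj_act g x.
Proof.
have [v vx] := point_surj x; have xv : represents x v by rewrite -vx.
move=> /(cvg_represents xv)[u [tu uv]].
apply: (represents_cvg (u := fun n => lift_mx g *m u n) (v := lift_mx g *m (v : vec))).
- by move=> n; exact: represents_act.
- exact: represents_act.
- by apply: mx_cvg_mul => //; exact: mx_cvg_cst.
Qed.

Lemma subseq_ge (h : nat -> nat) : increasing_seq h -> forall n, (n <= h n)%N.
Proof.
move=> hi; elim=> // n IH; apply: leq_ltn_trans IH _.
by have := leW_mono hi n n.+1; rewrite !ltEnat /= ltnSn => ->.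
Qed.

Lemma ccone_bolzano (u : nat -> vec) (B0 : R) : (forall n, CC (u n)) ->
  (forall n, form f (u n) <= B0) ->
  exists2 h : nat -> nat, increasing_seq h & exists2 v : vec, CC v & mx_cvg (u \o h) v.
Proof.
move=> Cu fu; have [B B_ge0 BP] := cone_bounded chart v0.
have uB n i j : `|u n i j| <= B * B0.
  by rewrite ord1; apply: le_trans (BP _ (Cu n) i) _; apply: ler_wpM2l.
have [h hi [v uv]] := real_mx_bolzano uB; exists h => //; exists v => //.
by apply: (ccone_limit Omega_open chart Cv0 uv) => n; exact: Cu.
Qed.

Lemma closure_form1 x : closure Omega x ->
  exists v, [/\ CC v, represents x v & form f v = 1].
Proof.
move=> /(closureP Omega_open chart Cv0)[v Cv xv].
have fv := ccone_form_gt0 chart Cv (represents_neq0 xv).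
exists ((form f v)^-1 *: v); split.
- by apply: (cconeZ Cv0) => //; rewrite invr_ge0 ltW.
- by apply: representsZ => //; rewrite invr_eq0 gt_eqF.
- by rewrite formZ mulVf// gt_eqF.
Qed.

Lemma form1_neq0 (v : vec) : form f v = 1 -> v != 0.
Proof. by move=> fv; apply: contra_eq_neq fv => ->; rewrite form0 eq_sym oner_eq0. Qed.

Lemma closure_bolzano (t : nat -> P) : (forall n, closure Omega (t n)) ->
  exists2 h : nat -> nat, increasing_seq h &
    exists2 x : P, closure Omega x & (t \o h) @ \oo --> x.
Proof.
move=> tc; have [u uP] := choice (fun n => closure_form1 (tc n)).
have Cu n : CC (u n) by have [] := uP n.
have fu n : form f (u n) <= 1 by have [_ _ ->] := uP n.
have [h hi [v Cv uv]] := ccone_bolzano Cu fu; exists h => //.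
have fv : form f v = 1.
  have h1 := form_cvg (f := f) uv.
  apply: (cvg_unique (@norm_hausdorff _ _) h1).
  rewrite (_ : (fun n => form f ((u \o h) n)) = fun=> 1); first exact: cvg_cst.
  by apply/funext => n; have [_ _] := uP (h n).
pose x : P := proj_of (NonzeroVector (form1_neq0 fv)).
exists x; first by apply/(closureP Omega_open chart Cv0); exists v.
by apply: (represents_cvg _ _ uv) => // n; have [] := uP (h n).
Qed.

Context (Gamma0 : set (PGL R m)).
Hypothesis disc : discrete_subgroup Gamma0.
Hypothesis autG : Gamma0 `<=` automorphisms Omega.
Hypothesis visible : forall x y, limit_set Omega Gamma0 x ->
  limit_set Omega Gamma0 y -> x != y -> open_segment Omega x y `<=` Omega.
Local Notation Lambda := (limit_set Omega Gamma0).

Lemma orbit_Omega g p : Gamma0 g -> Omega p -> Omega (proj_act g p).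
Proof. by move=> /autG gO Op; rewrite -gO; exists p. Qed.

Lemma closure_boundary (x : P) : closure Omega x -> ~ Omega x -> boundary Omega x.
Proof. by move=> cx nx; split=> //; rewrite (interior_id _).1. Qed.

Lemma boundary_not_Omega (x : P) : boundary Omega x -> ~ Omega x.
Proof. by move=> [_]; rewrite (interior_id _).1. Qed.

Lemma boundary_ccone (x : P) (v : vec) : boundary Omega x -> represents x v ->
  CC v -> ~ C v.
Proof. by move=> bx xv Cv Cv'; apply: (boundary_not_Omega bx); exact: point_of_cone Cv' xv. Qed.

Lemma visible_sum x y u w : Lambda x -> Lambda y -> x != y ->
  CC u -> CC w -> represents x u -> represents y w -> C (u + w).
Proof.
move=> Lx Ly xy Cu Cw xu yw.
have fu := ccone_form_gt0 chart Cu (represents_neq0 xu).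
have fw := ccone_form_gt0 chart Cw (represents_neq0 yw).
have fuw : 0 < form f (u + w) by rewrite formD addr_gt0.
have uw0 : u + w != 0 by apply: contraTneq fuw => ->; rewrite form0 ltxx.
pose z : P := proj_of (NonzeroVector uw0).
have zuw : represents z (u + w) by [].
apply: (ccone_cone chart (cconeD chart Cu Cw) zuw).
apply: (visible Lx Ly xy); split.
  exists u, w; split=> //.
    move=> y' [s /andP[s0 s1] yE]; apply/(closureP Omega_open chart Cv0).
    exists ((1 - s) *: u + s *: w) => //; apply: (cconeD chart).
      by apply: (cconeZ Cv0) => //; rewrite subr_ge0.
    exact: cconeZ Cv0 _ _ s0 Cw.
  exists (2^-1 : R); first by apply/andP; split; lra.
  have h2 : (2^-1 : R) != 0 by rewrite invr_eq0 pnatr_eq0.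
  have := representsZ h2 zuw; rewrite /represents => ->.
  by congr (<[_]>%VS); apply/matrixP => i j; rewrite !mxE; field.
have no (a b : vec) (p q : P) : represents p a -> represents q b ->
    p != q -> ~ represents p (a + b).
  move=> pa qb pq pab; have [k k0 E] := represents_prop pa pab.
  have bE : b = (k - 1) *: a by rewrite scalerBl scale1r -E addrAC subrr add0r.
  move/negP: pq; apply; apply/eqP; apply: (represents_inj _ qb).
  rewrite bE; apply: representsZ => //.
  by apply: contraNneq (represents_neq0 qb) => k1; rewrite bE k1 scale0r.
move=> [/= zx|/= zy].
  by apply: (no u w x y) => //; rewrite -zx.
by apply: (no w u y x) => //; rewrite 1?eq_sym// addrC -zy.
Qed.

Lemma cone_dominates (u w : vec) : C u -> exists2 M : R, 0 < M & CC (M *: u - w).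
Proof.
move=> Cu; have [e e0 Ce] := cone_segment Omega_open (- w) Cu.
exists e^-1; first by rewrite invr_gt0.
have ei : 0 <= e^-1 by rewrite invr_ge0 ltW.
have := cconeZ Cv0 ei (cone_ccone chart Cv0 Ce).
by rewrite scalerDr scalerA mulVf ?gt_eqF// scale1r.
Qed.

(** The orbits of [p] and [b] stay comparable with fixed constants, so their normalised limits [u]
    and [w] are comparable too. If these were different points, visibility would put [u + w], which
    is dominated by a multiple of [u], in the open cone, and [u] with it. *)
Lemma limit_set_orbit x b : Lambda x -> Omega b ->
  exists2 g : nat -> PGL R m, (forall n, Gamma0 (g n)) &
    (fun n => proj_act (g n) b) @ \oo --> x.
Proof.
move=> Lx Ob; have [bx [p [g [Op Gg gx]]]] := Lx.
have [vp Cp pvp] := exists_cone chart Op; have [vb Cb bvb] := exists_cone chart Ob.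
have [M1 M10 D1] := cone_dominates vp Cb; have [M2 M20 D2] := cone_dominates vb Cp.
have [B BP] := choice (fun n => cone_matrix Omega_open chart Cv0 (autG (Gg n))).
have CBp n : C (B n *m vp) by have [_ _ + _] := BP n => /(_ vp) ->.
have CBb n : C (B n *m vb) by have [_ _ + _] := BP n => /(_ vb) ->.
have fp n : 0 < form f (B n *m vp) by have [] := CBp n.
pose U n := (form f (B n *m vp))^-1 *: (B n *m vp).
pose W n := (form f (B n *m vp))^-1 *: (B n *m vb).
have inv0 n : 0 < (form f (B n *m vp))^-1 by rewrite invr_gt0.
have CU n : CC (U n) by apply: (cone_ccone chart Cv0); exact: coneZ.
have CW n : CC (W n) by apply: (cone_ccone chart Cv0); exact: coneZ.
have fU n : form f (U n) = 1 by rewrite formZ mulVf// gt_eqF.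
have E1 n : CC (M1 *: W n - U n).
  have [_ _ _ /(_ _ D1)] := BP n => /(cconeZ Cv0 (ltW (inv0 n))).
  by rewrite mulmxBr -scalemxAr scalerBr scalerA mulrC -scalerA.
have E2 n : CC (M2 *: U n - W n).
  have [_ _ _ /(_ _ D2)] := BP n => /(cconeZ Cv0 (ltW (inv0 n))).
  by rewrite mulmxBr -scalemxAr scalerBr scalerA mulrC -scalerA.
have fWM n : form f (W n) <= M2.
  by have := ccone_form_ge0 (E2 n); rewrite formB formZ fU mulr1 subr_ge0.
have fU1 n : form f (U n) <= 1 by rewrite fU.
have [h hi [u Cu Uu]] := ccone_bolzano CU fU1.
have [k ki [w Cw Ww]] := @ccone_bolzano (W \o h) M2 (fun n => CW (h n)) (fun n => fWM (h n)).
have {}Uu := mx_cvg_subseq ki Uu.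
have comb (c : R) (X Y : nat -> vec) x0 y0 : mx_cvg X x0 -> mx_cvg Y y0 ->
    mx_cvg (fun n => c *: X n - Y n) (c *: x0 - y0).
  move=> Xx Yy i j; rewrite !mxE (_ : (fun p => _) = fun p => c * X p i j - Y p i j).
    by apply: cvgB; [apply: cvgM; [exact: cvg_cst|exact: Xx]|exact: Yy].
  by apply/funext => q; rewrite !mxE.
have F1 : CC (M1 *: w - u).
  by apply: (ccone_limit Omega_open chart Cv0 (comb M1 _ _ _ _ Ww Uu)) => n; exact: E1.
have F2 : CC (M2 *: u - w).
  by apply: (ccone_limit Omega_open chart Cv0 (comb M2 _ _ _ _ Uu Ww)) => n; exact: E2.
have fu : form f u = 1.
  apply: (cvg_unique (@norm_hausdorff _ _) (form_cvg (f := f) Uu)).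
  rewrite (_ : (fun n => form f _) = fun=> 1); first exact: cvg_cst.
  by apply/funext => n; exact: fU.
have w_n0 : w != 0.
  apply/negP => /eqP w0; have := ccone_form_ge0 F1.
  by rewrite w0 scaler0 sub0r formN fu; lra.
have repB n q v : represents q v -> represents (proj_act (g n) q)
    ((form f (B n *m vp))^-1 *: (B n *m v)).
  move=> qv; have i0 := inv0 n; have [_ [c c0 BE] _ _] := BP n.
  apply: representsZ; first by rewrite gt_eqF.
  rewrite BE; by rewrite -scalemxAl; apply: representsZ => //; exact: represents_act.
pose x1 : P := proj_of (NonzeroVector (form1_neq0 fu)).
pose x2 : P := proj_of (NonzeroVector w_n0).
have gx1 : (fun n => proj_act (g (h (k n))) p) @ \oo --> x1.
  by apply: (represents_cvg _ _ Uu) => // n; exact: repB.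
have gx2 : (fun n => proj_act (g (h (k n))) b) @ \oo --> x2.
  by apply: (represents_cvg _ _ Ww) => // n; exact: repB.
have x1x : x1 = x.
  apply: (proj_cvg_unique gx1); exact: (subseq_cvg (increasing_comp hi ki) gx).
have xu : represents x u by rewrite -x1x.
have nCu := boundary_ccone bx xu Cu.
have x2w : represents x2 w by [].
have up z : C z -> CC (M2 *: u - z) -> False.
  move=> Cz Cuz; apply: nCu.
  have := coneZ (c := M2^-1) _ (ccone_addl Omega_open chart Cuz Cz).
  by rewrite invr_gt0 subrK scalerA mulVf ?gt_eqF// scale1r; apply.
have bx2 : boundary Omega x2.
  apply: closure_boundary; first by apply/(closureP Omega_open chart Cv0); exists w.
  by move=> /(ccone_cone chart Cw x2w) Cw'; exact: up w Cw' F2.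
have Lx2 : Lambda x2.
  by split=> //; exists b, (fun n => g (h (k n))); split=> // n; exact: Gg.
exists (fun n => g (h (k n))) => //.
have [xx|xx] := eqVneq x x2; first by rewrite xx.
exfalso; have Cuw := visible_sum Lx Lx2 xx Cu Cw xu x2w.
have M21 : 0 < M2 + 1 by rewrite addr_gt0.
have sumE : M2 *: u - w + (u + w) = (M2 + 1) *: u.
  by apply/matrixP => i j; rewrite !mxE; ring.
apply: nCu; have := ccone_addl Omega_open chart F2 Cuw; rewrite sumE => Cs.
have Mi : 0 < (M2 + 1)^-1 by rewrite invr_gt0.
by have := coneZ Mi Cs; rewrite scalerA mulVf ?gt_eqF// scale1r.
Qed.

Lemma limit_set_act g x : Gamma0 g -> Lambda x -> Lambda (proj_act g x).
Proof.
move=> Gg [bx [p [gs [Op Ggs gx]]]]; split.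
  apply: closure_boundary.
    have [u [Cu _ xu]] := (boundaryP Omega_open chart Cv0 x).1 bx.
    have [s [s0 _ sCC]] := automorphism_cone Omega_open chart Cv0 (autG Gg).
    apply/(closureP Omega_open chart Cv0); exists (s *: (lift_mx g *m u)); first exact: sCC.
    by apply: representsZ => //; exact: represents_act.
  move=> Ogx; apply: (boundary_not_Omega bx).
  have := orbit_Omega (GammaV disc Gg) Ogx; rewrite -proj_actM mulVg.
  by rewrite proj_act1.
exists p, (fun n => g * gs n)%g; split=> // [n|]; first exact: (GammaM disc).
rewrite (_ : (fun n => _) = (fun n => proj_act g (proj_act (gs n) p))).
  exact: proj_act_cvg.
by apply/funext => n; rewrite proj_actM.
Qed.

(** Dichotomy behind the arguments by contradiction below: an element recurs, or the orbits under
    the elements and under their inverses converge to limit points along a subsequence. A limit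
    inside [Omega] leads to the first case by [proper_discontinuity]. *)
Lemma escape b (g : nat -> PGL R m) : Omega b -> (forall n, Gamma0 (g n)) ->
  (exists h, forall N, exists2 n, (N <= n)%N & g n = h) \/
  exists2 h : nat -> nat, increasing_seq h & exists x y : P,
    [/\ Lambda x, Lambda y, (fun n => proj_act (g (h n)) b) @ \oo --> x &
        (fun n => proj_act (g (h n))^-1%g b) @ \oo --> y].
Proof.
move=> Ob Gg.
have cl (s : PGL R m) : Gamma0 s -> closure Omega (proj_act s b).
  by move=> Gs; apply: subset_closure; exact: orbit_Omega.
have [h hi [x cx gx]] := closure_bolzano (fun n => cl _ (Gg n)).
have GgV n : Gamma0 (g (h n))^-1%g by exact: (GammaV disc).
have [k ki [y cy gy]] := closure_bolzano (fun n => cl _ (GgV n)).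
have hki := increasing_comp hi ki.
have {}gx := subseq_cvg ki gx.
have lift (z : nat -> PGL R m) l : (forall N, exists2 n, (N <= n)%N & z (h (k n)) = l) ->
    forall N, exists2 n, (N <= n)%N & z n = l.
  move=> H N; have [n Nn E] := H N; exists (h (k n)) => //.
  by apply: leq_trans Nn _; exact: (subseq_ge hki).
have [Ox|nOx] := pselect (Omega x).
  left; have [l lP] := proper_discontinuity Omega_open chart Cv0 disc autG
    (fun n => Gg (h (k n))) Ob Ox gx.
  by exists l; exact: lift.
have [Oy|nOy] := pselect (Omega y).
  left; have [l lP] := proper_discontinuity Omega_open chart Cv0 disc autG
    (fun n => GgV (k n)) Ob Oy gy.
  exists l^-1%g; apply: lift => N; have [n Nn E] := lP N; exists n => //.
  by rewrite -E invgK.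
right; exists (h \o k) => //; exists x, y; split=> //; split.
- exact: closure_boundary.
- by exists b, (g \o (h \o k)); split=> // n; exact: Gg.
- exact: closure_boundary.
- by exists b, (fun n => (g (h (k n)))^-1%g); split=> // n; exact: GgV.
Qed.

(** By [limit_set_orbit] each term is approximated by the orbit of one base point [b], and a
    diagonal sequence converges to [x]. *)
Lemma limit_set_closed (t : nat -> P) x : (forall n, Lambda (t n)) ->
  t @ \oo --> x -> Lambda x.
Proof.
move=> Lt tx; have [vx vxE] := point_surj x.
have xv : represents x vx by rewrite -vxE.
have nOx : ~ Omega x.
  move=> Ox; have [N _ NP] : (t @ \oo) Omega.
    by apply: tx; apply: open_nbhs_nbhs.
  by apply: (boundary_not_Omega (Lt N).1); exact: NP N (leqnn N).
have cx : closure Omega x.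
  have cl : closed (closure Omega) by exact: closed_closure.
  apply: cl => V /tx[N _ /(_ N (leqnn N)) VN].
  by exists (t N); split=> //; have [[]] := Lt N.
split; first exact: closure_boundary.
have [b Cb] : exists b : P, Omega b by have [_ [b Ob _]] := Cv0; exists b.
have [u [tu uv]] := cvg_represents xv tx.
have H p : exists gw : PGL R m * vec, [/\ Gamma0 gw.1,
    represents (proj_act gw.1 b) gw.2 & mx_near (vx : vec) p gw.2].
  (* Each of the two errors is below [(2 * p).+2%:R^-1], and they add up to [p.+1%:R^-1]. *)
  have /(mx_cvg_near (@real_small R))/(_ (2 * p).+1)[N /(_ N (leqnn N)) uN] := uv.
  have [g Gg gt] := limit_set_orbit (Lt N) Cb.
  have [w [gw wu]] := cvg_represents (tu N) gt.
  have /(mx_cvg_near (@real_small R))/(_ (2 * p).+1)[M /(_ M (leqnn M)) wM] := wu.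
  exists (g M, w M); split=> //= i j.
  have -> : (vx : vec) i j - w M i j = ((vx : vec) i j - u N i j) + (u N i j - w M i j).
    by rewrite addrA subrK.
  apply: le_lt_trans (ler_normD _ _) _.
  have -> : (p.+1%:R^-1 : R) = (2 * p).+2%:R^-1 + (2 * p).+2%:R^-1.
    rewrite (_ : (2 * p).+2 = 2 * p.+1)%N; last by rewrite mulnS addnC !addnS addn0.
    by have p0 : (p.+1%:R : R) != 0 by []; rewrite natrM; field.
  exact: ltrD.
have [gw gwP] := choice H.
exists b, (fun n => (gw n).1); split=> // [n|]; first by have [] := gwP n.
apply: (represents_cvg (u := fun n => (gw n).2) _ xv) => [n|]; first by have [] := gwP n.
apply/(mx_cvg_near (@real_small R)) => p; exists p => q pq.
by apply: (mx_near_decreasing pq); have [] := gwP q.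
Qed.

End LimitSet.

(** * Limits of minors and the Iwasawa cocycle *)

Section Genericity.
Context (K : numFieldType) (d : nat).

Lemma poly_eq0_of_roots (p : {poly K}) : (forall t, p.[t] = 0) -> p = 0.
Proof.
move=> pt; apply/eqP/contraT => p0.
have := @max_poly_roots _ p [seq n%:R | n <- iota 0 (size p)] p0 _ _.
rewrite size_map size_iota ltnn; apply.
  by apply/allP => x _; rewrite /root pt.
by rewrite map_inj_uniq ?iota_uniq// => a b /eqP; rewrite eqr_nat => /eqP.
Qed.

Context (j : 'I_d.-1).

Lemma det_rowsub1 (f h : increasing_map d j.+1) :
  \det (mxsub (val f) (val h) (1%:M : 'M[K]_d)) = (f == h)%:R.
Proof.
have [<-|fh] := eqVneq f h.
  rewrite (_ : mxsub _ _ _ = 1%:M) ?det1//; apply/matrixP => a b.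
  by rewrite !mxE (inj_eq (@increasing_map_inj _ _ f)).
have [surj|nosurj] := pselect (forall b, exists a, val f a == val h b).
  have [p pP] := choice surj.
  have pinj : injective p.
    move=> a b pab; apply: (@increasing_map_inj _ _ h).
    by rewrite -(eqP (pP a)) -(eqP (pP b)) pab.
  move/eqP: fh; case; apply: (@increasing_map_eq _ _ _ _ (perm pinj) 1%g) => a.
  by rewrite permE perm1 (eqP (pP a)).
have /existsNP[b /forallNP no] := nosurj.
rewrite (expand_det_col _ b) big1// => a _; rewrite !mxE.
by have /negP/negbTE -> := no a; rewrite mul0r.
Qed.

(* Invertible matrices in general position with respect to [k] are Zariski
   dense, and permutation matrices realize each Pluecker coordinate alone. *)
Lemma frame_span (Z : increasing_map d j.+1 -> K) (k : GL K d) (I : {set 'I_d.-1}) :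
  (forall h : GL K d,
    (forall i, i \in I -> \det (last_rows i k *m first_cols i h) != 0) ->
    \sum_f row_minors (last_rows j h) f * Z f = 0) ->
  forall f, Z f = 0.
Proof.
move=> HZ; have [h1' h1P'] := transverse_base k.
pose h1 : 'M[K]_d := h1'.
have h1P i : last_rows i k *m first_cols i h1 = 1%:M := h1P' i.
have h1u : h1 \in unitmx := linear_group_unit h1'.
clearbody h1.
(* Along the line from the generic frame [h1] to [h0] the sum is a polynomial [P] in [t], and [Q]
   detects frames in general position. Their product vanishes everywhere and [Q] is nonzero at 0.
   The adjugate replaces the inverse to keep the entries polynomial. *)
have all (h0 : 'M[K]_d) : \sum_(f : increasing_map d j.+1) \det (colsub (val f) (rowsub (@tail_ord d j) (\adj h0))) * Z f = 0.
  pose H : 'M[{poly K}]_d := map_mx polyC h1 + 'X *: map_mx polyC (h0 - h1).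
  have evH t : map_mx (horner_eval t) H = h1 + t *: (h0 - h1).
    by apply/matrixP => a b; rewrite !mxE /= /horner_eval !hornerE.
  pose P : {poly K} := \sum_(f : increasing_map d j.+1) \det (colsub (val f) (rowsub (@tail_ord d j) (\adj H))) * (Z f)%:P.
  pose Q : {poly K} := \det H * \prod_(i in I)
    \det (map_mx polyC (last_rows i k) *m colsub (@head_ord d i) H).
  have evP t : P.[t] = \sum_(f : increasing_map d j.+1) \det (colsub (val f) (rowsub (@tail_ord d j)
      (\adj (h1 + t *: (h0 - h1))))) * Z f.
    rewrite -/(horner_eval t P) rmorph_sum; apply: eq_bigr => f _.
    rewrite rmorphM /= -det_map_mx /horner_eval hornerC; congr (\det _ * _).
    by rewrite !map_mxsub map_mx_adj evH.
  have evQ t : Q.[t] = \det (h1 + t *: (h0 - h1)) * \prod_(i in I)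
      \det (last_rows i k *m first_cols i (h1 + t *: (h0 - h1))).
    rewrite -/(horner_eval t Q) rmorphM rmorph_prod /= -det_map_mx evH.
    congr (_ * _); apply: eq_bigr => i _.
    rewrite -det_map_mx map_mxM; congr (\det (_ *m _)).
      by apply/matrixP => a b; rewrite !mxE /= /horner_eval hornerC.
    by rewrite map_mxsub evH.
  have PQ : P * Q = 0.
    apply: poly_eq0_of_roots => t; rewrite hornerM.
    have [->|Qt] := eqVneq Q.[t] 0; first by rewrite mulr0.
    suff -> : P.[t] = 0 by rewrite mul0r.
    move: Qt; rewrite evQ evP mulf_eq0 negb_or => /andP[du].
    set ht := h1 + _ in du *.
    have htu : ht \in unitmx by rewrite unitmxE unitfE.
    move=> /prodf_neq0 tr; have := HZ (gl_of htu) tr.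
    move=> /(congr1 (fun x => (\det ht) ^+ j.+1 * x)); rewrite mulr0 mulr_sumr => E.
    rewrite -[RHS]E; apply: eq_bigr => f _; rewrite mulrA; congr (_ * _).
    rewrite /row_minors -detZ; congr (\det _); apply/matrixP => a b.
    by rewrite !mxE /= /invmx htu mxE mulrA divff// mul1r mxE.
  have Q0 : Q != 0.
    apply/negP => /eqP Q0; have := evQ 0; rewrite Q0 horner0 scale0r addr0.
    under eq_bigr do rewrite h1P det1.
    rewrite big1_eq mulr1 => /eqP; rewrite eq_sym.
    by have := h1u; rewrite unitmxE unitfE => /negbTE ->.
  move/eqP: PQ; rewrite mulf_eq0 (negbTE Q0) orbF => /eqP P0.
  by have := evP 1; rewrite P0 horner0 scale1r addrC subrK => /esym.
(* The rows of [P] are completed to an invertible matrix, reversed in [F] because [tail_ord] counts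
   from the end. Applied to [invmx F], the relation retains only the coordinate [f]. *)
move=> f; pose P : 'M[K]_(j.+1, d) := rowsub (val f) 1%:M.
have PE (h : increasing_map d j.+1) : \det (colsub (val h) P) = (f == h)%:R.
  by rewrite -det_rowsub1; congr (\det _); apply/matrixP => a b; rewrite !mxE.
have rP : \rank P = j.+1.
  have := mulmx_max_rank; have PP : P *m P^T = 1%:M.
    apply/matrixP => a b; rewrite !mxE (bigD1 (val f b)) //= big1 => [|c cb].
      by rewrite !mxE eqxx mulr1 addr0 (inj_eq (@increasing_map_inj _ _ f)).
    by rewrite !mxE [val f b == c]eq_sym (negbTE cb) mulr0.
  move=> _; apply/eqP; rewrite eqn_leq rank_leq_row /=.
  by have := mxrankM_maxl P P^T; rewrite PP mxrank1.
pose E := row_ebase P; have Eu : E \in unitmx by exact: row_ebase_unit.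
have LE : P = col_ebase P *m rowsub (@head_ord d j) E.
  rewrite -[LHS]mulmx_ebase rP; rewrite -mulmxA; congr (_ *m _).
  apply/matrixP => a b; rewrite !mxE (bigD1 (head_ord a)) //= big1 => [|c ca].
    by rewrite !mxE eqxx ltn_ord mul1r addr0.
  rewrite !mxE (_ : (a == c :> nat) = false) ?mul0r//.
  by apply: contra_neqF ca => /eqP ac; apply/val_inj.
pose F := row_perm (perm rev_ord_inj) E.
have Fu : F \in unitmx by rewrite /F row_permE unitmx_mul unitmx_perm.
have := all (invmx F).
have adjE : \adj (invmx F) = \det (invmx F) *: F.
  have iu : invmx F \in unitmx by rewrite unitmx_inv.
  have {3}-> : F = (\det (invmx F))^-1 *: \adj (invmx F).
    by have := invmxK F; rewrite {1}/invmx iu => ->.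
  by rewrite scalerA divff ?scale1r// -unitfE -unitmxE.
have fE : rowsub (@tail_ord d j) F = rowsub (@head_ord d j) E.
  by apply/matrixP => a b; rewrite !mxE permE rev_ordK.
have DE (h : increasing_map d j.+1) :
    \det (col_ebase P) * \det (colsub (val h) (rowsub (@head_ord d j) E)) = (f == h)%:R.
  rewrite -PE -det_mulmx [in RHS]LE; congr (\det _).
  by apply/matrixP => a b; rewrite !mxE; apply: eq_bigr => c _; rewrite !mxE.
have du : \det (invmx F) != 0 by rewrite -unitfE -unitmxE unitmx_inv.
have AE (h : increasing_map d j.+1) :
    \det (colsub (val h) (rowsub (@tail_ord d j) (\adj (invmx F)))) =
    \det (invmx F) ^+ j.+1 * \det (colsub (val h) (rowsub (@head_ord d j) E)).
  rewrite -detZ adjE -fE; congr (\det _).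
  by apply/matrixP => a b; rewrite !mxE.
move=> /(congr1 (fun x => \det (col_ebase P) * x)); rewrite mulr0 mulr_sumr.
rewrite (eq_bigr (fun h => \det (invmx F) ^+ j.+1 * (f == h)%:R * Z h)); last first.
  by move=> h _; rewrite AE -DE; ring.
rewrite (bigD1 f) //= big1 => [|h /negbTE hf].
  rewrite addr0 eqxx mulr1 => /eqP; rewrite mulf_eq0 expf_eq0 (negbTE du) andbF /=.
  by move/eqP.
by rewrite eq_sym hf mulr0 mul0r.
Qed.

End Genericity.

Lemma cvg_mul_eq (K : numFieldType) (a b c e : nat -> K) (la lb lc le : K) :
  a @ \oo --> la -> b @ \oo --> lb -> c @ \oo --> lc -> e @ \oo --> le ->
  (forall n, a n * b n = c n * e n) -> la * lb = lc * le.
Proof.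
move=> al bl cl el E; have ceE : c \* e = a \* b by apply/funext => n /=.
apply: (cvg_unique (@norm_hausdorff _ _) (F := (a \* b) @ \oo)); first exact: cvgM.
by rewrite -ceE; exact: cvgM.
Qed.

(** * Rank one limits of minors *)

Section LimitingMinors.
Context (R : realType) (k : scalar_kind) (d : nat) (theta : {set 'I_d.-1}).
Local Notation K := (scalars R k).
Local Notation frame := (frame_flag theta).
Hypothesis sym : symmetric_roots theta.
Context (G : nat -> PSL K d) (kx hy : GL K d).
Local Notation g n := (lift_mx (G n)).
Hypothesis backward : forall F, transverse_flags F (frame kx) ->
  (fun n => flag_act (G n)^-1%g F) @ \oo --> frame hy.
Context (j : root_in theta).
Local Notation inc := (increasing_map d (val j).+1).
Context (N : nat -> K) (T : inc -> inc -> K).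
Hypothesis NT : forall f h : inc,
  (fun n => N n * \det (mxsub (val f) (val h) (g n))) @ \oo --> T f h.
Local Notation q := (row_minors (last_rows (val j) (hy : 'M[K]_d))).

Lemma minors_cvg n (A : nat -> 'M[K]_(d, n)) (L : 'M[K]_(d, n)) (f : increasing_map d n) :
  mx_cvg A L -> (fun p => minors (A p) f) @ \oo --> minors L f.
Proof. by move=> AL; apply: mx_cvg_det; exact: mx_cvg_sub. Qed.

Lemma row_minors_cvg n (A : nat -> 'M[K]_(n, d)) (L : 'M[K]_(n, d)) (f : increasing_map d n) :
  mx_cvg A L -> (fun p => row_minors (A p) f) @ \oo --> row_minors L f.
Proof. by move=> AL; apply: mx_cvg_det; exact: mx_cvg_sub. Qed.

Lemma minors_mul n (A : 'M[K]_d) (V : 'M[K]_(d, n)) (f : increasing_map d n) :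
  minors (A *m V) f = \sum_(h : increasing_map d n) \det (mxsub (val f) (val h) A) * minors V h.
Proof. exact: (@minors_mulmx K d n d n (val f) id A V). Qed.

Lemma row_minors_mul n (A : 'M[K]_d) (P : 'M[K]_(n, d)) (f : increasing_map d n) :
  row_minors (P *m A) f = \sum_(h : increasing_map d n) row_minors P h * \det (mxsub (val h) (val f) A).
Proof. exact: (@minors_mulmx K d n n d id (val f) P A). Qed.

(** The last rows of [invmx (g n) *m h] are those of [h] times [g n]. As the flag of this frame
    tends to that of [hy], their minors become proportional to [q], while after scaling by [N n]
    they tend to the pairing with [T]. *)
Lemma limit_row_minors (h : GL K d) (f1 f2 : inc) :
  transverse_flags (frame h) (frame kx) ->
  (\sum_f row_minors (last_rows (val j) h) f * T f f1) * q f2 =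
  (\sum_f row_minors (last_rows (val j) h) f * T f f2) * q f1.
Proof.
move=> tr; have hu := linear_group_unit h.
have [u [ut uhy]] := flag_lift (@scalar_small R k) (backward tr).
have gu n : invmx (g n) *m h \in unitmx by rewrite unitmx_mul unitmx_inv lift_mx_unit.
have uE n : frame (u n) = frame (gl_of (gu n)).
  have guV : lift_mx (G n)^-1%g *m h \in unitmx by rewrite unitmx_mul lift_mx_unit.
  rewrite ut (flag_act_frame theta guV (erefl _)).
  have [c c0 cE] := lift_mxM (G n)^-1%g (G n).
  have [e e0 eE] := lift_mx1 K d true.
  have gE : lift_mx (G n)^-1%g = (c^-1 * e) *: invmx (g n).
    rewrite mulVg eE in cE.
    have := congr1 (fun M => c^-1 *: (M *m invmx (g n))) cE.
    by rewrite -!scalemxAl mulmxK ?lift_mx_unit// mul1mx !scalerA mulVf// scale1r => <-.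
  apply: eq_frame_flag => i; exists ((c^-1 * e) ^+ (val i).+1) => f.
  rewrite /minors -detZ; congr (\det _).
  by apply/matrixP => a b; rewrite /= gE -scalemxAl !mxE.
have prop n : exists c, forall f : inc,
    row_minors (last_rows (val j) h *m g n) f = c * row_minors (last_rows (val j) (u n)) f.
  have rj : rev_ord (val j) \in theta by rewrite sym (valP j).
  pose i : root_in theta := exist _ (rev_ord (val j)) rj.
  have ij : ((val j).+1 + (val i).+1 = d)%N by exact: rev_root_add.
  have [c cE] := @frame_flag_row_minors _ _ theta (gl_of (gu n)) (u n) i (val j) ij
    (congr1 (fun F : flag K theta => F i) (esym (uE n))).
  by exists c => f; rewrite -cE -last_rows_mulmx// lift_mx_unit.
pose X f n := N n * row_minors (last_rows (val j) h *m g n) f.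
have Xl f : X f @ \oo --> \sum_f' row_minors (last_rows (val j) h) f' * T f' f.
  rewrite (_ : X f = fun n => \sum_(f' : inc) row_minors (last_rows (val j) h) f' *
     (N n * \det (mxsub (val f') (val f) (g n)))).
    by apply: cvg_big_sum => f' _; apply: cvgM; [exact: cvg_cst|exact: NT].
  apply/funext => n; rewrite /X row_minors_mul mulr_sumr; apply: eq_bigr => f' _.
  by rewrite mulrCA.
have Yl f : (fun n => row_minors (last_rows (val j) (u n)) f) @ \oo --> q f.
  apply: row_minors_cvg; apply: mx_cvg_sub; apply: mx_cvg_inv => //.
    by move=> p; exact: linear_group_unit.
  exact: linear_group_unit.
apply: (cvg_mul_eq (Xl f1) (Yl f2) (Xl f2) (Yl f1)) => n.
by have [c cE] := prop n; rewrite /X !cE; ring.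
Qed.

(** The cross relations of [limit_row_minors] are linear in the minors of [h], so [frame_span] turns
    them into relations between the entries of each row of [T]. *)
Lemma limit_minors_rank1 : exists u : inc -> K, forall f h, T f h = u f * q h.
Proof.
have cross f f1 f2 : T f f1 * q f2 = T f f2 * q f1.
  apply/eqP; rewrite -subr_eq0; apply/eqP.
  apply: (@frame_span K d (val j) (fun f => T f f1 * q f2 - T f f2 * q f1) kx theta).
  move=> h hP; have tr : transverse_flags (frame h) (frame kx).
    by apply/transverse_frameP => // i; apply: hP; exact: valP.
  have := limit_row_minors f1 f2 tr => /eqP; rewrite -subr_eq0 => /eqP E.
  rewrite -[RHS]E !mulr_suml -sumrB; apply: eq_bigr => f' _.
by rewrite mulrBr !mulrA.
have [f0 f00] := row_minors_last_rows_neq0 (val j) (linear_group_unit hy).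
exists (fun f => T f f0 / q f0) => f h.
by apply: (mulIf f00); rewrite cross mulrAC divfK.
Qed.

Context (u : inc -> K).
Hypothesis Tu : forall f h, T f h = u f * q h.

(** With [T] of rank one, the limit of the scaled minors is [u] times the pairing that tests
    transversality to [hy]. The frames [v n] may vary with [n]. *)
Lemma limit_minors_image (v : nat -> GL K d) (hz : GL K d) (f : inc) :
  mx_cvg (fun n => v n : 'M[K]_d) hz ->
  (fun n => N n * minors (g n *m first_cols (val j) (v n)) f) @ \oo -->
  u f * \det (last_rows (val j) hy *m first_cols (val j) hz).
Proof.
move=> vz.
rewrite (_ : (fun n => _) = fun n => \sum_(h : inc)
   (N n * \det (mxsub (val f) (val h) (g n))) * minors (first_cols (val j) (v n)) h).
  rewrite det_mul_minors mulr_sumr.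
  have -> : \sum_(i : inc) u f * (q i * minors (first_cols (val j) hz) i) =
            \sum_(i : inc) T f i * minors (first_cols (val j) hz) i.
    by apply: eq_bigr => h _; rewrite Tu mulrA.
  apply: cvg_big_sum => h _; apply: cvgM; first exact: NT.
  by apply: minors_cvg; exact: mx_cvg_sub.
by apply/funext => n; rewrite minors_mul mulr_sumr; apply: eq_bigr => h _; rewrite mulrA.
Qed.

(** When the pairing is nonzero, the scaled minors of the images tend to a nonzero multiple of [u],
    which is therefore proportional to the Pluecker coordinates of the limit flag. *)
Lemma limit_minors_attract (v : nat -> GL K d) (hz w : GL K d) (f1 f2 : inc) :
  mx_cvg (fun n => v n : 'M[K]_d) hz ->
  transverse_flags (frame hz) (frame hy) ->
  (fun n => flag_act (G n) (frame (v n))) @ \oo --> frame w ->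
  u f1 * minors (first_cols (val j) w) f2 = u f2 * minors (first_cols (val j) w) f1.
Proof.
move=> vz /(transverse_frameP _ _ sym)/(_ j) D0 /(flag_lift (@scalar_small R k))[s [st sw]].
have gu n : g n *m v n \in unitmx by rewrite unitmx_mul lift_mx_unit linear_group_unit.
have prop n : exists c : K, forall f : inc,
    minors (g n *m first_cols (val j) (v n)) f = c * minors (first_cols (val j) (s n)) f.
  have [|c _ cE] := @frame_flag_minors _ _ theta (gl_of (gu n)) (s n) j.
    by rewrite st (flag_act_frame theta (gu n) (erefl _)).
  by exists c => f; rewrite -cE mulmx_first_cols.
set D := \det _ in D0.
have Yl f : (fun n => minors (first_cols (val j) (s n)) f) @ \oo -->
    minors (first_cols (val j) w) f by apply: minors_cvg; exact: mx_cvg_sub.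
have E := cvg_mul_eq (@limit_minors_image v hz f1 vz) (Yl f2) (@limit_minors_image v hz f2 vz) (Yl f1).
apply: (mulIf D0); rewrite mulrAC E 1?mulrAC// => n.
by have [c cE] := prop n; rewrite !cE; ring.
Qed.

End LimitingMinors.

Lemma ln_ratio_le (R : realType) (c e1 e2 s1 s2 : R) : 0 < c -> 0 < e1 -> 0 < e2 ->
  e1 <= s1 -> e2 <= s2 -> s1 <= c * e1 -> s2 <= c * e2 ->
  `|ln (e2 / e1) - ln (s2 / s1)| <= ln c.
Proof.
move=> c0 e10 e20 l1 l2 m1 m2.
have s10 := lt_le_trans e10 l1; have s20 := lt_le_trans e20 l2.
have {}l1 : ln e1 <= ln s1 by rewrite ler_ln.
have {}l2 : ln e2 <= ln s2 by rewrite ler_ln.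
have {}m1 : ln s1 <= ln c + ln e1 by rewrite -lnM ?posrE// ler_ln ?posrE ?mulr_gt0.
have {}m2 : ln s2 <= ln c + ln e2 by rewrite -lnM ?posrE// ler_ln ?posrE ?mulr_gt0.
by rewrite !ln_div ?posrE// ler_norml; apply/andP; split; lra.
Qed.

(** * The Iwasawa cocycle through minors *)

Section IwasawaCocycle.
Context (R : realType) (k : scalar_kind) (d : nat) (theta : {set 'I_d.-1}).
Local Notation K := (scalars R k).
Local Notation frame := (frame_flag theta).

Definition minors_sum n (V : 'M[K]_(d, n)) : R := \sum_(f : increasing_map d n) scalar_abs (minors V f).

Lemma minors_sum_ge0 n (V : 'M[K]_(d, n)) : 0 <= minors_sum V.
Proof. by apply: sumr_ge0 => f _; exact: abs_ge0. Qed.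

Lemma minors_sum_gt0 n (V : 'M[K]_(d, n)) : (exists f, minors V f != 0) -> 0 < minors_sum V.
Proof.
move=> [f f0]; rewrite /minors_sum (bigD1 f) //= ltr_pwDl//.
  by rewrite lt_def abs_eq0 f0 abs_ge0.
by apply: sumr_ge0 => h _; exact: abs_ge0.
Qed.

Lemma minors_sum_first_cols_gt0 (j : 'I_d.-1) (h : 'M[K]_d) : h \in unitmx ->
  0 < minors_sum (first_cols j h).
Proof. by move=> hu; apply: minors_sum_gt0; exact: minors_first_cols_neq0. Qed.

Lemma pluckerE n (V : 'M[K]_(d, n)) f : plucker V f = minors V f.
Proof. by rewrite ffunE. Qed.

Lemma exterior_norm_le n (V : 'M[K]_(d, n)) : exterior_norm (plucker V) <= minors_sum V.
Proof.
have s0 := minors_sum_ge0 V.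
rewrite -[leRHS]ger0_norm// -sqrtr_sqr ler_sqrt ?sqr_ge0//.
rewrite expr2 {1}/minors_sum mulr_suml; apply: ler_sum => f _.
rewrite pluckerE expr2; apply: ler_wpM2l; first exact: abs_ge0.
rewrite /minors_sum (bigD1 f) //= lerDl; apply: sumr_ge0 => h _; exact: abs_ge0.
Qed.

Lemma le_exterior_norm n (V : 'M[K]_(d, n)) :
  minors_sum V <= #|{: increasing_map d n}|%:R * exterior_norm (plucker V).
Proof.
rewrite -sum1_card natr_sum mulr_suml; apply: ler_sum => f _; rewrite mul1r.
rewrite -[leLHS]ger0_norm ?abs_ge0// -sqrtr_sqr /exterior_norm ler_sqrt; last first.
  by apply: sumr_ge0 => h _; exact: sqr_ge0.
rewrite (bigD1 f) //= pluckerE lerDl; apply: sumr_ge0 => h _; exact: sqr_ge0.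
Qed.

Lemma exterior_norm_scale n (V : 'M[K]_(d, n)) (B : 'M[K]_n) :
  exterior_norm (plucker (V *m B)) = scalar_abs (\det B) * exterior_norm (plucker V).
Proof.
rewrite plucker_mulmx /exterior_norm -[X in X * _]ger0_norm ?abs_ge0//.
rewrite -sqrtr_sqr -sqrtrM ?sqr_ge0// mulr_sumr; congr Num.sqrt.
by apply: eq_bigr => f _; rewrite ffunE absM exprMn.
Qed.

(** Another wedge product from the same subspace differs by a factor [\det B], whose modulus cancels
    in the quotient; so the defining conditions are consistent, and [exists_fundamental_weights]
    solves them. *)
Lemma iwasawa_cocycleE (g : PSL K d) (h : GL K d) (j : root_in theta) :
  fundamental_weight (val j) (iwasawa_cocycle g (frame h)) =
  ln (exterior_norm (plucker (lift_mx g *m first_cols (val j) h)) /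
      exterior_norm (plucker (first_cols (val j) h))).
Proof.
pose c (i : 'I_d.-1) := ln (exterior_norm (plucker (lift_mx g *m first_cols i h)) /
      exterior_norm (plucker (first_cols i h))).
have wedgeE (i : root_in theta) (s : (val i).+1.-tuple 'cV[K]_d) :
    (forall a, tnth s a \in frame h i) -> wedge_product s != 0 ->
    ln (exterior_norm (exterior_map (lift_mx g) (wedge_product s)) /
            exterior_norm (wedge_product s)) = c (val i).
  move=> sF; rewrite wedge_productE exterior_map_plucker.
  have [B BE] : exists B, tuple_mx s = first_cols (val i) h *m B.
    have [y yE] := choice (fun a => elimT (mem_frame_flagP h _ _) (sF a)).
    exists (\matrix_(a, b) y b a 0); apply/matrixP => a b; rewrite !mxE yE !mxE.
    by apply: eq_bigr => e _; rewrite !mxE.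
  rewrite BE => wn; rewrite mulmxA !exterior_norm_scale /c.
  have dB : scalar_abs (\det B) != 0.
    rewrite abs_eq0; apply: contra wn => /eqP d0; apply/eqP/ffunP => f.
    by rewrite plucker_mulmx !ffunE d0 mul0r.
  by rewrite -mulf_div divff// mul1r.
have [a aP] := exists_fundamental_weights theta c.
rewrite /iwasawa_cocycle; case: xgetP => [b _ bP|H].
  pose s : (val j).+1.-tuple 'cV[K]_d := [tuple col a (first_cols (val j) h) | a < (val j).+1].
  have sF e : tnth s e \in frame h j by rewrite tnth_mktuple; exact: first_cols_mem.
  have sE : tuple_mx s = first_cols (val j) h.
    by apply/matrixP => p q; rewrite !mxE tnth_mktuple !mxE.
  have s0 : wedge_product s != 0.
    rewrite wedge_productE sE.
    have [f f0] := minors_first_cols_neq0 (val j) (linear_group_unit h).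
    by apply: contra f0 => /eqP E; rewrite -pluckerE E ffunE.
  by rewrite (bP j s sF s0) wedgeE.
by exfalso; apply: (H a) => i s sF s0; rewrite aP ?(valP i)// wedgeE.
Qed.

Lemma iwasawa_minors_sum (j : root_in theta) : exists C : R,
  forall (g : PSL K d) (h : GL K d),
  `|fundamental_weight (val j) (iwasawa_cocycle g (frame h)) -
    ln (minors_sum (lift_mx g *m first_cols (val j) h) /
        minors_sum (first_cols (val j) h))| <= C.
Proof.
set c : R := #|{: increasing_map d (val j).+1}|%:R.
exists (ln c) => g h; rewrite iwasawa_cocycleE.
set V := first_cols (val j) h; set W := lift_mx g *m V.
have s1 : 0 < minors_sum V by apply: minors_sum_first_cols_gt0; exact: linear_group_unit.
have s2 : 0 < minors_sum W.
  rewrite /W mulmx_first_cols; apply: minors_sum_first_cols_gt0.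
  by rewrite unitmx_mul lift_mx_unit linear_group_unit.
have c0 : 0 < c.
  rewrite ltr0n; apply/card_gt0P.
  by have [f _] := minors_first_cols_neq0 (val j) (linear_group_unit h); exists f.
have e1 : 0 < exterior_norm (plucker V).
  by have := lt_le_trans s1 (le_exterior_norm V); rewrite pmulr_rgt0.
have e2 : 0 < exterior_norm (plucker W).
  by have := lt_le_trans s2 (le_exterior_norm W); rewrite pmulr_rgt0.
have l1 := exterior_norm_le V; have l2 := exterior_norm_le W.
have m1 := le_exterior_norm V; have m2 := le_exterior_norm W.
exact: ln_ratio_le.
Qed.

End IwasawaCocycle.

Lemma cvg_ln_bounded (R : realType) (a b : nat -> R) (la lb : R) :
  a @ \oo --> la -> b @ \oo --> lb -> 0 < la -> 0 < lb ->
  exists (M : R) N, forall n, (N <= n)%N -> `|ln (a n) - ln (b n)| <= M.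
Proof.
move=> al bl la0 lb0.
have lnal : (fun n => ln (a n)) @ \oo --> ln la.
  exact: (cvg_comp _ _ al (continuous_ln la0)).
have lnbl : (fun n => ln (b n)) @ \oo --> ln lb.
  exact: (cvg_comp _ _ bl (continuous_ln lb0)).
have lnab : (fun n => ln (a n) - ln (b n)) @ \oo --> ln la - ln lb by exact: cvgB.
have /cvgrPdist_lt/(_ 1 ltr01)[N _ NP] := lnab.
exists (`|ln la - ln lb| + 1), N => n /NP; rewrite distrC => /ltW H.
have -> : ln (a n) - ln (b n) = (ln la - ln lb) + ((ln (a n) - ln (b n)) - (ln la - ln lb)).
  by rewrite subrKC.
by apply: le_trans (ler_normD _ _) _; rewrite lerD2l.
Qed.

Lemma ler_dist3 (R : realType) (x y v w t C1 C2 C3 : R) :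
  `|x - (w - v)| <= C1 -> `|y - t| <= C2 -> `|- t + w - v| <= C3 ->
  `|x - y| <= C1 + C2 + C3.
Proof.
by rewrite !ler_norml => /andP[? ?] /andP[? ?] /andP[? ?]; apply/andP; split; lra.
Qed.

(** * Dynamics of the representation on flags *)

Section Dynamics.
Context (R : realType) (k : scalar_kind) (d m : nat) (theta : {set 'I_d.-1}).
Local Notation K := (scalars R k).
Local Notation P := (projective_space R m).
Local Notation frame := (frame_flag theta).
Hypothesis sym : symmetric_roots theta.
Context (Omega : set P) (f : 'rV[R]_m).
Hypothesis Omega_open : open Omega.
Hypothesis chart : convex_bounded_chart Omega f.
Context (v0 : 'cV[R]_m).
Hypothesis Cv0 : cone Omega f v0.
Context (Gamma0 : set (PGL R m)).
Hypothesis visible : projectively_visible Omega Gamma0.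
Context (rho : PGL R m -> PSL K d) (xi : P -> flag K theta).
Hypothesis rep : representation Gamma0 rho.
Hypothesis trans : transverse_with_limit_map Omega Gamma0 rho xi.
Local Notation Lambda := (limit_set Omega Gamma0).

Lemma rhoM g h : Gamma0 g -> Gamma0 h -> rho (g * h)%g = (rho g * rho h)%g.
Proof. by move=> Gg Gh; apply: rep; exact: mem_set. Qed.

Lemma rho1 : rho 1%g = 1%g.
Proof.
have [disc _ _ _] := visible; have G1 := Gamma1 disc.
apply: (@mulgI _ (rho 1%g)); rewrite -rhoM// !mulg1; reflexivity.
Qed.

Lemma rhoV g : Gamma0 g -> rho g^-1%g = (rho g)^-1%g.
Proof.
have [disc _ _ _] := visible => Gg; have GV := GammaV disc Gg.
by apply: (@mulgI _ (rho g)); rewrite -rhoM// !mulgV rho1.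
Qed.

Lemma xi_cvg (t : nat -> P) z : (forall n, Lambda (t n)) -> Lambda z ->
  t @ \oo --> z -> (fun n => xi (t n)) @ \oo --> xi z.
Proof.
move=> Lt Lz tz; have [[xic _ _] _ _ _] := trans.
move=> V /((subspace_continuousP _ _).1 xic z Lz) /tz[N _ NP].
by exists N => // n /NP /(_ (Lt n)).
Qed.

Context (g : nat -> PGL R m) (b x y : P).
Hypothesis Gg : forall n, Gamma0 (g n).
Hypothesis Ob : Omega b.
Hypothesis Lx : Lambda x.
Hypothesis Ly : Lambda y.
Hypothesis gx : (fun n => proj_act (g n) b) @ \oo --> x.
Hypothesis gy : (fun n => proj_act (g n)^-1%g b) @ \oo --> y.
Context (kx hy : GL K d).
Hypothesis xiE : xi x = frame kx.
Hypothesis yiE : xi y = frame hy.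

Lemma rho_forward F : transverse_flags F (frame hy) ->
  (fun n => flag_act (rho (g n)) F) @ \oo --> frame kx.
Proof.
have [_ _ _ H] := trans; rewrite -xiE -yiE => tr.
exact: (H _ b x y Gg Ob Lx Ly gx gy).
Qed.

Lemma rho_backward F : transverse_flags F (frame kx) ->
  (fun n => flag_act (rho (g n))^-1%g F) @ \oo --> frame hy.
Proof.
have [_ _ _ H] := trans; rewrite -xiE -yiE => tr.
have [disc _ _ _] := visible.
have GV n : Gamma0 (g n)^-1%g by exact: GammaV.
have := H (fun n => (g n)^-1%g) b y x GV Ob Ly Lx gy _ F tr.
rewrite (_ : (fun n => flag_act (rho (g n)^-1%g) F) =
             (fun n => flag_act (rho (g n))^-1%g F)); last first.
  by apply/funext => n; rewrite rhoV.
apply; rewrite (_ : (fun n => _) = (fun n => proj_act (g n) b)) //.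
by apply/funext => n; rewrite invgK.
Qed.

Context (j : root_in theta).
Local Notation inc := (increasing_map d (val j).+1).
Local Notation scale n := (scalar_of_real k (minors_norm (val j).+1 (lift_mx (rho (g n))))^-1).

Lemma exists_limit_minors : exists2 h : nat -> nat, increasing_seq h &
  exists (T : inc -> inc -> K) (u : inc -> K),
  [/\ forall e e' : inc, (fun n => scale (h n) * \det (mxsub (val e) (val e')
        (lift_mx (rho (g (h n)))))) @ \oo --> T e e',
      forall e e', T e e' = u e * row_minors (last_rows (val j) (hy : 'M[K]_d)) e' &
      exists e, u e != 0].
Proof.
pose G n := lift_mx (rho (g n)).
pose nu n := minors_norm (val j).+1 (G n).
have nu0 n : 0 < nu n.
  by apply: minors_norm_gt0; [exact: root_leq|exact: lift_mx_unit].
pose U (ee : inc * inc) n := scalar_of_real k (nu n)^-1 *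
  \det (mxsub (val ee.1) (val ee.2) (G n)).
have absU ee n : scalar_abs (U ee n) = (nu n)^-1 *
    scalar_abs (\det (mxsub (val ee.1) (val ee.2) (G n))).
  by rewrite absM abs_real ger0_norm// invr_ge0 ltW.
have U1 ee n : scalar_abs (U ee n) <= 1.
  by rewrite absU ler_pdivrMl// mulr1; exact: le_minors_norm.
have [h hi [T0 TP]] := family_bolzano U1.
pose T (e e' : inc) : K := T0 (e, e'); exists h => //.
have TP' (e e' : inc) : (fun n => scale (h n) * \det (mxsub (val e) (val e')
        (lift_mx (rho (g (h n)))))) @ \oo --> T e e' by exact: (TP (e, e')).
pose S n := \sum_(e : inc) \sum_(e' : inc) scalar_abs (U (e, e') (h n)).
have S1 : S = fun=> 1.
  apply/funext => n; rewrite /S -[RHS](mulVf (lt0r_neq0 (nu0 (h n)))).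
  rewrite mulr_sumr; apply: eq_bigr => e _; rewrite mulr_sumr.
  by apply: eq_bigr => e' _; rewrite absU.
have T1 : \sum_(e : inc) \sum_(e' : inc) scalar_abs (T e e') = 1.
  apply: (cvg_unique (@norm_hausdorff _ _) (F := S @ \oo)); last by rewrite S1; exact: cvg_cst.
  apply: cvg_big_sum => e _; apply: cvg_big_sum => e' _; apply: cvg_scalar_abs.
  exact: (TP (e, e')).
have back F : transverse_flags F (frame kx) ->
    (fun n => flag_act ((rho \o g \o h) n)^-1%g F) @ \oo --> frame hy.
  by move=> tr; exact: (subseq_cvg hi (rho_backward tr)).
have [u uP] := limit_minors_rank1 sym back TP'.
exists T, u; split=> //; apply: contrapT => /forallNP u0.
move/eqP: T1; rewrite big1 => [|e _]; first by rewrite eq_sym oner_eq0.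
rewrite big1// => e' _; rewrite uP.
by have := u0 e => /negP; rewrite negbK => /eqP ->; rewrite mul0r abs0.
Qed.

(** The scaled sum of minors of the image frame tends to a positive limit since [z0] differs from
    the repelling point [y]. Taking logarithms, the expansion at [z] is that of the whole exterior
    power up to a constant. *)
Lemma cocycle_kappa_subseq (z : nat -> P) (z0 : P) :
  (forall n, Lambda (z n)) -> Lambda z0 -> z @ \oo --> z0 -> z0 != y ->
  exists2 h : nat -> nat, increasing_seq h & exists (C : R) N,
    forall n, (N <= n)%N ->
    `|fundamental_weight (val j) (iwasawa_cocycle (rho (g (h n))) (xi (z (h n)))) -
      fundamental_weight (val j) (kappa (rho (g (h n))))| <= C.
Proof.
move=> Lz Lz0 zz0 z0y.
have [hz hzE] := flag_frame (xi z0).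
have := xi_cvg Lz Lz0 zz0; rewrite hzE => /(flag_lift (@scalar_small R k))[v [vz vhz]].
have [h hi [T [u [NT Tu [e0 u0]]]]] := exists_limit_minors.
pose V n := first_cols (val j) (v (h n) : 'M[K]_d).
pose W n := lift_mx (rho (g (h n))) *m V n.
pose nu n := minors_norm (val j).+1 (lift_mx (rho (g (h n)))).
have nu0 n : 0 < nu n.
  by apply: minors_norm_gt0; [exact: root_leq|exact: lift_mx_unit].
have vh : mx_cvg (fun n => v (h n) : 'M[K]_d) hz.
  exact: (@mx_cvg_subseq _ _ _ (fun n => v n : 'M[K]_d) _ h hi vhz).
have tr : transverse_flags (frame hz) (frame hy).
  have [[_ inj _] _ H _] := trans; rewrite -hzE -yiE; apply: H => //.
  by apply: contra z0y => /eqP/inj; rewrite !in_setE => /(_ Lz0 Ly) ->.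
have D0 := (transverse_frameP hz hy sym).1 tr j.
have WL (e : inc) := @limit_minors_image _ _ _ _ (fun n => rho (g (h n))) hy j _ T NT u Tu
  (fun n => v (h n)) hz e vh.
set D := \det _ in D0 WL.
have sW : (fun n => (nu n)^-1 * minors_sum (W n)) @ \oo -->
    \sum_(e : inc) scalar_abs (u e * D).
  rewrite (_ : (fun n => (nu n)^-1 * minors_sum (W n)) = (fun n => \sum_(e : inc)
      scalar_abs (scalar_of_real k (nu n)^-1 * minors (W n) e))).
    by apply: cvg_big_sum => e _; apply: cvg_scalar_abs; exact: WL.
  apply/funext => n; rewrite /minors_sum mulr_sumr; apply: eq_bigr => e _.
  by rewrite absM abs_real ger0_norm// invr_ge0 ltW.
have sV : (fun n => minors_sum (V n)) @ \oo --> minors_sum (first_cols (val j) hz).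
  apply: cvg_big_sum => e _; apply: cvg_scalar_abs; apply: minors_cvg.
  exact: mx_cvg_sub.
have lim0 : 0 < \sum_(e : inc) scalar_abs (u e * D).
  rewrite (bigD1 e0) //= ltr_pwDl//.
    by rewrite lt_def abs_ge0 abs_eq0 mulf_neq0.
  by apply: sumr_ge0 => e _; exact: abs_ge0.
have sV0 n : 0 < minors_sum (V n).
  by apply: minors_sum_first_cols_gt0; exact: linear_group_unit.
have sW0 n : 0 < minors_sum (W n).
  rewrite /W mulmx_first_cols; apply: minors_sum_first_cols_gt0.
  by rewrite unitmx_mul lift_mx_unit linear_group_unit.
have sz0 : 0 < minors_sum (first_cols (val j) hz).
  by apply: minors_sum_first_cols_gt0; exact: linear_group_unit.
have [M [N NM]] := cvg_ln_bounded sW sV lim0 sz0.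
exists h => //.
have [C1 C1P] := iwasawa_minors_sum R k j.
have [C2 C2P] := kappa_minors_norm R k (val j).
exists (C1 + C2 + M), N => n /NM nM.
have := C1P (rho (g (h n))) (v (h n)); have := C2P (rho (g (h n))).
rewrite -vz -/(nu n) -/(V n) -/(W n) ln_div ?posrE//.
move: nM; rewrite lnM ?posrE ?invr_gt0// lnV ?posrE//.
by move=> lnM h2 h1; exact: ler_dist3 h1 h2 lnM.
Qed.

(** Two applications of [limit_minors_attract]: to the moving flags, and to one fixed flag
    transverse to [hy], whose limit is known to be that of [kx]. Both limits are proportional to
    [u]. *)
Lemma attracting_minors (z : nat -> P) (z0 : P) (hw : GL K d) :
  (forall n, Lambda (z n)) -> Lambda z0 -> z @ \oo --> z0 -> z0 != y ->
  (fun n => flag_act (rho (g n)) (xi (z n))) @ \oo --> frame hw ->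
  exists c : K, forall e : inc,
    minors (first_cols (val j) hw) e = c * minors (first_cols (val j) kx) e.
Proof.
move=> Lz Lz0 zz0 z0y gw.
have [hz hzE] := flag_frame (xi z0).
have := xi_cvg Lz Lz0 zz0; rewrite hzE => /(flag_lift (@scalar_small R k))[v [vz vhz]].
have [h hi [T [u [NT Tu [e0 u0]]]]] := exists_limit_minors.
have tr : transverse_flags (frame hz) (frame hy).
  have [[_ inj _] _ H _] := trans; rewrite -hzE -yiE; apply: H => //.
  by apply: contra z0y => /eqP/inj; rewrite !in_setE => /(_ Lz0 Ly) ->.
have vh : mx_cvg (fun n => v (h n) : 'M[K]_d) hz.
  exact: (@mx_cvg_subseq _ _ _ (fun n => v n : 'M[K]_d) _ h hi vhz).
have Aw (e1 e2 : inc) := @limit_minors_attract _ _ _ _ sym (fun n => rho (g (h n))) hy j _ T NT u Tu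
  (fun n => v (h n)) hz hw e1 e2 vh tr.
have [h1 h1P] := transverse_base hy.
have tr1 : transverse_flags (frame h1) (frame hy).
  by apply/transverse_frameP => // i; rewrite h1P det1 oner_neq0.
have Ax (e1 e2 : inc) := @limit_minors_attract _ _ _ _ sym (fun n => rho (g (h n))) hy j _ T NT u Tu
  (fun=> h1) h1 kx e1 e2 (@mx_cvg_cst _ _ _ _) tr1 (subseq_cvg hi (rho_forward tr1)).
have {}Aw e1 e2 := Aw e1 e2 _.
have [e1 m1] := minors_first_cols_neq0 (val j) (linear_group_unit kx).
have mx0 : minors (first_cols (val j) kx) e0 != 0.
  apply: contra m1 => /eqP E; have := Ax e0 e1; rewrite E mulr0 => /eqP.
  by rewrite mulf_eq0 (negbTE u0).
exists (minors (first_cols (val j) hw) e0 / minors (first_cols (val j) kx) e0) => e.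
apply: (mulfI u0); rewrite Aw.
  by rewrite [RHS]mulrCA Ax [RHS]mulrCA divfK.
have := subseq_cvg hi gw.
by rewrite (_ : _ \o h = fun n => flag_act (rho (g (h n))) (frame (v (h n))))//;
  apply/funext => n /=; rewrite vz.
Qed.

End Dynamics.

(** * The limit set has no global fixed point *)

Section ChartDistance.
Context (R : realType) (m : nat).
Local Notation P := (projective_space R m).
Context (Omega : set P) (f : 'rV[R]_m).
Hypothesis Omega_open : open Omega.
Hypothesis chart : convex_bounded_chart Omega f.
Context (v0 : 'cV[R]_m).
Hypothesis Cv0 : cone Omega f v0.

Definition chart_vec (x : P) : 'cV[R]_m := xget 0 [set v | represents x v /\ form f v = 1].

Lemma chart_vecP x : closure Omega x ->
  [/\ ccone Omega f v0 (chart_vec x), represents x (chart_vec x) & form f (chart_vec x) = 1].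
Proof.
move=> /(closure_form1 Omega_open chart Cv0)[v [Cv xv fv]].
rewrite /chart_vec; case: xgetP => [w _ [xw fw]|/(_ v) H]; last by exfalso; apply: H.
suff -> : w = v by [].
have [c _ wE] := represents_prop xv xw; move: fw.
by rewrite wE formZ fv mulr1 => ->; rewrite scale1r.
Qed.

Lemma chart_vec_uniq x v : closure Omega x -> represents x v -> form f v = 1 -> v = chart_vec x.
Proof.
move=> /chart_vecP[_ xw fw] xv fv; have [c _ vE] := represents_prop xw xv.
by move: fv; rewrite vE formZ fw mulr1 => ->; rewrite scale1r.
Qed.

Lemma chart_vec_cvg (t : nat -> P) x : (forall n, closure Omega (t n)) ->
  closure Omega x -> t @ \oo --> x -> mx_cvg (chart_vec \o t) (chart_vec x).
Proof.
move=> ct cx tx; have [_ xw fw] := chart_vecP cx.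
have [u [tu uw]] := cvg_represents xw tx.
have fu n : form f (u n) != 0.
  have [_ tv fv] := chart_vecP (ct n); have [c c0 ->] := represents_prop tv (tu n).
  by rewrite formZ fv mulr1.
have -> : chart_vec \o t = fun n => (form f (u n))^-1 *: u n.
  apply/funext => n; apply/esym/chart_vec_uniq => //.
    by apply: representsZ => //; rewrite invr_eq0.
  by rewrite formZ mulVf.
rewrite -[chart_vec x]scale1r -invr1 -fw; apply: mx_cvg_scale => //.
apply: cvgV; last exact: form_cvg.
by rewrite fw oner_neq0.
Qed.

(** An auxiliary distance on the closure of [Omega], read in the chart, to measure points of the
    limit set, which the Hilbert metric does not reach. *)
Definition chart_dist (x y : P) : R := \sum_i `|chart_vec x i 0 - chart_vec y i 0|.

Lemma chart_dist_ge0 x y : 0 <= chart_dist x y.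
Proof. exact: sumr_ge0. Qed.

Lemma chart_distC x y : chart_dist x y = chart_dist y x.
Proof. by apply: eq_bigr => i _; rewrite distrC. Qed.

Lemma chart_dist_triangle y x z : chart_dist x z <= chart_dist x y + chart_dist y z.
Proof. by rewrite -big_split; apply: ler_sum => i _; exact: ler_distD. Qed.

Lemma chart_dist_gt0 x y : closure Omega x -> closure Omega y -> x != y ->
  0 < chart_dist x y.
Proof.
move=> /chart_vecP[_ xv _] /chart_vecP[_ yv _] xy; rewrite lt_def chart_dist_ge0 andbT.
apply: contra xy => /eqP/psumr_eq0P H; apply/eqP.
suff E : chart_vec x = chart_vec y by rewrite E in xv; exact: represents_inj xv yv.
apply/matrixP => i j; rewrite ord1; apply/eqP; rewrite -subr_eq0 -normr_eq0.
by rewrite H.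
Qed.

Lemma chart_dist_cvg (t : nat -> P) x y : (forall n, closure Omega (t n)) ->
  closure Omega x -> t @ \oo --> x -> (fun n => chart_dist (t n) y) @ \oo --> chart_dist x y.
Proof.
move=> ct cx tx; apply: cvg_big_sum => i _; apply: cvg_norm.
apply: cvgB; [exact: (chart_vec_cvg ct cx tx)|exact: cvg_cst].
Qed.

Lemma chart_dist_le (t : nat -> P) x y e : (forall n, closure Omega (t n)) ->
  closure Omega x -> t @ \oo --> x -> (forall n, chart_dist (t n) y < e) ->
  chart_dist x y <= e.
Proof.
move=> ct cx tx te.
have H : (fun n => chart_dist (t n) y) @ \oo --> chart_dist x y by exact: chart_dist_cvg.
apply: (cvgr_to_le H).
by apply: nearW => n; exact: ltW.
Qed.

Lemma chart_dist_ge (t : nat -> P) x y e : (forall n, closure Omega (t n)) ->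
  closure Omega x -> t @ \oo --> x -> (forall n, e <= chart_dist (t n) y) ->
  e <= chart_dist x y.
Proof.
move=> ct cx tx te.
have H : (fun n => chart_dist (t n) y) @ \oo --> chart_dist x y by exact: chart_dist_cvg.
apply: (cvgr_to_ge H).
by apply: nearW => n; exact: te.
Qed.

End ChartDistance.

(** * Attraction on the limit set *)

Section Attraction.
Context (R : realType) (k : scalar_kind) (d m : nat) (theta : {set 'I_d.-1}).
Local Notation K := (scalars R k).
Local Notation P := (projective_space R m).
Hypothesis sym : symmetric_roots theta.
Context (Omega : set P) (Gamma0 : set (PGL R m)).
Hypothesis visible : projectively_visible Omega Gamma0.
Context (rho : PGL R m -> PSL K d) (xi : P -> flag K theta).
Hypothesis rep : representation Gamma0 rho.
Hypothesis trans : transverse_with_limit_map Omega Gamma0 rho xi.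
Local Notation Lambda := (limit_set Omega Gamma0).

(** Convergence along moving points, obtained from the pointwise hypothesis on flags:
    [attracting_minors] identifies the flag of [w] with that of [x], and [xi] is injective. *)
Lemma limit_attract (b : P) (s : nat -> PGL R m) (x y : P) (z : nat -> P) (z0 w : P) :
  Omega b -> (forall n, Gamma0 (s n)) -> Lambda x -> Lambda y ->
  (fun n => proj_act (s n) b) @ \oo --> x ->
  (fun n => proj_act (s n)^-1%g b) @ \oo --> y ->
  (forall n, Lambda (z n)) -> Lambda z0 -> z @ \oo --> z0 -> z0 != y ->
  (forall n, Lambda (proj_act (s n) (z n))) -> Lambda w ->
  (fun n => proj_act (s n) (z n)) @ \oo --> w -> w = x.
Proof.
move=> Ob Gs Lx Ly sx sy Lz Lz0 zz0 z0y Lsz Lw szw.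
have [kx kxE] := flag_frame (xi x); have [hy hyE] := flag_frame (xi y).
have [hw hwE] := flag_frame (xi w).
have gw : (fun n => flag_act (rho (s n)) (xi (z n))) @ \oo --> frame_flag theta hw.
  rewrite -hwE; have := xi_cvg trans Lsz Lw szw.
  have [_ eqv _ _] := trans.
  by rewrite (_ : (fun n => xi (proj_act (s n) (z n))) = (fun n => flag_act (rho (s n)) (xi (z n))))//;
    apply/funext => n; rewrite eqv.
have [[_ inj _] _ _ _] := trans.
apply: inj; rewrite ?in_setE// hwE kxE; apply: eq_frame_flag => j.
exact: (attracting_minors sym visible rep trans Gs Ob Lx Ly sx sy kxE hyE j Lz Lz0 zz0 z0y gw).
Qed.

End Attraction.

(** * Exclusion of a global fixed point *)

Section NoGlobalFixedPoint.
Context (R : realType) (m : nat).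
Local Notation P := (projective_space R m).
Context (Omega : set P) (f : 'rV[R]_m).
Hypothesis Omega_open : open Omega.
Hypothesis chart : convex_bounded_chart Omega f.
Context (v0 : 'cV[R]_m).
Hypothesis Cv0 : cone Omega f v0.
Context (Gamma0 : set (PGL R m)).
Hypothesis disc : discrete_subgroup Gamma0.
Hypothesis autG : Gamma0 `<=` automorphisms Omega.
Local Notation Lambda := (limit_set Omega Gamma0).
Hypothesis visible : forall x y, Lambda x -> Lambda y -> x != y ->
  open_segment Omega x y `<=` Omega.
Context (o : P).
Hypothesis Oo : Omega o.

Definition converges (s : nat -> PGL R m) (x y : P) : Prop :=
  [/\ Lambda x, Lambda y, (fun n => proj_act (s n) o) @ \oo --> x &
      (fun n => proj_act (s n)^-1%g o) @ \oo --> y].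

(** The convergence property of the action on the limit set, the only trace of the representation in
    this section; [limit_attract] provides it. *)
Hypothesis attract : forall (s : nat -> PGL R m) (x y : P) (z : nat -> P) (z0 w : P),
  (forall n, Gamma0 (s n)) -> converges s x y ->
  (forall n, Lambda (z n)) -> Lambda z0 -> z @ \oo --> z0 -> z0 != y ->
  (forall n, Lambda (proj_act (s n) (z n))) -> Lambda w ->
  (fun n => proj_act (s n) (z n)) @ \oo --> w -> w = x.

Lemma converges_subseq s x y h : increasing_seq h -> converges s x y ->
  converges (s \o h) x y.
Proof.
by move=> hi [Lx Ly sx sy]; split=> //; [exact: (subseq_cvg hi sx)|exact: (subseq_cvg hi sy)].
Qed.

Lemma converges_inv s x y : converges s x y -> converges (fun n => (s n)^-1%g) y x.
Proof.
move=> [Lx Ly sx sy]; split=> //.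
by rewrite (_ : (fun n => _) = (fun n => proj_act (s n) o))//; apply/funext => n; rewrite invgK.
Qed.

Lemma limit_set_act_inv g x : Gamma0 g -> Lambda x -> Lambda (proj_act g^-1%g x).
Proof. by move=> /(GammaV disc) Gg; exact: (limit_set_act Omega_open chart Cv0). Qed.

Lemma limit_bolzano (t : nat -> P) : (forall n, Lambda (t n)) ->
  exists2 h : nat -> nat, increasing_seq h &
    exists2 x : P, Lambda x & (t \o h) @ \oo --> x.
Proof.
move=> Lt; have ct n : closure Omega (t n) by have [[]] := Lt n.
have [h hi [x _ tx]] := closure_bolzano Omega_open chart Cv0 ct.
exists h => //; exists x => //.
by apply: (limit_set_closed Omega_open chart Cv0 autG visible _ tx) => n; exact: Lt.
Qed.

Lemma attract_subseq s x y (z : nat -> P) z0 : (forall n, Gamma0 (s n)) ->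
  converges s x y -> (forall n, Lambda (z n)) -> Lambda z0 -> z @ \oo --> z0 -> z0 != y ->
  exists2 h : nat -> nat, increasing_seq h & (fun n => proj_act (s (h n)) (z (h n))) @ \oo --> x.
Proof.
move=> Gs sxy Lz Lz0 zz0 z0y.
have Lsz n : Lambda (proj_act (s n) (z n)) by exact: (limit_set_act Omega_open chart Cv0).
have [h hi [w Lw szw]] := limit_bolzano Lsz; exists h => //.
suff <- : w = x by [].
apply: (@attract (s \o h) x y (z \o h) z0 w) => // [n||n||n].
- exact: Gs.
- exact: converges_subseq.
- exact: Lz.
- exact: (subseq_cvg hi zz0).
- exact: Lsz.
Qed.

Lemma attract_point s x y z : (forall n, Gamma0 (s n)) ->
  converges s x y -> Lambda z -> z != y ->
  exists2 h : nat -> nat, increasing_seq h & (fun n => proj_act (s (h n)) z) @ \oo --> x.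
Proof.
move=> Gs sxy Lz zy.
exact: (@attract_subseq s x y (fun=> z) z Gs sxy (fun=> Lz) Lz (cvg_cst z) zy).
Qed.

Lemma cst_cvg_eq (x y : P) : (fun=> x : P) @ \oo --> y -> x = y.
Proof.
by move=> H; apply: (proj_cvg_unique _ H); exact: cvg_cst.
Qed.

Lemma attract_fixed s x y z : (forall n, Gamma0 (s n)) ->
  converges s x y -> Lambda z -> (forall n, proj_act (s n) z = z) -> z != y -> z = x.
Proof.
move=> Gs sxy Lz sz zy; have [h _] := attract_point Gs sxy Lz zy.
rewrite (_ : (fun n => _) = fun=> z); first exact: cst_cvg_eq.
by apply/funext.
Qed.

Lemma frequently_cst_cvg (t : nat -> P) (c w : P) : t @ \oo --> w ->
  (forall N, exists2 n, (N <= n)%N & t n = c) -> c = w.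
Proof.
move=> tw tc; have [h hP] := choice (fun N => (exists2P _ _).1 (tc N)).
apply: cst_cvg_eq => V /tw[N _ NV]; exists N => // n /= Nn.
by have [nh <-] := hP n; apply: NV => /=; exact: leq_trans nh.
Qed.

Lemma proj_actK (g : PGL R m) x : proj_act g^-1%g (proj_act g x) = x.
Proof. by rewrite -proj_actM mulVg proj_act1. Qed.

Lemma proj_act_inj (g : PGL R m) : injective (proj_act g).
Proof. exact: can_inj (proj_actK g). Qed.

(* An orbit accumulating at a point of the limit set has an inverse orbit that
   also accumulates only at the limit set, since the action is proper. *)
Lemma exists_converges x : Lambda x ->
  exists (s : nat -> PGL R m) (y : P), (forall n, Gamma0 (s n)) /\ converges s x y.
Proof.
move=> Lx; have [s Gs sx] := limit_set_orbit Omega_open chart Cv0 autG visible Lx Oo.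
have [[l lP]|[h hi [x' [y [Lx' Ly sx' sy]]]]] := escape Omega_open chart Cv0 disc autG Oo Gs.
  have lx : proj_act l o = x.
    by apply: (frequently_cst_cvg sx) => N; have [n Nn <-] := lP N; exists n.
  exfalso; apply: (boundary_not_Omega Omega_open Lx.1); rewrite -lx.
  by have [n _ <-] := lP 0%N; exact: (orbit_Omega autG).
exists (s \o h), y; split=> [n|]; first exact: Gs.
split=> //.
exact: (subseq_cvg hi sx).
Qed.

Hypothesis infinite : infinite_set Lambda.
Context (y : P).
Hypothesis Ly : Lambda y.
Hypothesis fixy : forall g, Gamma0 g -> proj_act g y = y.
Local Notation D := (chart_dist f).

Lemma limit_closure x : Lambda x -> closure Omega x.
Proof. by move=> [[]]. Qed.

Lemma third_point a b : exists x, [/\ Lambda x, x != a & x != b].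
Proof.
apply: contrapT => /forallNP no; apply: infinite.
apply: (@sub_finite_set _ _ [set a; b]); last exact: finite_set2.
move=> x Lx /=; apply: contrapT => /not_orP[/eqP xa /eqP xb].
by apply: (no x).
Qed.

Lemma chart_dist0 x : D x x = 0.
Proof. by rewrite /chart_dist big1// => i _; rewrite subrr normr0. Qed.

(** A sequence tending to [x1] must repel from the fixed point [y], so its inverses push the
    complement of a ball around [x1] towards [y]; one of them is [g]. The point [x2] lies outside
    both balls, and its orbit is followed later. *)
Lemma contracting_element : exists (x1 x2 : P) (e : R) (g : PGL R m),
  [/\ [/\ Lambda x1, Lambda x2, Gamma0 g & 0 < e],
      [/\ 2 * e < D y x1, e < D x2 y & e < D x2 x1] &
      forall z, Lambda z -> e <= D z x1 -> D (proj_act g z) y < e].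
Proof.
have [x1 [Lx1 x1y _]] := third_point y y.
have [x2 [Lx2 x2y x21]] := third_point y x1.
have a0 : 0 < D y x1.
  apply: (chart_dist_gt0 Omega_open chart Cv0 (limit_closure Ly) (limit_closure Lx1)).
  by rewrite eq_sym.
have b0 : 0 < D x2 y.
  exact: (chart_dist_gt0 Omega_open chart Cv0 (limit_closure Lx2) (limit_closure Ly) x2y).
have c0 : 0 < D x2 x1.
  exact: (chart_dist_gt0 Omega_open chart Cv0 (limit_closure Lx2) (limit_closure Lx1) x21).
have [e [e0 ea eb ec]] : exists e : R, [/\ 0 < e, 2 * e < D y x1, e < D x2 y & e < D x2 x1].
  move: (D y x1) (D x2 y) (D x2 x1) a0 b0 c0 => a b c a0 b0 c0.
  pose mn := Num.min a (Num.min b c).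
  have m0 : 0 < mn by rewrite !lt_min a0 b0 c0.
  have ma : mn <= a by rewrite ge_min lexx.
  have mb : mn <= b by rewrite !ge_min lexx orbT.
  have mc : mn <= c by rewrite !ge_min lexx !orbT.
  exists (mn / 3); split; lra.
have [s [y' [Gs sxy]]] := exists_converges Lx1.
(* A fixed point other than the repelling one is the attracting one, but [x1] differs from [y]. *)
have yy' : y' = y.
  apply/eqP/contraT; rewrite eq_sym => ny.
  have := attract_fixed Gs sxy Ly (fun n => fixy (Gs n)) ny.
  by move=> E; rewrite E eqxx in x1y.
rewrite yy' in sxy; have sI := converges_inv sxy.
have GsV n : Gamma0 (s n)^-1%g by exact: GammaV.
suff [n nP] : exists n, forall z, Lambda z -> e <= D z x1 -> D (proj_act (s n)^-1%g z) y < e.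
  by exists x1, x2, e, (s n)^-1%g; split.
apply: contrapT => /forallNP no.
have {}no n : exists z, [/\ Lambda z, e <= D z x1 & e <= D (proj_act (s n)^-1%g z) y].
  apply: contrapT => /forallNP no'; apply: (no n) => z Lz ez.
  by rewrite ltNge; apply/negP => ez'; apply: (no' z).
have [z zP] := choice no.
have Lz n : Lambda (z n) by have [] := zP n.
have [h hi [z0 Lz0 zz0]] := limit_bolzano Lz.
have ez0 : e <= D z0 x1.
  apply: (chart_dist_ge Omega_open chart Cv0 _ (limit_closure Lz0) zz0) => n /=.
    exact/limit_closure/Lz.
  by have [] := zP (h n).
have z01 : z0 != x1 by apply/negP => /eqP E; rewrite E chart_dist0 leNgt e0 in ez0.
have [k ki sz] := @attract_subseq (fun n => (s (h n))^-1%g) y x1 (z \o h) z0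
  (fun n => GsV (h n)) (converges_subseq hi sI) (fun n => Lz (h n)) Lz0 zz0 z01.
have : e <= D y y.
  apply: (chart_dist_ge Omega_open chart Cv0 _ (limit_closure Ly) sz) => n /=.
    by apply: limit_closure; apply: limit_set_act_inv => //; exact: Lz.
  by have [] := zP (h (k n)).
by rewrite chart_dist0 leNgt e0.
Qed.

Section Powers.
Context (x1 x2 : P) (e : R) (g : PGL R m).
Hypothesis Lx1 : Lambda x1.
Hypothesis Lx2 : Lambda x2.
Hypothesis Gg : Gamma0 g.
Hypothesis e0 : 0 < e.
Hypothesis far : 2 * e < D y x1.
Hypothesis x2y_far : e < D x2 y.
Hypothesis x2x1_far : e < D x2 x1.
Hypothesis contracting : forall z, Lambda z -> e <= D z x1 -> D (proj_act g z) y < e.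

Lemma Gamma_pow n : Gamma0 (g ^+ n)%g.
Proof.
elim: n => [|n IH]; first by rewrite expg0; exact: Gamma1.
by rewrite expgS; exact: GammaM.
Qed.

Lemma Gamma_powV n : Gamma0 (g ^- n)%g.
Proof. exact/(GammaV disc)/Gamma_pow. Qed.

Lemma limit_pow n z : Lambda z -> Lambda (proj_act (g ^+ n)%g z).
Proof. exact: (limit_set_act Omega_open chart Cv0 disc autG (Gamma_pow n)). Qed.

Lemma limit_powV n z : Lambda z -> Lambda (proj_act (g ^- n)%g z).
Proof. exact: (limit_set_act Omega_open chart Cv0 disc autG (Gamma_powV n)). Qed.

Lemma near_y_far z : D z y < e -> e <= D z x1.
Proof.
move=> zy; rewrite leNgt; apply/negP => zx1.
have := chart_dist_triangle f z y x1; rewrite chart_distC in zy.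
by move=> H; have := lt_le_trans far H; rewrite ltNge => /negP; apply; lra.
Qed.

Lemma pow_contracting n z : Lambda z -> e <= D z x1 -> D (proj_act (g ^+ n.+1)%g z) y < e.
Proof.
elim: n z => [|n IH] z Lz ez; first by rewrite expg1; exact: contracting.
rewrite expgSr proj_actM; apply: IH.
  exact: (limit_set_act Omega_open chart Cv0).
exact/near_y_far/contracting.
Qed.

Lemma powV_near n : D (proj_act (g ^- n.+1)%g x2) x1 < e.
Proof.
rewrite ltNge; apply/negP => H.
have := pow_contracting n (limit_powV n.+1 Lx2) H.
by rewrite -proj_actM mulgV proj_act1 ltNge (ltW x2y_far).
Qed.

Lemma powV_far n : e <= D (proj_act (g ^- n)%g x2) y.
Proof.
rewrite leNgt; apply/negP; case: n => [|n] H.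
  by move: H; rewrite expg0 invg1 proj_act1 ltNge (ltW x2y_far).
by have := near_y_far H; rewrite leNgt powV_near.
Qed.

(** A positive power moves [x2] into the ball around [y], so it is not the identity. *)
Lemma pow_inj a b : (g ^- a)%g = (g ^- b)%g -> a = b.
Proof.
wlog ab : a b / (a < b)%N.
  move=> W E; case: (ltngtP a b) => // ab; first exact: W.
  by apply/esym/W.
move=> E; have := pow_contracting (b - a).-1 Lx2 (ltW x2x1_far).
rewrite prednK ?subn_gt0//.
have -> : (g ^+ (b - a))%g = 1%g.
  apply: (@mulIg _ (g ^+ a)%g); rewrite -expgD subnK 1?ltnW// mul1g.
  by apply: invg_inj; rewrite E.
by rewrite proj_act1 ltNge (ltW x2y_far).
Qed.

(** The negative powers are pairwise distinct, hence escape, and [b] is their attracting point. As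
    [g] commutes with its powers, the limit of the images of [g x2] is both [b] and [g b]. *)
Lemma repelling_point : exists b, [/\ Lambda b, D b x1 <= e, proj_act g b = b &
  exists2 h : nat -> nat, increasing_seq h & converges (fun n => (g ^- (h n).+1)%g) b y].
Proof.
have Gs n : Gamma0 (g ^- n.+1)%g by exact: Gamma_powV.
have [[l lP]|[h hi [b [y' [Lb Ly' sb sy']]]]] := escape Omega_open chart Cv0 disc autG Oo Gs.
  have [n1 _ E1] := lP 0%N; have [n2 n12 E2] := lP n1.+1.
  have := @pow_inj n1.+1 n2.+1; rewrite E1 E2 => /(_ erefl)[E].
  by move: n12; rewrite E ltnn.
have sby : converges (fun n => (g ^- (h n).+1)%g) b y' by [].
have Gsh n : Gamma0 (g ^- (h n).+1)%g by exact: Gs.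
have Db : D b x1 <= e.
  (* If [x2] were the repelling point, the fixed point [y] would have to be [b]; then positive
     powers would move [x2] towards [x2] itself, although they keep it within [e] of [y]. *)
  have [x2y'|x2y'] := eqVneq x2 y'; last first.
    have [k ki sk] := attract_point Gsh sby Lx2 x2y'.
    apply: (chart_dist_le Omega_open chart Cv0 _ (limit_closure Lb) sk) => n.
      exact/limit_closure/limit_powV.
    exact: powV_near.
  exfalso; have yx2 : y != x2.
    by apply: contraTneq x2y_far => <-; rewrite chart_dist0 -leNgt ltW.
  have yb : y = b.
    apply: (attract_fixed Gsh sby Ly (fun n => fixy (Gsh n))).
    by rewrite -x2y'.
  have GshV n : Gamma0 ((g ^- (h n).+1)^-1)%g by exact: (GammaV disc).
  have x2b : x2 != b by rewrite -yb eq_sym.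
  have [k ki sk] := attract_point GshV (converges_inv sby) Lx2 x2b.
  rewrite -x2y' in sk.
  have : D x2 y <= e.
    apply: (chart_dist_le Omega_open chart Cv0 _ (limit_closure Lx2) sk) => n.
      by apply: limit_closure; rewrite invgK; exact: limit_pow.
    by rewrite invgK; apply: pow_contracting => //; exact: ltW.
  by rewrite leNgt x2y_far.
have by_ : y != b.
  apply/negP => /eqP yb; rewrite -yb in Db; have := lt_le_trans far Db.
  by rewrite gtr_pMl// gtrDl ltr10.
have y'y : y' = y.
  apply/eqP/contraT; rewrite eq_sym => yy'.
  have := attract_fixed Gsh sby Ly (fun n => fixy (Gsh n)) yy'.
  by move=> E; rewrite E eqxx in by_.
rewrite y'y in sby; exists b; split=> //; last by exists h.
have x2y : x2 != y.
  by apply: contraTneq x2y_far => ->; rewrite chart_dist0 -leNgt ltW.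
have [k ki sk] := attract_point Gsh sby Lx2 x2y.
have gx2y : proj_act g x2 != y.
  by rewrite -(fixy Gg) (inj_eq (@proj_act_inj g)).
have Gshk n : Gamma0 (g ^- (h (k n)).+1)%g by exact: Gs.
have Lgx2 : Lambda (proj_act g x2) by exact: (limit_set_act Omega_open chart Cv0).
have [l li sl] := @attract_point _ _ _ _ Gshk (converges_subseq ki sby) Lgx2 gx2y.
apply: (proj_cvg_unique _ sl).
have gsk := subseq_cvg li sk.
have := proj_act_cvg (g := g) gsk.
rewrite (_ : (fun n => proj_act g _) = (fun n => proj_act (g ^- (h (k (l n))).+1)%g (proj_act g x2)))//.
apply/funext => n /=; rewrite -!proj_actM; congr (proj_act _ _).
by apply: commuteV; exact: commuteX.
Qed.

(** Elements tending to [x2] repel from a single point, and a fixed point that is not the repelling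
    one equals [x2]; so they cannot all fix both [y] and [b]. *)
Lemma moved_point b : Lambda b -> b != x2 -> b != y ->
  exists2 h, Gamma0 h & proj_act h b != b.
Proof.
move=> Lb bx2 nby; apply: contrapT => no.
have fixb h : Gamma0 h -> proj_act h b = b.
  by move=> Gh; apply/eqP/contraT => hb; exfalso; apply: no; exists h.
have [s [y' [Gs sxy]]] := exists_converges Lx2.
have [E|y'b] := eqVneq b y'.
  have yx2 : y = x2.
    by apply: (attract_fixed Gs sxy Ly (fun n => fixy (Gs n))); rewrite -E eq_sym.
  by move: x2y_far; rewrite yx2 chart_dist0 ltNge (ltW e0).
have := attract_fixed Gs sxy Lb (fun n => fixb _ (Gs n)) y'b.
by move=> E; rewrite E eqxx in bx2.
Qed.

Lemma global_fixed_point_absurd : False.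
Proof.
have [b [Lb Db gb [h hi sby]]] := repelling_point.
have Gsh n : Gamma0 (g ^- (h n).+1)%g by exact: Gamma_powV.
have nby : b != y.
  apply/negP => /eqP yb; rewrite yb in Db; have := lt_le_trans far Db.
  by rewrite gtr_pMl// gtrDl ltr10.
have bx2 : b != x2.
  by apply: contraTneq x2x1_far => <-; rewrite -leNgt.
have x2y : x2 != y.
  by apply: contraTneq x2y_far => ->; rewrite chart_dist0 -leNgt ltW.
have Dby : ~ D b y <= e.
  move=> H; have := chart_dist_triangle f b y x1; rewrite [D y b]chart_distC => H2.
  by have := lt_le_trans far (le_trans H2 (lerD H Db)); rewrite mulr_natl mulr2n ltxx.
have powb n : proj_act (g ^+ n)%g b = b.
  by elim: n => [|n IH]; rewrite ?expg0 ?proj_act1// expgS proj_actM IH.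
have powVb n : proj_act (g ^- n)%g b = b by rewrite -{1}(powb n) proj_actK.
have [h0 Gh0 h0b] := moved_point Lb bx2 nby.
have GshV n : Gamma0 ((g ^- (h n).+1)^-1)%g by exact: (GammaV disc).
have [k1 ki1 x2lim] := attract_point GshV (converges_inv sby) Lx2 (etrans (congr1 negb (eq_sym _ _)) bx2).
(* Positive powers attract [x2] to [y], and [h0] fixes [y]; hence the points [q n] below approach
   [y]. *)
have limq : (fun n => proj_act h0 (proj_act (g ^+ (h (k1 n)).+1)%g x2)) @ \oo --> y.
  rewrite -(fixy Gh0); apply: proj_act_cvg; move: x2lim.
  by rewrite (_ : (fun n => _) = (fun n => proj_act (g ^+ (h (k1 n)).+1)%g x2))//;
    apply/funext => n; rewrite invgK.
have near_seq (t : nat -> P) : (forall n, Lambda (t n)) -> t @ \oo --> y ->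
    exists N, forall n, (N <= n)%N -> D (t n) y < e.
  move=> Lt ty.
  have H : (fun n => D (t n) y) @ \oo --> D y y.
    apply: (chart_dist_cvg Omega_open chart Cv0) => // [n|]; last exact: limit_closure.
    exact/limit_closure/Lt.
  rewrite chart_dist0 in H; have /cvgrPdist_lt/(_ e e0)[N _ NP] := H.
  exists N => n /NP /=; rewrite sub0r normrN ger0_norm//; exact: chart_dist_ge0.
have Lq' n : Lambda (proj_act h0 (proj_act (g ^+ (h (k1 n)).+1)%g x2)).
  by apply: (limit_set_act Omega_open chart Cv0 disc autG Gh0); exact: limit_pow.
have [N0 N0P] := near_seq _ Lq' limq.
pose M n := (h (k1 (n + N0)%N)).+1.
pose q n := proj_act h0 (proj_act (g ^+ M n)%g x2).
have incN : increasing_seq (fun n => (n + N0)%N) by move=> i j; rewrite !leEnat leq_add2r.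
have qy : q @ \oo --> y by exact: (subseq_cvg incN limq).
have Lq n : Lambda (q n) by exact: Lq'.
have q_near n : D (q n) y < e by apply: N0P; exact: leq_addl.
have q_neq n : q n != y.
  rewrite -(fixy Gh0) (inj_eq (@proj_act_inj h0)) -(fixy (Gamma_pow (M n))).
  by rewrite (inj_eq (@proj_act_inj _)).
(* Negative powers move each [q n] towards [b], which is farther than [e] from [y], so they leave
   the ball. *)
have exI n : exists i, e <= D (proj_act (g ^- i)%g (q n)) y.
  apply: contrapT => /forallNP no.
  have [k ki sk] := attract_point Gsh sby (Lq n) (q_neq n).
  apply: Dby; apply: (chart_dist_le Omega_open chart Cv0 _ (limit_closure Lb) sk) => l.
    exact/limit_closure/limit_powV.
  by rewrite ltNge; apply/negP; exact: no.
pose I n := ex_minn (exI n).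
have IP n : e <= D (proj_act (g ^- I n)%g (q n)) y by rewrite /I; case: ex_minnP.
have Imin n i : (i < I n)%N -> D (proj_act (g ^- i)%g (q n)) y < e.
  rewrite /I; case: ex_minnP => i0 _ i0min ii0; rewrite ltNge; apply/negP => /i0min.
  by rewrite leqNgt ii0.
have I0 n : (0 < I n)%N.
  rewrite lt0n; apply/eqP => I0; have := IP n.
  by rewrite I0 expg0 invg1 proj_act1 leNgt q_near.
(* As [q n] tends to the fixed point [y], it takes longer and longer to leave the ball. *)
have Igrow J : exists N, forall n, (N <= n)%N -> (J < I n)%N.
  have ev i : exists N, forall n, (N <= n)%N -> D (proj_act (g ^- i)%g (q n)) y < e.
    apply: near_seq => [n|]; first exact: limit_powV.
    by rewrite -(fixy (Gamma_powV i)); exact: proj_act_cvg.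
  elim: J => [|J [N NP]]; first by exists 0%N => n _; exact: I0.
  have [N' N'P] := ev J.+1; exists (maxn N N') => n; rewrite geq_max => /andP[Nn N'n].
  rewrite ltn_neqAle NP// andbT; apply/eqP => E.
  by have := IP n; rewrite -E leNgt N'P.
pose s2 n := (g ^- I n)%g.
have Gs2 n : Gamma0 (s2 n) by exact: Gamma_powV.
have [[l lP]|[h2 hi2 [x' [y' [Lx' Ly' sx' sy']]]]] := escape Omega_open chart Cv0 disc autG Oo Gs2.
  have [n1 _ E1] := lP 0%N; have [N NP] := Igrow (I n1); have [n2 n12 E2] := lP N.
  have E := @pow_inj (I n1) (I n2) (etrans E1 (esym E2)).
  by have := NP n2 n12; rewrite E ltnn.
have Gs2h n : Gamma0 (s2 (h2 n)) by exact: Gs2.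
have s2xy : converges (fun n => s2 (h2 n)) x' y' by [].
(* Otherwise [y] is attracting and [b] repelling for these negative powers, and [x2] would be
   brought to [y], against [powV_far]. *)
have y'y : y' = y.
  apply/eqP/contraT; rewrite eq_sym => yy'.
  have yx' := attract_fixed Gs2h s2xy Ly (fun n => fixy (Gs2h n)) yy'.
  have by' : b = y'.
    apply/eqP/contraT => by'; move: nby.
    by rewrite (attract_fixed Gs2h s2xy Lb (fun n => powVb _) by') yx' eqxx.
  have x2y' : x2 != y' by rewrite -by' eq_sym.
  have [k ki sk] := attract_point Gs2h s2xy Lx2 x2y'.
  rewrite -yx' in sk.
  have : e <= D y y.
    apply: (chart_dist_ge Omega_open chart Cv0 _ (limit_closure Ly) sk) => n.
      exact/limit_closure/limit_powV.
    exact: powV_far.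
  by rewrite chart_dist0 leNgt e0.
rewrite y'y in s2xy.
have bx' : b = x' by exact: (attract_fixed Gs2h s2xy Lb (fun n => powVb _) nby).
rewrite -bx' in s2xy.
have Lh0b : Lambda (proj_act h0 b) by exact: (limit_set_act Omega_open chart Cv0).
have h0by : proj_act h0 b != y by rewrite -(fixy Gh0) (inj_eq (@proj_act_inj h0)).
have [k3 ki3 sh0b] := attract_point Gs2h s2xy Lh0b h0by.
pose p n := proj_act (s2 (h2 (k3 n))) (q (h2 (k3 n))).
have Lp n : Lambda (p n) by exact: limit_powV.
have [k4 ki4 [p0 Lp0 pp0]] := limit_bolzano Lp.
pose r n := h2 (k3 (k4 n)).
(* These elements fix [y], bring [b] to [b] and [x2] to [p0] in the limit. Three distinct limits are
   impossible, since all points but one are attracted to the same point. *)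
pose F n := (s2 (r n) * (h0 * g ^+ M (r n)))%g.
have GF n : Gamma0 (F n).
  by apply: (GammaM disc); [exact: Gs2|apply: (GammaM disc); [|exact: Gamma_pow]].
have Fx2 n : proj_act (F n) x2 = p (k4 n) by rewrite !proj_actM.
have Fb n : proj_act (F n) b = proj_act (s2 (r n)) (proj_act h0 b).
  by rewrite !proj_actM powb.
have Fblim : (fun n => proj_act (F n) b) @ \oo --> b.
  have := subseq_cvg ki4 sh0b.
  by rewrite (_ : _ \o k4 = (fun n => proj_act (F n) b))//; apply/funext => n; rewrite Fb.
have Fx2lim : (fun n => proj_act (F n) x2) @ \oo --> p0.
  by move: pp0; rewrite (_ : p \o k4 = (fun n => proj_act (F n) x2))//; apply/funext => n; rewrite Fx2.
have p0y : p0 != y.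
  apply/negP => /eqP E; have : e <= D p0 y.
    apply: (chart_dist_ge Omega_open chart Cv0 _ (limit_closure Lp0) pp0) => n.
      exact/limit_closure/Lp.
    exact: IP.
  by rewrite E chart_dist0 leNgt e0.
(* One step before the exit the point was still within [e] of [y]; if [p0] were [b], the limit would
   place [g b = b] within [e] of [y]. *)
have p0b : p0 != b.
  apply/negP => /eqP E; apply: Dby; rewrite -gb -E.
  have Lgp n : Lambda (proj_act g (p n)) by exact: (limit_set_act Omega_open chart Cv0).
  have Lgp0 : Lambda (proj_act g p0) by exact: (limit_set_act Omega_open chart Cv0).
  apply: (chart_dist_le Omega_open chart Cv0 _ (limit_closure Lgp0) (proj_act_cvg (g := g) pp0)) => n.
    exact/limit_closure/Lgp.
  have := Imin (r n) (I (r n)).-1; rewrite prednK// leqnn => /(_ isT).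
  congr (D _ y < e); rewrite /= /p -proj_actM; congr (proj_act _ _).
  rewrite /s2 -/(r n) -{2}(prednK (I0 (r n))) expgSr invMg mulgA mulgV mul1g.
  by [].
have [[l lP]|[k5 ki5 [u [v [Lu Lv Fu Fv]]]]] := escape Omega_open chart Cv0 disc autG Oo GF.
  (* A recurring element would fix [b]; as the powers of [g] fix [b], so would [h0]. *)
  have lb : proj_act l b = b.
    by apply: (frequently_cst_cvg Fblim) => N; have [n Nn <-] := lP N; exists n.
  have [n _ E] := lP 0%N; move: lb; rewrite -E Fb -{2}(powVb (I (r n))).
  by move=> /proj_act_inj /eqP; rewrite (negbTE h0b).
have GF5 n : Gamma0 (F (k5 n)) by exact: GF.
have Fuv : converges (fun n => F (k5 n)) u v by [].
have yu : y != v -> y = u.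
  by apply: (attract_fixed GF5 Fuv Ly) => n; apply: fixy.
have lim_u z w : Lambda z -> Lambda w -> (fun n => proj_act (F n) z) @ \oo --> w -> z != v -> w = u.
  move=> Lz Lw zw zv.
  apply: (@attract (fun n => F (k5 n)) u v (fun=> z) z w) => //.
  - exact: cvg_cst.
  - by move=> n; apply: (limit_set_act Omega_open chart Cv0 disc autG).
  - exact: (subseq_cvg ki5 zw).
have bu := lim_u b b Lb Lb Fblim; have pu := lim_u x2 p0 Lx2 Lp0 Fx2lim.
have [yv|/yu yu'] := eqVneq y v.
  have bu' : b = u by apply: bu; rewrite -yv.
  have pu' : p0 = u by apply: pu; rewrite -yv.
  by rewrite pu' bu' eqxx in p0b.
have [bv|/bu bu'] := eqVneq b v.
  have pu' : p0 = u by apply: pu; rewrite -bv eq_sym.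
  by rewrite pu' yu' eqxx in p0y.
by rewrite bu' yu' eqxx in nby.
Qed.

End Powers.

Lemma no_global_fixed_point : False.
Proof.
have [x1 [x2 [e [g [[Lx1 Lx2 Gg e0] [f1 f2 f3] c]]]]] := contracting_element.
exact: (@global_fixed_point_absurd x1 x2 e g).
Qed.

End NoGlobalFixedPoint.

(** * The mass of shadows *)

Section ShadowLimits.
Context (R : realType) (m : nat).
Local Notation P := (projective_space R m).
Context (Omega : set P) (f : 'rV[R]_m).
Hypothesis Omega_open : open Omega.
Hypothesis chart : convex_bounded_chart Omega f.
Context (v0 : 'cV[R]_m).
Hypothesis Cv0 : cone Omega f v0.
Local Notation C := (cone Omega f).
Local Notation CC := (ccone Omega f v0).
Local Notation cv := (chart_vec f).

Lemma boundary_closure (x : P) : boundary Omega x -> closure Omega x.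
Proof. by case. Qed.

Lemma chart_vec_boundary x : boundary Omega x -> ~ C (cv x).
Proof.
move=> bx; have [Cx xx _] := chart_vecP Omega_open chart Cv0 (boundary_closure bx).
exact: (boundary_ccone Omega_open bx xx Cx).
Qed.

Lemma chart_vec_cone x : Omega x -> C (cv x).
Proof.
move=> Ox; have [Cx xx _] := chart_vecP Omega_open chart Cv0 (subset_closure Ox).
exact: (ccone_cone chart Cx xx Ox).
Qed.

Lemma shadow_chartP r t b x : Omega t -> Omega b -> boundary Omega x ->
  shadow Omega r t b x <-> shadow_cone Omega f v0 r (cv t) (cv b) (cv x).
Proof.
move=> Ot Ob bx.
have [_ tt _] := chart_vecP Omega_open chart Cv0 (subset_closure Ot).
have [_ bb _] := chart_vecP Omega_open chart Cv0 (subset_closure Ob).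
have [Cx xx _] := chart_vecP Omega_open chart Cv0 (boundary_closure bx).
exact: (shadowP Omega_open chart Cv0 r (chart_vec_cone Ot) tt (chart_vec_cone Ob) bb Cx
  (chart_vec_boundary bx) xx).
Qed.

Lemma mx_cvg_lin (a c : nat -> R) (la lc : R) (u w : nat -> 'cV[R]_m) lu lw (z : 'cV[R]_m) :
  a @ \oo --> la -> c @ \oo --> lc -> mx_cvg u lu -> mx_cvg w lw ->
  mx_cvg (fun n => a n *: u n + c n *: w n + z) (la *: lu + lc *: lw + z).
Proof.
move=> al cl ul wl i j; rewrite !mxE.
rewrite (_ : (fun n => _) = fun n => a n * u n i j + c n * w n i j + z i j); last first.
  by apply/funext => n; rewrite !mxE.
apply: cvgD; last exact: cvg_cst.
by apply: cvgD; [exact: cvgM al (ul i j)|exact: cvgM cl (wl i j)].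
Qed.

(* If the shadows of [b] seen from [t n] had points converging to the limit of
   [t n], then [b] would be dominated by a boundary vector. *)
Lemma shadow_limit_neq r (t x : nat -> P) b y z : (forall n, Omega (t n)) -> Omega b ->
  (forall n, boundary Omega (x n)) -> boundary Omega y -> closure Omega z ->
  t @ \oo --> y -> x @ \oo --> z ->
  (forall n, shadow Omega r (t n) b (x n)) -> z != y.
Proof.
move=> Ot Ob bx by_ cz ty xz sh; apply/negP => /eqP zy; rewrite {z cz}zy in xz.
have cy := boundary_closure by_.
have tv := chart_vec_cvg Omega_open chart Cv0 (fun n => subset_closure (Ot n)) cy ty.
have xv := chart_vec_cvg Omega_open chart Cv0 (fun n => boundary_closure (bx n)) cy xz.
(* Evaluating the upper inequality by [f], which is 1 on all chart vectors, bounds the two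
   coefficients, so they converge along a subsequence. *)
have H n : exists ac : R * R, [/\ 0 <= ac.1, 0 <= ac.2, ac.1 + ac.2 <= expR r &
    CC (ac.1 *: cv (t n) + ac.2 *: cv (x n) - cv b)].
  have /(shadow_chartP _ (Ot n) Ob (bx n))[c [c' [l [c0 c'0 lr C1 C2]]]] := sh n.
  exists (c, c'); split=> //=; first exact: ltW.
  have := ccone_form_ge0 C2; rewrite formB formD !formZ.
  have [_ _ ->] := chart_vecP Omega_open chart Cv0 (subset_closure Ob).
  have [_ _ ->] := chart_vecP Omega_open chart Cv0 (subset_closure (Ot n)).
  have [_ _ ->] := chart_vecP Omega_open chart Cv0 (boundary_closure (bx n)).
  rewrite !mulr1 subr_ge0 => /le_trans; apply.
  by rewrite ler_expR ltW.
have [ac acP] := choice H.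
have b1 n : `|(ac n).1| <= expR r.
  by have [a0 c0 s _] := acP n; rewrite ger0_norm//; apply: le_trans s; rewrite lerDl.
have b2 n : `|(ac n).2| <= expR r.
  by have [a0 c0 s _] := acP n; rewrite ger0_norm//; apply: le_trans s; rewrite lerDr.
have [h hi [la al]] := real_bolzano b1.
have [k ki [lc cl]] := real_bolzano (fun n => b2 (h n)).
have al' := subseq_cvg ki al.
have hk := increasing_comp hi ki.
have la0 : 0 <= la.
  by apply: (cvgr_to_ge al'); apply: nearW => n; have [] := acP (h (k n)).
have lc0 : 0 <= lc.
  by apply: (cvgr_to_ge cl); apply: nearW => n; have [] := acP (h (k n)).
have lim := mx_cvg_lin (z := - cv b) al' cl (mx_cvg_subseq hk tv) (mx_cvg_subseq hk xv).
have Cl : CC (la *: cv y + lc *: cv y - cv b).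
  by apply: (ccone_limit Omega_open chart Cv0 lim) => n; have [] := acP (h (k n)).
have := ccone_addl Omega_open chart Cl (chart_vec_cone Ob).
rewrite subrK -scalerDl => Cs.
have s0 : 0 < la + lc.
  rewrite lt_def addr_ge0// andbT; apply/negP => /eqP s0; move: Cs; rewrite s0 scale0r.
  by case; rewrite form0 ltxx.
apply: (chart_vec_boundary by_).
have si : 0 < (la + lc)^-1 by rewrite invr_gt0.
by have := coneZ si Cs; rewrite scalerA mulVf ?gt_eqF// scale1r.
Qed.

Lemma cone_dominates_strict u w : C u -> C w -> exists2 M : R, 0 < M & C (M *: u - w).
Proof.
move=> Cu Cw; have [M M0 D] := cone_dominates Omega_open chart Cv0 w Cu.
exists (M + 1); first by rewrite addr_gt0.
have := ccone_addl Omega_open chart D Cu.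
rewrite (_ : _ + u = (M + 1) *: u - w)//.
by apply/matrixP => i j; rewrite !mxE; ring.
Qed.

Lemma mx_cvg_lin2 (a c : R) (u w : nat -> 'cV[R]_m) lu lw (z : 'cV[R]_m) :
  mx_cvg u lu -> mx_cvg w lw ->
  mx_cvg (fun n => a *: u n + c *: w n + z) (a *: lu + c *: lw + z).
Proof. by move=> ul wl; apply: mx_cvg_lin => //; exact: cvg_cst. Qed.

(* The midpoints of [t n] and [x n] stay in a compact part of the domain. *)
Lemma shadow_contains (t x : nat -> P) b y z : (forall n, Omega (t n)) -> Omega b ->
  (forall n, boundary Omega (x n)) -> closure Omega y -> closure Omega z ->
  t @ \oo --> y -> x @ \oo --> z -> C (cv y + cv z) ->
  exists L N, forall n, (N <= n)%N -> forall r, L < r -> shadow Omega r (t n) b (x n).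
Proof.
move=> Ot Ob bx cy cz ty xz Cyz.
have tv := chart_vec_cvg Omega_open chart Cv0 (fun n => subset_closure (Ot n)) cy ty.
have xv := chart_vec_cvg Omega_open chart Cv0 (fun n => boundary_closure (bx n)) cz xz.
have Cb := chart_vec_cone Ob.
(* Both coefficients are [M]. The inequalities are strict at the limit, so they persist for the
   nearby vectors, and the length [ln E] depends only on [b] and the limits. *)
have [M M0 C1] := cone_dominates_strict Cyz Cb.
have Cyz' : C (M *: (cv y + cv z)) by exact: coneZ.
have [E E0 C2] := cone_dominates_strict Cb Cyz'.
have lim1 := mx_cvg_lin2 (a := M) (c := M) (z := - cv b) tv xv.
have lim2 := mx_cvg_lin2 (a := - M) (c := - M) (z := E *: cv b) tv xv.
have [N1 N1P] : exists N, forall n, (N <= n)%N ->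
    C (M *: cv (t n) + M *: cv (x n) + - cv b).
  by apply: (cone_mx_cvg Omega_open _ lim1); rewrite -scalerDr.
have [N2 N2P] : exists N, forall n, (N <= n)%N ->
    C (- M *: cv (t n) + - M *: cv (x n) + E *: cv b).
  by apply: (cone_mx_cvg Omega_open _ lim2); rewrite -scalerDr addrC scaleNr.
exists (ln E), (maxn N1 N2) => n; rewrite geq_max => /andP[n1 n2] r Lr.
apply/shadow_chartP => //; exists M, M, (ln E); split=> //; first exact: ltW.
  by apply: (cone_ccone chart Cv0); exact: N1P.
rewrite lnK ?posrE//; apply: (cone_ccone chart Cv0); have := N2P n n2.
by congr C; apply/matrixP => i j; rewrite !mxE; ring.
Qed.

(** The strict [l < r] leaves slack: raising [l] makes the upper bound interior, then raising [c]
    makes the lower one interior. Interior conditions persist along the sequence. *)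
Lemma shadow_open r t b (x : nat -> P) z : Omega t -> Omega b ->
  (forall n, boundary Omega (x n)) -> boundary Omega z -> x @ \oo --> z ->
  shadow Omega r t b z -> exists2 n, True & shadow Omega r t b (x n).
Proof.
move=> Ot Ob bx bz xz /(shadow_chartP _ Ot Ob bz)[c [c' [l [c0 c'0 lr C1 C2]]]].
have xv := chart_vec_cvg Omega_open chart Cv0 (fun n => boundary_closure (bx n))
  (boundary_closure bz) xz.
pose l' := (l + r) / 2.
have ll' : l < l' by rewrite /l'; lra.
have l'r : l' < r by rewrite /l'; lra.
have D2 : C (expR l' *: cv b - (c *: cv t + c' *: cv z)).
  have el : 0 < expR l' - expR l by rewrite subr_gt0 ltr_expR.
  have := ccone_addl Omega_open chart C2 (coneZ el (chart_vec_cone Ob)).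
  by congr C; apply/matrixP => i j; rewrite !mxE; ring.
have [e e0 D2'] := cone_segment Omega_open (- cv t) D2.
have D1 : C ((c + e) *: cv t + c' *: cv z - cv b).
  have := ccone_addl Omega_open chart C1 (coneZ e0 (chart_vec_cone Ot)).
  by congr C; apply/matrixP => i j; rewrite !mxE; ring.
have lim1 := mx_cvg_lin2 (a := c + e) (c := c') (z := - cv b) (@mx_cvg_cst _ _ _ (cv t)) xv.
have lim2 := mx_cvg_lin2 (a := - (c + e)) (c := - c') (z := expR l' *: cv b) (@mx_cvg_cst _ _ _ (cv t)) xv.
have [N1 N1P] := cone_mx_cvg Omega_open D1 lim1.
have D2'' : C (- (c + e) *: cv t + - c' *: cv z + expR l' *: cv b).
  by move: D2'; congr C; apply/matrixP => i j; rewrite !mxE; ring.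
have [N2 N2P] := cone_mx_cvg Omega_open D2'' lim2.
exists (maxn N1 N2) => //; apply/shadow_chartP => //.
exists (c + e), c', l'; split=> //; first by rewrite addr_gt0.
  by apply: (cone_ccone chart Cv0); apply: N1P; exact: leq_maxl.
apply: (cone_ccone chart Cv0); have := N2P _ (leq_maxr N1 N2).
by congr C; apply/matrixP => i j; rewrite !mxE; ring.
Qed.

End ShadowLimits.

(** * Closed and measurable images in the flag manifold *)

Section FlagLimits.
Context (R : realType) (k : scalar_kind) (d : nat) (theta : {set 'I_d.-1}).
Local Notation K := (scalars R k).
Local Notation frame := (frame_flag theta).

Lemma flag_cvg_unique (t : nat -> flag K theta) (F G : flag K theta) :
  t @ \oo --> F -> t @ \oo --> G -> F = G.
Proof.
have [h ->] := flag_frame F; have [l ->] := flag_frame G.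
move=> /(flag_lift (@scalar_small R k))[u [ut uh]] /(flag_lift (@scalar_small R k))[w [wt wl]].
apply: eq_frame_flag => j.
have uw n : frame (u n) j = frame (w n) j by rewrite ut wt.
have ulim e : (fun n => minors (first_cols (val j) (u n)) e) @ \oo -->
    minors (first_cols (val j) h) e by apply: minors_cvg; exact: mx_cvg_sub.
have wlim e : (fun n => minors (first_cols (val j) (w n)) e) @ \oo -->
    minors (first_cols (val j) l) e by apply: minors_cvg; exact: mx_cvg_sub.
have cross e1 e2 : minors (first_cols (val j) h) e1 * minors (first_cols (val j) l) e2 =
    minors (first_cols (val j) h) e2 * minors (first_cols (val j) l) e1.
  apply: (cvg_mul_eq (ulim e1) (wlim e2) (ulim e2) (wlim e1)) => n.
  by have [c _ cE] := frame_flag_minors (uw n); rewrite !cE mulrAC.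
have [e0 m0] := minors_first_cols_neq0 (val j) (linear_group_unit l).
exists (minors (first_cols (val j) h) e0 / minors (first_cols (val j) l) e0) => e.
by apply: (mulIf m0); rewrite cross [RHS]mulrAC divfK.
Qed.

Lemma closed_borel_measurable (A : set (flag K theta)) : closed A ->
  measurable (A : set (borel_flag K theta)).
Proof.
move=> cA; rewrite -[A]setCK; apply: measurableC.
by apply: sub_sigma_algebra; exact: closed_openC.
Qed.

Context (m : nat).
Local Notation P := (projective_space R m).
Context (Omega : set P) (f : 'rV[R]_m).
Hypothesis Omega_open : open Omega.
Hypothesis chart : convex_bounded_chart Omega f.
Context (v0 : 'cV[R]_m).
Hypothesis Cv0 : cone Omega f v0.
Context (Gamma0 : set (PGL R m)).
Hypothesis visible : projectively_visible Omega Gamma0.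
Context (rho : PGL R m -> PSL K d) (xi : P -> flag K theta).
Hypothesis trans : transverse_with_limit_map Omega Gamma0 rho xi.
Local Notation Lambda := (limit_set Omega Gamma0).

(** Preimages of a convergent sequence accumulate in the compact limit set, and continuity of [xi]
    identifies the limit. *)
Lemma limit_image_closed (A : set P) : A `<=` Lambda ->
  (forall (x : nat -> P) z, (forall n, A (x n)) -> x @ \oo --> z -> Lambda z -> A z) ->
  closed (xi @` A).
Proof.
move=> AL Acl; apply: (flag_closedP (@scalar_small R k)) => u h uh uA.
have H n : exists x, A x /\ xi x = frame (u n) by have [x Ax <-] := uA n; exists x.
have [x xP] := choice H.
have Lx n : Lambda (x n) by apply: AL; have [] := xP n.
have [disc autG vis _] := visible.
have [s si [z Lz xz]] := limit_bolzano Omega_open chart Cv0 autG vis Lx.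
exists z; first by apply: (Acl (x \o s)) => // n; have [] := xP (s n).
apply: (@flag_cvg_unique (fun n => frame (u (s n)))).
  have := xi_cvg trans (fun n => Lx (s n)) Lz xz.
  rewrite (_ : (fun n => xi ((x \o s) n)) = (fun n => frame (u (s n))))//.
  by apply/funext => n; have [] := xP (s n).
exact: (frame_cvg (@scalar_small R k) (mx_cvg_subseq si uh)).
Qed.

Lemma limit_image_measurable (A : set P) : A `<=` Lambda ->
  (forall (x : nat -> P) z, (forall n, A (x n)) -> x @ \oo --> z -> Lambda z -> A z) ->
  measurable (xi @` A : set (borel_flag K theta)).
Proof. by move=> AL Acl; apply: closed_borel_measurable; exact: limit_image_closed. Qed.

(** The shadow is relatively open in the limit set and [xi] is injective, so the image is a
    difference of two closed sets. *)
Lemma shadow_image_measurable r t b : Omega t -> Omega b ->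
  measurable (xi @` (shadow Omega r t b `&` Lambda) : set (borel_flag K theta)).
Proof.
move=> Ot Ob; set S := shadow Omega r t b.
have [[_ inj _] _ _ _] := trans.
have -> : xi @` (S `&` Lambda) = xi @` Lambda `\` xi @` (Lambda `\` S).
  apply/seteqP; split=> [F [x [Sx Lx] <-]|F [[x Lx <-] H]].
    split; first by exists x.
    move=> [x' [Lx' nSx'] /inj]; rewrite !in_setE => /(_ Lx' Lx) E.
    by apply: nSx'; rewrite E.
  exists x => //; split=> //; apply: contrapT => nSx; apply: H; exists x => //.
apply: measurableD; first by apply: limit_image_measurable.
apply: limit_image_measurable; first by move=> x [].
move=> x z xP xz Lz; split=> // Sz.
have [n _ Sn] := shadow_open Omega_open chart Cv0 Ot Ob (fun n => (xP n).1.1) Lz.1 xz Sz.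
by have [_] := xP n.
Qed.

End FlagLimits.

(** * Comparison of the cocycle with the Cartan projection *)

Section CocycleBound.
Context (R : realType) (k : scalar_kind) (d : nat) (theta : {set 'I_d.-1}).
Local Notation K := (scalars R k).

Lemma minors_sum_mul n (A : 'M[K]_d) (V : 'M[K]_(d, n)) :
  minors_sum (A *m V) <= minors_norm n A * minors_sum V.
Proof.
rewrite /minors_sum /minors_norm mulr_suml; apply: ler_sum => e _.
rewrite minors_mul mulr_suml; apply: le_trans (abs_sum _ _ _) _.
apply: ler_sum => e' _; rewrite absM; apply: ler_wpM2l; first exact: abs_ge0.
by rewrite (bigD1 e') //= lerDl; apply: sumr_ge0 => l _; exact: abs_ge0.
Qed.

Lemma ln_two_sided (a b c e : R) : 0 < a -> 0 < b -> a <= c * b -> b <= e * a ->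
  `|ln (a / b)| <= `|ln c| + `|ln e|.
Proof.
move=> a0 b0 ac be.
have c0 : 0 < c by have := lt_le_trans a0 ac; rewrite pmulr_lgt0.
have e0 : 0 < e by have := lt_le_trans b0 be; rewrite pmulr_lgt0.
have {}ac : ln a <= ln c + ln b by rewrite -lnM ?posrE// ler_ln ?posrE ?mulr_gt0.
have {}be : ln b <= ln e + ln a by rewrite -lnM ?posrE// ler_ln ?posrE ?mulr_gt0.
have h1 := ler_norm (ln c); have h2 := ler_norm (ln e).
have h3 := normr_ge0 (ln c); have h4 := normr_ge0 (ln e).
by rewrite ln_div ?posrE// ler_norml; apply/andP; split; lra.
Qed.

Lemma ler_norm_near (x y C1 C2 : R) : `|x - y| <= C1 -> `|y| <= C2 -> `|x| <= C1 + C2.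
Proof. by move=> h1 h2; rewrite -[x](subrK y); apply: le_trans (ler_normD _ _) (lerD h1 h2). Qed.

(** Expansion by [A] is bounded above by the minors of [A] and below by those of its inverse. This
    settles the case of a recurring element. *)
Lemma cocycle_bounded (j : root_in theta) (g : PSL K d) : exists C : R,
  forall F : flag K theta, `|fundamental_weight (val j) (iwasawa_cocycle g F)| <= C.
Proof.
have [C1 C1P] := iwasawa_minors_sum R k j.
pose A := lift_mx g; have Au : A \in unitmx by exact: lift_mx_unit.
exists (C1 + (`|ln (minors_norm (val j).+1 A)| + `|ln (minors_norm (val j).+1 (invmx A))|)) => F.
have [h ->] := flag_frame F; have hu := linear_group_unit h.
apply: ler_norm_near (C1P g h) _; apply: ln_two_sided.
- rewrite mulmx_first_cols; apply: minors_sum_first_cols_gt0.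
  by rewrite unitmx_mul lift_mx_unit.
- exact: minors_sum_first_cols_gt0.
- exact: minors_sum_mul.
- rewrite -[leLHS](congr1 (@minors_sum _ _ _ _) (mulKmx Au (first_cols (val j) h))).
  exact: minors_sum_mul.
Qed.

Context (m : nat).
Local Notation P := (projective_space R m).
Hypothesis sym : symmetric_roots theta.
Context (Omega : set P) (f : 'rV[R]_m).
Hypothesis Omega_open : open Omega.
Hypothesis chart : convex_bounded_chart Omega f.
Context (v0 : 'cV[R]_m).
Hypothesis Cv0 : cone Omega f v0.
Context (Gamma0 : set (PGL R m)).
Hypothesis visible : projectively_visible Omega Gamma0.
Context (rho : PGL R m -> PSL K d) (xi : P -> flag K theta).
Hypothesis rep : representation Gamma0 rho.
Hypothesis trans : transverse_with_limit_map Omega Gamma0 rho xi.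
Local Notation Lambda := (limit_set Omega Gamma0).
Context (b : P).
Hypothesis Ob : Omega b.

Lemma unbounded_absurd (u : nat -> R) (C : R) : (forall n, n%:R < u n) ->
  ~ (forall N, exists2 n, (N <= n)%N & u n <= C).
Proof.
move=> nu H; have [n Nn unC] := H (Num.bound C).
have CM : C < (Num.bound C)%:R.
  by have [C0|C0] := leP 0 C; [exact: archi_boundP|exact: lt_le_trans C0 (ler0n _ _)].
have := lt_le_trans (nu n) unC; rewrite ltNge => /negP; apply.
by apply: ltW; apply: lt_le_trans CM _; rewrite ler_nat.
Qed.

Lemma shadow_weight_estimate (j : root_in theta) (r : R) : exists C : R,
  forall g x, Gamma0 g -> Lambda x -> shadow Omega r (proj_act g^-1%g b) b x ->
  `|fundamental_weight (val j) (iwasawa_cocycle (rho g) (xi x)) -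
    fundamental_weight (val j) (kappa (rho g))| <= C.
Proof.
apply: contrapT => /forallNP no.
have {}no (n : nat) : exists gx : PGL R m * P, [/\ Gamma0 gx.1, Lambda gx.2,
    shadow Omega r (proj_act gx.1^-1%g b) b gx.2 &
    n%:R < `|fundamental_weight (val j) (iwasawa_cocycle (rho gx.1) (xi gx.2)) -
    fundamental_weight (val j) (kappa (rho gx.1))|].
  apply: contrapT => /forallNP no'; apply: (no n%:R) => g x Gg Lx sh.
  by rewrite leNgt; apply/negP => H; apply: (no' (g, x)).
have [gx gxP] := choice no.
pose g n := (gx n).1; pose x n := (gx n).2.
have Gg n : Gamma0 (g n) by have [] := gxP n.
have Lx n : Lambda (x n) by have [] := gxP n.
have sh n : shadow Omega r (proj_act (g n)^-1%g b) b (x n) by have [] := gxP n.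
have [disc autG vis _] := visible.
pose u n := `|fundamental_weight (val j) (iwasawa_cocycle (rho (g n)) (xi (x n))) -
    fundamental_weight (val j) (kappa (rho (g n)))|.
have nu n : n%:R < u n by have [] := gxP n.
have [[l lP]|[h hi [x0 [y0 [Lx0 Ly0 gx0 gy0]]]]] := escape Omega_open chart Cv0 disc autG Ob Gg.
  have [C CP] := cocycle_bounded j (rho l).
  apply: (@unbounded_absurd u (C + `|fundamental_weight (val j) (kappa (rho l))|) nu) => N.
  have [n Nn gl] := lP N; exists n => //; rewrite /u gl.
  by apply: le_trans (ler_normB _ _) _; rewrite lerD2r.
have Lxh n : Lambda (x (h n)) by exact: Lx.
have [s si [z Lz xz]] := limit_bolzano Omega_open chart Cv0 autG vis Lxh.
have gxs : (fun n => proj_act (g (h (s n))) b) @ \oo --> x0 by exact: (subseq_cvg si gx0).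
have gys : (fun n => proj_act (g (h (s n)))^-1%g b) @ \oo --> y0 by exact: (subseq_cvg si gy0).
have Ot n : Omega (proj_act (g (h (s n)))^-1%g b).
  by apply: (orbit_Omega autG) => //; exact: (GammaV disc).
have zy : z != y0.
  apply: (shadow_limit_neq Omega_open chart Cv0 Ot Ob (fun n => (Lx (h (s n))).1) Ly0.1
    (boundary_closure Lz.1) gys xz) => n; exact: sh.
have [kx kxE] := flag_frame (xi x0); have [hy hyE] := flag_frame (xi y0).
have Ghs n : Gamma0 (g (h (s n))) by exact: Gg.
have Lxhs n : Lambda (x (h (s n))) by exact: Lx.
have [q qi [C [N CP]]] := cocycle_kappa_subseq sym visible rep trans Ghs Ob Lx0 Ly0
  gxs gys kxE hyE j Lxhs Lz xz zy.
apply: (@unbounded_absurd u C nu) => M.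
exists (h (s (q (maxn N M)))); last exact: (CP _ (leq_maxl _ _)).
apply: leq_trans (leq_maxr N M) _; apply: leq_trans (subseq_ge qi _) _.
by apply: leq_trans (subseq_ge si _) _; exact: subseq_ge.
Qed.

Lemma shadow_functional_estimate (phi : {scalar a_theta R theta}) (r : R) :
  exists2 C : R, 0 <= C & forall g x, Gamma0 g -> Lambda x ->
  shadow Omega r (proj_act g^-1%g b) b x ->
  `|phi (iwasawa_cocycle (rho g) (xi x)) - phi (kappa_theta theta (rho g))| <= C.
Proof.
have [C0 C00 C0P] := functional_bound phi.
have [c cP] := choice (fun j : root_in theta => shadow_weight_estimate j r).
pose c' (j : root_in theta) := Num.max 0 (c j).
exists (C0 * \sum_(j : root_in theta) c' j).
  apply: mulr_ge0 => //; apply: sumr_ge0 => j _; by rewrite /c' le_max lexx.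
move=> g x Gg Lx sh; apply: le_trans (C0P _ _) _; apply: ler_wpM2l => //.
rewrite big_sub; apply: ler_sum => j _; rewrite kappa_thetaP ?(valP j)//.
by apply: le_trans (cP j g x Gg Lx sh) _; rewrite /c' le_max lexx orbT.
Qed.

End CocycleBound.

(** The integral of a nonnegative function is a supremum over the simple functions below it, hence
    monotone for arbitrary functions. This bypasses the measurability of the cocycle as a function
    of the flag. *)
Lemma ge0_le_integral_nonmeasurable (dd : measure_display) (T : measurableType dd)
    (R : realType) (mu : {measure set T -> \bar R}) (D : set T) (f g : T -> \bar R) :
  (forall x, D x -> (0 <= f x)%E) -> (forall x, D x -> (f x <= g x)%E) ->
  (\int[mu]_(x in D) f x <= \int[mu]_(x in D) g x)%E.
Proof.
move=> f0 fg; have g0 x : D x -> (0 <= g x)%E by move=> Dx; apply: le_trans (fg x Dx); exact: f0.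
rewrite (ge0_integralE _ f0) (ge0_integralE _ g0).
apply: le_ereal_sup => _ [h hf <-]; exists h => // x.
apply: le_trans (hf x) _; rewrite /patch; case: ifPn => // xD.
by apply: fg; exact: set_mem.
Qed.

(** * Lower bound for the mass of shadows *)

Section ShadowMass.
Context (R : realType) (k : scalar_kind) (d m : nat) (theta : {set 'I_d.-1}).
Local Notation K := (scalars R k).
Local Notation P := (projective_space R m).
Local Notation borel := (borel_flag K theta).
Hypothesis sym : symmetric_roots theta.
Context (Omega : set P) (f : 'rV[R]_m).
Hypothesis Omega_open : open Omega.
Hypothesis chart : convex_bounded_chart Omega f.
Context (v0 : 'cV[R]_m).
Hypothesis Cv0 : cone Omega f v0.
Context (Gamma0 : set (PGL R m)).
Hypothesis visible : projectively_visible Omega Gamma0.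
Hypothesis infinite : non_elementary Omega Gamma0.
Context (rho : PGL R m -> PSL K d) (xi : P -> flag K theta).
Hypothesis rep : representation Gamma0 rho.
Hypothesis trans : transverse_with_limit_map Omega Gamma0 rho xi.
Local Notation Lambda := (limit_set Omega Gamma0).
Context (phi : {scalar a_theta R theta}) (beta : R) (mu : probability borel R).
Hypothesis ps : patterson_sullivan (rho @` Gamma0) (xi @` Lambda) phi beta mu.
Context (b : P).
Hypothesis Ob : Omega b.

Lemma limit_point_measurable y : Lambda y -> measurable ([set xi y] : set borel).
Proof.
move=> Ly; rewrite -image_set1.
apply: (limit_image_measurable Omega_open chart Cv0 visible trans) => [x ->//|x z xy xz Lz].
apply: (proj_cvg_unique xz); rewrite (_ : x = fun=> y); first exact: cvg_cst.
by apply/funext => n; exact: xy.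
Qed.

Lemma limit_point_mass y : Lambda y -> mu [set xi y] != 1%E.
Proof.
move=> Ly; apply/negP => /eqP mass.
have [disc autG vis _] := visible.
have [_ eqv _ _] := trans.
apply: (no_global_fixed_point Omega_open chart Cv0 disc autG vis Ob _ infinite Ly).
  move=> s x z t t0 w Gs [Lx Lz sx sz] Lt Lt0 tt0 t0z Lst Lw stw.
  exact: (limit_attract sym visible rep trans Ob Gs Lx Lz sx sz Lt Lt0 tt0 t0z Lst Lw stw).
move=> g Gg; apply/eqP/contraT => gy.
have GV := GammaV disc Gg.
have g'y : proj_act g^-1%g y != y.
  by rewrite -(inj_eq (@proj_act_inj R m g)) -proj_actM mulgV proj_act1 eq_sym.
have Lg'y : Lambda (proj_act g^-1%g y) by exact: (limit_set_act Omega_open chart Cv0).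
have m1 := limit_point_measurable Ly; have m2 := limit_point_measurable Lg'y.
have [[_ inj _] _ _ _] := trans.
have mass0 : mu [set xi (proj_act g^-1%g y)] = 0%E.
  apply/eqP; rewrite eq_le measure_ge0 andbT.
  have <- : mu (~` [set xi y]) = 0%E by rewrite probability_setC// mass subee.
  apply: le_measure; rewrite ?inE//; first exact: measurableC.
  move=> F /= -> /inj; rewrite !in_setE => /(_ Lg'y Ly) E.
  by rewrite E eqxx in g'y.
(* The push-forward by [rho g] gives [xi y] the mass of [xi (g^-1 y)], which is zero; absolute
   continuity of [mu] with respect to it contradicts the mass 1. *)
have [_ /(_ (rho g) (ex_intro2 _ _ g Gg erefl))[_ dom _]] := ps.
have /dom/(_ _ m1 (fun _ H => H)) : null_set
    (pushforward mu (flag_act (rho g) : borel -> borel)) [set xi y].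
  move=> A mA /subset_set1[->|->]; rewrite /pushforward; first by rewrite preimage_set0 measure0.
  rewrite (_ : _ @^-1` _ = [set xi (proj_act g^-1%g y)])//.
  apply/seteqP; split=> [F /= E|F /= ->].
    rewrite (eqv _ _ GV Ly) -E (rhoV visible rep Gg) -flag_actM mulVg.
    by rewrite flag_act1.
  by rewrite -(eqv _ _ Gg Lg'y) -proj_actM mulgV proj_act1.
by rewrite mass => /eqP; rewrite onee_eq0.
Qed.

Lemma late_subseq (T : topologicalType) (u : nat -> T) (l : T) (a : nat -> nat) :
  (forall n, (n <= a n)%N) -> u @ \oo --> l -> (u \o a) @ \oo --> l.
Proof.
move=> na ul V /ul[N _ NV]; exists N => // n /= Nn.
by apply: NV => /=; exact: leq_trans (na n).
Qed.

Lemma shadow_mass_bound : exists R0 c : R, 0 < c /\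
  forall r g, R0 < r -> Gamma0 g ->
  (c%:E <= mu (xi @` (shadow Omega r (proj_act g^-1%g b) b `&` Lambda)))%E.
Proof.
have [disc autG vis _] := visible.
apply: contrapT => no.
have {}no (n : nat) : exists rg : R * PGL R m, [/\ n%:R < rg.1, Gamma0 rg.2 &
    (mu (xi @` (shadow Omega rg.1 (proj_act rg.2^-1%g b) b `&` Lambda)) < (n.+1%:R^-1)%:E)%E].
  apply: contrapT => /forallNP no'; apply: no; exists n%:R, n.+1%:R^-1; split.
    by rewrite invr_gt0.
  move=> r g nr Gg; rewrite leNgt; apply/negP => H; exact: (no' (r, g)).
have [rg rgP] := choice no.
pose r n := (rg n).1; pose g n := (rg n).2; pose t n := proj_act (g n)^-1%g b.
have nr n : n%:R < r n by have [] := rgP n.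
have Gg n : Gamma0 (g n) by have [] := rgP n.
have small n : (mu (xi @` (shadow Omega (r n) (t n) b `&` Lambda)) < (n.+1%:R^-1)%:E)%E.
  by have [] := rgP n.
have Ot n : Omega (t n) by apply: (orbit_Omega autG) => //; exact: (GammaV disc).
have [h hi [y cy ty]] := closure_bolzano Omega_open chart Cv0 (fun n => subset_closure (Ot n)).
(* The limit [y] may also lie in [Omega]. Then the shadows swallow the whole limit set and [mu]
   would be zero instead of a Dirac mass. *)
have yOL : Omega y \/ Lambda y.
  have [Oy|nOy] := pselect (Omega y); [by left|right].
  split; first exact: (closure_boundary Omega_open).
  by exists b, (fun n => (g (h n))^-1%g); split=> // n; exact: (GammaV disc).
(* These sets exhaust the limit set minus [y] and stay away from [y], so each is contained in the
   shadows from some index on. *)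
pose A (i : nat) := [set x | Lambda x /\ i.+1%:R^-1 <= chart_dist f x y].
have Lcl x : Lambda x -> closure Omega x by case=> -[].
have mA i : measurable (xi @` A i : set borel).
  apply: (limit_image_measurable Omega_open chart Cv0 visible trans) => [x []//|x z xA xz Lz].
  split=> //; apply: (chart_dist_ge Omega_open chart Cv0 _ (Lcl _ Lz) xz) => n.
    by apply: Lcl; have [] := xA n.
  by have [] := xA n.
have A_sub i : exists N, forall n, (N <= n)%N -> A i `<=` shadow Omega (r (h n)) (t (h n)) b.
  apply: contrapT => /forallNP noN.
  have {}noN N : exists nx : nat * P, [/\ (N <= nx.1)%N, A i nx.2 &
      ~ shadow Omega (r (h nx.1)) (t (h nx.1)) b nx.2].
    apply: contrapT => /forallNP no'; apply: (noN N) => n Nn x Ax.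
    by apply: contrapT => ns; exact: (no' (n, x)).
  have [nx nxP] := choice noN.
  have Lx n : Lambda (nx n).2 by have [_ []] := nxP n.
  have [s si [z Lz xz]] := limit_bolzano Omega_open chart Cv0 autG vis Lx.
  pose a n := (nx (s n)).1.
  have na n : (n <= a n)%N.
    by have [H _ _] := nxP (s n); apply: leq_trans H; exact: subseq_ge.
  have ta : (fun n => t (h (a n))) @ \oo --> y by exact: (late_subseq na ty).
  have zA : i.+1%:R^-1 <= chart_dist f z y.
    apply: (chart_dist_ge Omega_open chart Cv0 _ (Lcl _ Lz) xz) => n; first exact: (Lcl _ (Lx (s n))).
    by have [_ []] := nxP (s n).
  have zy : y != z.
    apply/negP => /eqP E; move: zA; rewrite E /chart_dist big1 => [|l _].
      by rewrite leNgt invr_gt0 ltr0n.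
    by rewrite subrr normr0.
  have [Cy yy _] := chart_vecP Omega_open chart Cv0 cy.
  have [Cz zz _] := chart_vecP Omega_open chart Cv0 (Lcl _ Lz).
  (* The sum is interior by visibility when [y] is a limit point, and because one summand is
     interior when [y] lies in [Omega]. *)
  have Cyz : cone Omega f (chart_vec f y + chart_vec f z).
    case: yOL => [Oy|Ly]; last exact: (visible_sum Omega_open chart Cv0 vis Ly Lz zy).
    rewrite addrC; apply: (ccone_addl Omega_open chart Cz).
    exact: (chart_vec_cone Omega_open chart Cv0).
  have [L [N NP]] := shadow_contains Omega_open chart Cv0 (fun n => Ot (h (a n))) Ob
    (fun n => (Lx (s n)).1) cy (Lcl _ Lz) ta xz Cyz.
  (* [L] depends on the limits only, while the radii exceed their index, so they eventually exceed
     [L]. *)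
  pose n := maxn N (Num.bound L).
  have [_ _ ns] := nxP (s n); apply: ns; apply: NP; first exact: leq_maxl.
  have LM : L < (Num.bound L)%:R.
    by have [L0|L0] := leP 0 L; [exact: archi_boundP|exact: lt_le_trans L0 (ler0n _ _)].
  apply: lt_trans LM _; apply: le_lt_trans (nr _); rewrite ler_nat.
  apply: leq_trans (leq_maxr N _) _; apply: leq_trans (na n) _; exact: subseq_ge.
have A0 i : mu (xi @` A i) = 0%E.
  have [N NP] := A_sub i.
  apply/eqP; rewrite eq_le measure_ge0 andbT; apply/lee_addgt0Pr => e e0; rewrite add0e.
  have [p pe] := real_small e0; pose n := maxn N p.
  apply: (@le_trans _ _ (mu (xi @` (shadow Omega (r (h n)) (t (h n)) b `&` Lambda)))).
    apply: le_measure; rewrite ?inE//.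
      exact: (shadow_image_measurable Omega_open chart Cv0 visible trans).
    by move=> _ [x Ax <-]; exists x => //; split; [apply: (NP n (leq_maxl _ _)) Ax|case: Ax].
  apply: le_trans (ltW (small (h n))) _; rewrite lee_fin; apply: le_trans (ltW pe).
  rewrite lef_pV2 ?posrE ?ltr0n// ler_nat ltnS.
  by apply: leq_trans (leq_maxr N p) _; exact: subseq_ge.
have negl : mu.-negligible (~` (xi @` Lambda) `|` \bigcup_i xi @` A i).
  apply: negligibleU; first by have [] := ps.
  by apply: negligible_bigcup => i; exists (xi @` A i); split; [exact: mA|exact: A0|].
have cover x : Lambda x -> x != y -> exists i, A i x.
  move=> Lx xy; have D0 := chart_dist_gt0 Omega_open chart Cv0 (Lcl _ Lx) cy xy.
  by have [i ii] := real_small D0; exists i; split=> //; exact: ltW.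
have [Ly|nLy] := pselect (Lambda y).
  have m1 := limit_point_measurable Ly.
  move/negP: (limit_point_mass Ly); apply.
  have : mu (~` [set xi y]) = 0%E.
    apply/negligibleP; first exact: measurableC.
    apply: negligibleS negl => F /= Fy.
    have [[x Lx xF]|nF] := pselect ((xi @` Lambda) F); [right|by left].
    have [i Ai] : exists i, A i x.
      by apply: cover => //; apply/negP => /eqP E; apply: Fy; rewrite -xF E.
    by exists i => //; exists x.
  move=> H; rewrite -[X in mu X]setCK probability_setC ?H ?sube0//.
  exact: measurableC.
have : mu setT = 0%E.
  apply/negligibleP => //; apply: negligibleS negl => F _.
  have [[x Lx xF]|nF] := pselect ((xi @` Lambda) F); [right|by left].
  have [i Ai] : exists i, A i x.
    by apply: cover => //; apply/negP => /eqP E; apply: nLy; rewrite -E.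
  by exists i => //; exists x.
by rewrite probability_setT => /eqP; rewrite onee_eq0.
Qed.

End ShadowMass.

Lemma expR_functional_bounds (R : realType) (beta x y C : R) : `|x - y| <= C ->
  (expR (`|beta| * C))^-1 * expR (- beta * y) <= expR (- beta * x) <=
  expR (`|beta| * C) * expR (- beta * y).
Proof.
move=> xy; have : `|- beta * x - - beta * y| <= `|beta| * C.
  by rewrite -mulrBr normrM normrN ler_wpM2l.
rewrite -expRN -!expRD !ler_expR ler_norml => /andP[h1 h2]; apply/andP; split; lra.
Qed.

Theorem proposition1p7 (R : realType) (k : scalar_kind) (d d0 : nat)
    (theta : {set 'I_d.-1})
    (Omega : set (projective_space R d0)) (Gamma0 : set (PGL R d0))
    (rho : PGL R d0 -> PSL (scalars R k) d)
    (xi : projective_space R d0 -> flag (scalars R k) theta)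
    (phi : {scalar a_theta R theta}) (beta : R)
    (mu : probability (borel_flag (scalars R k) theta) R) :
  symmetric_roots theta ->
  properly_convex_domain Omega ->
  projectively_visible Omega Gamma0 ->
  non_elementary Omega Gamma0 ->
  representation Gamma0 rho ->
  transverse_with_limit_map Omega Gamma0 rho xi ->
  patterson_sullivan (rho @` Gamma0) (xi @` limit_set Omega Gamma0)
    phi beta mu ->
  forall b0 : projective_space R d0, Omega b0 ->
  exists R0 : R, forall r : R, R0 < r ->
  exists2 C : R, 1 < C &
    forall gamma : PGL R d0, Gamma0 gamma ->
      let shadow_limit :=
        shadow Omega r b0 (proj_act gamma b0) `&`
        limit_set Omega Gamma0 in
      let e := expR (- beta * phi (kappa_theta theta (rho gamma))) in
      ((C^-1 * e)%:E <= mu (xi @` shadow_limit) <= (C * e)%:E)%E.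
Proof.
move=> sym [openO [f chart]] visible infinite rep trans ps b Ob.
have [v0 Cv0 _] := exists_cone chart Ob.
have [R0 [c [c0 mass]]] := shadow_mass_bound sym openO chart Cv0 visible infinite rep trans ps Ob.
exists R0 => r R0r.
have [C C0 CP] := shadow_functional_estimate sym openO chart Cv0 visible rep trans Ob phi r.
pose E := expR (`|beta| * C); have E0 : 0 < E by exact: expR_gt0.
have Ec0 : 0 < E / c by rewrite divr_gt0.
(* [E] serves the upper bound and [E / c] the lower one; the summand 1 makes the constant larger
   than 1. *)
exists (1 + E + E / c); first by rewrite -addrA ltrDl addr_gt0.
move=> gamma Gg; cbv zeta.
set S := _ `&` _; set e := expR (- _ * phi (kappa_theta _ _)).
have e0 : 0 < e by exact: expR_gt0.
have [disc autG vis _] := visible; have [_ eqv _ _] := trans.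
have GV := GammaV disc Gg.
have Ogb : Omega (proj_act gamma^-1%g b) by exact: (orbit_Omega autG).
set A : set (borel_flag (scalars R k) theta) :=
  xi @` (shadow Omega r (proj_act gamma^-1%g b) b `&` limit_set Omega Gamma0).
have mA : measurable A by exact: (shadow_image_measurable openO chart Cv0 visible trans).
(* Applied to the inverse, so that the density involves the cocycle of [rho gamma] itself; the
   pushed-forward mass of [A] is the mass of the image of [S]. *)
have [_ /(_ (rho gamma^-1%g) (ex_intro2 _ _ _ GV erefl))[_ _ /(_ A mA)]] := ps.
have -> : pushforward mu (flag_act (rho gamma^-1%g) :
    borel_flag (scalars R k) theta -> borel_flag (scalars R k) theta) A = mu (xi @` S).
  rewrite /pushforward; congr (mu _); apply/seteqP; split=> [F [x [sx Lx] xF]|_ [x [sx Lx] <-]].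
    exists (proj_act gamma x).
      split; last exact: (limit_set_act openO chart Cv0).
      have := shadow_act openO chart Cv0 (autG _ Gg) Ogb Ob sx.
      by rewrite -proj_actM mulgV proj_act1.
    rewrite eqv// xF (rhoV visible rep Gg) -flag_actM mulgV.
    by rewrite flag_act1.
  exists (proj_act gamma^-1%g x); last by rewrite eqv.
  split; last exact: (limit_set_act openO chart Cv0).
  have := shadow_act openO chart Cv0 (autG _ GV) Ob (orbit_Omega autG Gg Ob) sx.
  by rewrite -proj_actM mulVg proj_act1.
rewrite (rhoV visible rep Gg) invgK => muS.
have bounds F : A F -> E^-1 * e <= expR (- beta * phi (iwasawa_cocycle (rho gamma) F)) <= E * e.
  by move=> [x [sx Lx] <-]; apply: expR_functional_bounds; exact: CP.
have Ee0 : 0 <= E^-1 * e by rewrite mulr_ge0// ltW// invr_gt0.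
have lower : ((E^-1 * e)%:E * mu A <= mu (xi @` S))%E.
  rewrite muS -integral_cst//; apply: ge0_le_integral_nonmeasurable => F AF.
    by rewrite lee_fin.
  by rewrite lee_fin; have /andP[] := bounds F AF.
have upper : (mu (xi @` S) <= (E * e)%:E * mu A)%E.
  rewrite muS -integral_cst//; apply: ge0_le_integral_nonmeasurable => F AF.
    by rewrite lee_fin expR_ge0.
  by rewrite lee_fin; have /andP[] := bounds F AF.
have C1 : 0 < 1 + E + E / c by rewrite !addr_gt0.
have E1 : 0 <= 1 + E by rewrite addr_ge0// (ltW E0).
have lowC : (1 + E + E / c)^-1 <= E^-1 * c.
  have -> : E^-1 * c = (E / c)^-1 by rewrite invf_div mulrC.
  by rewrite lef_pV2 ?posrE// lerDr.
have upC : E <= 1 + E + E / c.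
  by rewrite addrAC lerDr addr_ge0// (ltW Ec0).
apply/andP; split.
  apply: le_trans lower; apply: (@le_trans _ _ ((E^-1 * e)%:E * c%:E)%E).
    by rewrite -EFinM lee_fin mulrAC ler_wpM2r// (ltW e0).
  by apply: lee_wpmul2l; [rewrite lee_fin|exact: mass].
(* For the upper bound the mass of [A] is estimated by 1; the lower bound used [mass]. *)
apply: le_trans upper _; apply: (@le_trans _ _ ((E * e)%:E * 1)%E).
  by apply: lee_wpmul2l; [rewrite lee_fin mulr_ge0// ltW|exact: probability_le1].
by rewrite mule1 lee_fin ler_wpM2r// (ltW e0).
Qed.
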